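(* Let $m$ and $n$ be positive integers and put $\kappa:=2m+2n+2$. Then, as identities of formal power series in $q$, \[ \sum_{\substack{\lambda \\ \lambda_1\leq m}} q^{|\lambda|} P_{2\lambda}\big(1,q,q^2,\dots;q^{2n}\big) =\frac{(q^2;q^2)_{\infty}(q^{\kappa/2};q^{\kappa/2})_{\infty}(q^{\kappa};q^{\kappa})_{\infty}^{n-1}}{(q;q)_{\infty}^{n+1}}\prod_{i=1}^n \theta\big(q^{i};q^{\kappa/2}\big)\prod_{1\leq i<j\leq n}\theta\big(q^{j-i},q^{i+j};q^{\kappa}\big) =\frac{(q^{\kappa};q^{\kappa})_{\infty}^m}{(q;q)_{\infty}^m}\prod_{i=1}^m \theta\big(q^{i+1};q^{\kappa}\big)\prod_{1\leq i<j\leq m}\theta\big(q^{j-i},q^{i+j+1};q^{\kappa}\big), \] where the sum is over all integer partitions $\lambda$ with largest part $\lambda_1\le m$.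
   Context: A partition $\lambda=(\lambda_1\ge\lambda_2\ge\cdots)$ is a weakly decreasing sequence of nonnegative integers with finitely many nonzero terms; $|\lambda|=\sum_i\lambda_i$, $\ell(\lambda)$ is the number of nonzero parts, and $2\lambda:=(2\lambda_1,2\lambda_2,\dots)$. For $k\ge0$, $(a;q)_k=\prod_{j=0}^{k-1}(1-aq^j)$ and $(a;q)_\infty=\prod_{j\ge0}(1-aq^j)$. The modified theta function is $\theta(a;q):=(a;q)_\infty(q/a;q)_\infty$, and $\theta(a_1,\dots,a_k;q):=\theta(a_1;q)\cdots\theta(a_k;q)$. Hall–Littlewood polynomials: for variables $x=(x_1,\dots,x_N)$, a parameter $t$ and a partition $\lambda$ with $\ell(\lambda)\le N$, let $m_i$ be the number of parts of $\lambda$ equal to $i$ ($m_0:=N-\ell(\lambda)$), $v_\lambda(t)=\prod_{i\ge0}(t;t)_{m_i}/(1-t)^{m_i}$, and $P_\lambda(x;t)=\frac{1}{v_\lambda(t)}\sum_{w\in\mathfrak S_N} w\Big(x_1^{\lambda_1}\cdots x_N^{\lambda_N}\prod_{i<j}\frac{x_i-tx_j}{x_i-x_j}\Big)$, where $\mathfrak S_N$ permutes the variables; $P_\lambda:=0$ if $\ell(\lambda)>N$. These define Hall–Littlewood symmetric functions in infinitely many variables; $P_\lambda(1,q,q^2,\dots;t)$ denotes the specialization $x_i=q^{i-1}$ ($i\ge1$), i.e. the $N\to\infty$ limit of $P_\lambda(1,q,\dots,q^{N-1};t)$ as a formal power series in $q$. Here $t=q^{2n}$. *)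

(* Defs.v *)
From HB Require Import structures.
From mathcomp Require Import all_boot all_order all_fingroup all_algebra.
From mathcomp Require Import boolp classical_sets.

Set Implicit Arguments.
Unset Strict Implicit.
Unset Printing Implicit Defensive.

Import GRing.Theory.
Local Open Scope ring_scope.

Record fps (R : Type) := Fps { fcoef : nat -> R }.

Section FormalPowerSeries.
Variable R : idomainType.
Implicit Types f g h : fps R.

Lemma fpsP f g : (forall k, fcoef f k = fcoef g k) -> f = g.
Proof. by case: f g => f [g] /= fg; congr Fps; apply/funext. Qed.

HB.instance Definition _ := gen_eqMixin (fps R).
HB.instance Definition _ := gen_choiceMixin (fps R).

Definition fps0 : fps R := Fps (fun=> 0).
Definition fps1 : fps R := Fps (fun k => (k == 0%N)%:R).
Definition fpsX : fps R := Fps (fun k => (k == 1%N)%:R).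
Definition fps_opp f : fps R := Fps (fun k => - fcoef f k).
Definition fps_add f g : fps R := Fps (fun k => fcoef f k + fcoef g k).
Definition fps_mul f g : fps R :=
  Fps (fun k => \sum_(i < k.+1) fcoef f i * fcoef g (k - i)).

Lemma fps_addA : associative fps_add.
Proof. by move=> f g h; apply: fpsP => k /=; rewrite addrA. Qed.
Lemma fps_addC : commutative fps_add.
Proof. by move=> f g; apply: fpsP => k /=; rewrite addrC. Qed.
Lemma fps_add0 : left_id fps0 fps_add.
Proof. by move=> f; apply: fpsP => k /=; rewrite add0r. Qed.
Lemma fps_addN : left_inverse fps0 fps_opp fps_add.
Proof. by move=> f; apply: fpsP => k /=; rewrite addNr. Qed.

HB.instance Definition _ :=
  GRing.isZmodule.Build (fps R) fps_addA fps_addC fps_add0 fps_addN.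

Definition fps_trunc n f : {poly R} := \poly_(i < n) fcoef f i.

Lemma coef_fps_mul_trunc n k f g : (k < n)%N ->
  fcoef (fps_mul f g) k = (fps_trunc n f * fps_trunc n g)`_k.
Proof.
move=> kn; rewrite coefM /=; apply: eq_bigr => i _; rewrite !coef_poly.
by rewrite (leq_ltn_trans _ kn) ?leq_ord // (leq_ltn_trans (leq_subr _ _) kn).
Qed.

Lemma fps_mulC : commutative fps_mul.
Proof.
by move=> f g; apply: fpsP => k; rewrite !(@coef_fps_mul_trunc k.+1) // mulrC.
Qed.

Lemma fps_mulA : associative fps_mul.
Proof.
move=> f g h; apply: fpsP => k.
transitivity ((fps_trunc k.+1 f * (fps_trunc k.+1 g * fps_trunc k.+1 h))`_k).
  rewrite coefM /=; apply: eq_bigr => i _.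
  by rewrite coef_poly ltn_ord -coef_fps_mul_trunc // ltnS leq_subr.
rewrite mulrA coefM /=; apply: eq_bigr => i _.
by rewrite -coef_fps_mul_trunc ?ltn_ord //= coef_poly ltnS leq_subr.
Qed.

Lemma fps_mul1 : left_id fps1 fps_mul.
Proof.
move=> f; apply: fpsP => k /=; rewrite big_ord_recl /= mul1r subn0.
by rewrite big1 ?addr0 // => i _; rewrite mul0r.
Qed.

Lemma fps_mulDl : left_distributive fps_mul fps_add.
Proof.
move=> f g h; apply: fpsP => k /=.
by rewrite -big_split; apply: eq_bigr => i _; rewrite mulrDl.
Qed.

Lemma fps1_neq0 : fps1 != 0.
Proof.
by apply/eqP => /(congr1 (fun f => fcoef f 0)) /= /eqP; rewrite oner_eq0.
Qed.

HB.instance Definition _ := GRing.Zmodule_isComNzRing.Build (fps R)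
  fps_mulA fps_mulC fps_mul1 fps_mulDl fps1_neq0.

Definition fps_unit : {pred fps R} := fun f => `[< exists g, g * f = 1 >].
Definition fps_inv f : fps R := xget f [set g | g * f = 1].

Lemma fps_mulV : {in fps_unit, left_inverse 1 fps_inv *%R}.
Proof.
by move=> f /asboolP[g gf]; rewrite /fps_inv; case: xgetP => // /(_ g)/(_ gf).
Qed.
Lemma fps_unitP f g : g * f = 1 -> fps_unit f.
Proof. by move=> gf; apply/asboolP; exists g. Qed.
Lemma fps_inv_out : {in [predC fps_unit], fps_inv =1 id}.
Proof.
move=> f /negP nf; rewrite /fps_inv; case: xgetP => // g _ gf.
by case: nf; apply: fps_unitP gf.
Qed.

HB.instance Definition _ := GRing.ComNzRing_hasMulInverse.Build (fps R)
  fps_mulV fps_unitP fps_inv_out.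

Lemma fps_neq0_val f : f != 0 ->
  exists2 k, fcoef f k != 0 & forall i, (i < k)%N -> fcoef f i = 0.
Proof.
move=> f0; have /ex_minnP[k fk kmin] : exists k, fcoef f k != 0.
  apply: contrapT => all0; case/eqP: f0; apply: fpsP => k; apply/eqP.
  by apply: contraT => fk; case: all0; exists k.
exists k => // i ik; apply/eqP; apply: contraLR ik => /kmin.
by rewrite -leqNgt.
Qed.

Lemma fps_mulf_eq0 f g : f * g = 0 -> (f == 0) || (g == 0).
Proof.
move=> fg0; apply: contraT; rewrite negb_or => /andP[].
move=> /fps_neq0_val[a fa mina] /fps_neq0_val[b gb minb].
have := congr1 (fun f => fcoef f (a + b)%N) fg0; rewrite /=.
have alt : (a < (a + b).+1)%N by rewrite ltnS leq_addr.
rewrite (bigD1 (Ordinal alt)) //= addKn big1 ?addr0 => [/eqP|i].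
  by rewrite mulf_eq0 (negPf fa) (negPf gb).
rewrite -val_eqE /= neq_ltn => /orP[/mina->|ai]; first by rewrite mul0r.
rewrite minb ?mulr0 // ltn_subLR ?ltn_add2r //.
by rewrite -ltnS ltn_ord.
Qed.

HB.instance Definition _ :=
  GRing.ComUnitRing_isIntegral.Build (fps R) fps_mulf_eq0.

End FormalPowerSeries.

(* Q((q)).  Identities between formal power series are stated in this field,
   into which Q[[q]] embeds, because theta(a; q) and the Hall-Littlewood
   formula divide by non-units of Q[[q]]. *)
Definition laurent := {fraction (fps rat)}.

Local Notation "x %:F" := (@FracField.tofrac (fps rat) x).

Definition q : laurent := (fpsX rat)%:F.

(* a = b modulo q^d Q[[q]]; for two power series: same coefficients below d *)
Definition eqmodq (d : nat) (a b : laurent) : Prop :=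
  exists h : fps rat, a - b = q ^+ d * h%:F.

Definition converges_to (u : nat -> laurent) (l : laurent) : Prop :=
  forall d, exists N0, forall N, (N0 <= N)%N -> eqmodq d (u N) l.

(* 0 when [u] has no limit *)
Definition limq (u : nat -> laurent) : laurent :=
  xget 0 [set l | converges_to u l].

(* Unconditional summability of the family [f] over [A], with sum [l]. *)
Definition has_sum (I : eqType) (A : pred I) (f : I -> laurent)
    (l : laurent) : Prop :=
  forall d, exists2 s0 : seq I, all A s0 &
    forall s, uniq s -> all A s -> {subset s0 <= s} ->
      eqmodq d (\sum_(i <- s) f i) l.

Definition qpoch (K : fieldType) (a p : K) (k : nat) : K :=
  \prod_(0 <= j < k) (1 - a * p ^+ j).

Definition qpoch_inf (a p : laurent) : laurent := limq (qpoch a p).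

Definition theta (a p : laurent) : laurent :=
  qpoch_inf a p * qpoch_inf (p / a) p.

(* A partition is given by the list of its nonzero parts, in weakly decreasing
   order; thus l(la) = size la, and la_(i+1) = nth 0 la i. *)
Definition is_partition : pred (seq nat) :=
  fun la => sorted geq la && (0%N \notin la).

Definition double_partition (la : seq nat) : seq nat :=
  [seq (2 * p)%N | p <- la].

(* The number of parts of la_1, ..., la_N equal to i; for i = 0 this is
   N - l(la). *)
Definition multiplicity (N : nat) (la : seq nat) (i : nat) : nat :=
  \sum_(j < N) (nth 0 la j == i).

Section HallLittlewood.
Variables (K : fieldType) (N : nat).

(* The factors with i > la_1 are equal to 1. *)
Definition HL_v (la : seq nat) (t : K) : K :=
  \prod_(0 <= i < (nth 0 la 0).+1)
    (qpoch t t (multiplicity N la i) / (1 - t) ^+ multiplicity N la i).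

(* The value of P_la at a point [x] with pairwise distinct coordinates of a
   field (and t not a root of unity): no denominator of the defining formula
   vanishes there.  Taking for [x] the variables of a field of rational
   functions gives the polynomial itself. *)
Definition HL_P (la : seq nat) (x : 'I_N -> K) (t : K) : K :=
  if (size la <= N)%N then
    (HL_v la t)^-1 *
    \sum_(w : 'S_N)
      ((\prod_(i < N) x (w i) ^+ nth 0 la i) *
       \prod_(i < N) \prod_(j < N | (i < j)%N)
         ((x (w i) - t * x (w j)) / (x (w i) - x (w j))))
  else 0.

End HallLittlewood.

(* P_la(1, q, ..., q^(N-1); t) and P_la(1, q, q^2, ...; t) *)
Definition HL_principal_fin (la : seq nat) (t : laurent) (N : nat) : laurent :=
  HL_P la (fun i : 'I_N => q ^+ i) t.

Definition HL_principal (la : seq nat) (t : laurent) : laurent :=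
  limq (HL_principal_fin la t).

(* Main.v *)
(** Put kap(x, y) = (x - t y)/(x - y).  For a finite alphabet s let F_m(s) be
    the sum, over all maps level : s -> {0, ..., m}, of the product of the
    (z y^2)^(level y) and of the kap(x, y) with level x > level y; it equals
    sum_(la_1 <= m) z^|la| P_(2 la)(s; t).  In the convolution algebra where
    f * g sums f(a) g(b) prod kap(x, y) over the splittings s = a + b, F_m is an
    iterated product.  A constant-term identity, proved by counting the roots of
    a polynomial, inverts one of the factors and turns F_m(s) into a sum over
    the choices of y or 1/(z y) for each y in s.

    For s = {1, q, ..., q^(2nR-1)}, z = q and t = q^(2n) the alphabet is a union
    of n strings of ratio t, and a choice has nonzero weight only if it flips an
    initial segment of each (shifted) string; F_m(s) becomes a sum over
    [-R, R]^n of determinants of theta type.  The constant-term identity for n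
    strings of ratio q^(2k), k = m + n + 1, writes (q^k; q^2k)_(2nR) as another
    such sum, and both sums are expansions of one determinant, along rows and
    along columns.  Letting R tend to infinity gives F_m up to a factor
    independent of m, which is found from F_0 = 1.  The equality of the two
    products is a comparison of the exponents of the factors 1 - q^k. *)

From HB Require Import structures.
Require Import Defs.
From mathcomp Require Import all_boot all_order all_fingroup all_algebra.
From mathcomp Require Import boolp classical_sets zify ring.

Set Implicit Arguments.
Unset Strict Implicit.
Unset Printing Implicit Defensive.

Import Order.TTheory GRing.Theory Num.Theory.
Local Open Scope ring_scope.

(** * Splittings and ordered pairs of a list *)

(** Write [k] for multiplication by the kth power of prod z y^2, which respects the convolution
    product. Then F_m = [m]1 * [m-1]1 * ... * [0]1. The constant-term identity gives a factorization
    1 = A * B, and a second instance of it says that [1]B is inverse to A. Hence [k]B and the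
    following [k-1]A cancel, and the product collapses to [m]A * B. So m survives only as the
    exponent of one monomial. On n strings this exponent joins the Gaussian factors: each string
    alone gives the power m + 2 and its n - 1 partners give n - 1 more, in total k = m + n + 1. The
    determinant entries become sums over r of powers with exponent 2nk r^2 - k(2i+1)r - 2n(j+1)r +
    i(j+1), minus a mirror term. Here (k, i) and (n, j) play parallel roles, so transposition
    exchanges the ratios q^(2n) and q^(2k); this dictates the second alphabet. Every identity before
    the limit is exact for finite R. The common sum is never evaluated: it is eliminated between the
    two formulas, and no infinite theta or determinant identity is needed. *)

Definition perm_invariant (T : eqType) (V : Type) (E : seq T -> V) :=
  forall s1 s2, perm_eq s1 s2 -> E s1 = E s2.

Section Lists.
Variable (T : eqType).
Implicit Types (x : T) (s : seq T).

Lemma perm_invariant_cons V (E : seq T -> V) x :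
  perm_invariant E -> perm_invariant (fun s => E (x :: s)).
Proof. by move=> invE s1 s2 s12; apply: invE; rewrite perm_cons. Qed.

Fixpoint splits s : seq (seq T * seq T) :=
  if s is x :: s' then
    [seq (x :: p.1, p.2) | p <- splits s'] ++
    [seq (p.1, x :: p.2) | p <- splits s']
  else [:: ([::], [::])].

Lemma splits_perm s p : p \in splits s -> perm_eq (p.1 ++ p.2) s.
Proof.
elim: s p => [|x s IHs] p /=; first by rewrite inE => /eqP->.
rewrite mem_cat => /orP[] /mapP[[a b] /IHs /= ab ->] /=.
  by rewrite perm_cons.
by rewrite -cat1s perm_catCA /= perm_cons.
Qed.

Fixpoint picks s : seq (T * seq T) :=
  if s is x :: s' then (x, s') :: [seq (p.1, x :: p.2) | p <- picks s']
  else [::].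

Lemma picks_perm s p : p \in picks s -> perm_eq (p.1 :: p.2) s.
Proof.
elim: s p => [|x s IHs] p //=; rewrite inE => /predU1P[->//|].
case/mapP=> [[a b] /IHs /= ab ->] /=.
rewrite -(perm_cons x) in ab; apply: perm_trans ab.
exact: permEl (perm_catCA [:: a] [:: x] b).
Qed.

Section Sums.
Variable R : comNzRingType.

Lemma big_splits_cons x s (F : seq T * seq T -> R) :
  \sum_(p <- splits (x :: s)) F p =
  \sum_(p <- splits s) (F (x :: p.1, p.2) + F (p.1, x :: p.2)).
Proof. by rewrite /= big_cat !big_map big_split. Qed.

Lemma big_splits_nil (F : seq T * seq T -> R) :
  \sum_(p <- splits [::]) F p = F ([::], [::]).
Proof. by rewrite big_seq1. Qed.

(** Both sides deal the letters of [s] into three lists. This yields the associativity of [conv]. *)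
Lemma splits_assoc (E : seq T -> seq T -> seq T -> R) s :
  \sum_(p <- splits s) \sum_(r <- splits p.1) E r.1 r.2 p.2 =
  \sum_(p <- splits s) \sum_(r <- splits p.2) E p.1 r.1 r.2.
Proof.
elim: s E => [|x s IHs] E; first by rewrite !big_splits_nil.
rewrite !big_splits_cons; under eq_bigr do rewrite big_splits_cons /=.
rewrite big_split /=.
under [RHS]eq_bigr do rewrite addrC big_splits_cons /=.
rewrite big_split /=.
transitivity (\sum_(p <- splits s) \sum_(r <- splits p.1) E (x :: r.1) r.2 p.2 +
 \sum_(p <- splits s) \sum_(r <- splits p.1) E r.1 (x :: r.2) p.2 +
 \sum_(p <- splits s) \sum_(r <- splits p.1) E r.1 r.2 (x :: p.2)).
  by congr (_ + _); rewrite -big_split; apply: eq_bigr => p _; rewrite big_split.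
rewrite (IHs (fun a b c => E (x :: a) b c)) (IHs (fun a b c => E a (x :: b) c)).
rewrite (IHs (fun a b c => E a b (x :: c))) -addrA addrC; congr (_ + _).
by rewrite -big_split; apply: eq_bigr => p _; rewrite big_split.
Qed.

Lemma splits_cat (E : seq T -> seq T -> R) s1 s2 :
  \sum_(p <- splits (s1 ++ s2)) E p.1 p.2 =
  \sum_(p <- splits s1) \sum_(r <- splits s2) E (p.1 ++ r.1) (p.2 ++ r.2).
Proof.
elim: s1 E => [|x s1 IHs] E; first by rewrite big_splits_nil.
rewrite cat_cons !big_splits_cons big_split /=.
rewrite (IHs (fun a b => E (x :: a) b)) (IHs (fun a b => E a (x :: b))).
by rewrite -big_split.
Qed.

Lemma splits_perm_sum (E : seq T -> seq T -> R) s1 s2 :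
  (forall b, perm_invariant (E^~ b)) -> (forall a, perm_invariant (E a)) ->
  perm_eq s1 s2 ->
  \sum_(p <- splits s1) E p.1 p.2 = \sum_(p <- splits s2) E p.1 p.2.
Proof.
move=> invl invr.
apply: (catCA_perm_subst (F := fun s => \sum_(p <- splits s) E p.1 p.2)).
move=> a b c; rewrite !splits_cat.
have cat3 a' b' : \sum_(p <- splits a') \sum_(r <- splits (b' ++ c))
    E (p.1 ++ r.1) (p.2 ++ r.2) = \sum_(p <- splits a') \sum_(r <- splits b')
    \sum_(o <- splits c) E (p.1 ++ r.1 ++ o.1) (p.2 ++ r.2 ++ o.2).
  by apply: eq_bigr => p _; rewrite (splits_cat (fun u v => E (p.1 ++ u) (p.2 ++ v))).
rewrite !cat3 exchange_big /=.
apply: eq_bigr => p _; apply: eq_bigr => r _; apply: eq_bigr => o _.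
by rewrite (invl _ _ _ (permEl (perm_catCA _ _ _))) (invr _ _ _ (permEl (perm_catCA _ _ _))).
Qed.

(** Applied later with [P] selecting the letters of maximal level, among which the first letter of
    an ordering is chosen. *)
Lemma big_picks_filter (P : pred T) (E : T -> seq T -> R) s :
  \sum_(p <- picks s | P p.1) E p.1 (filter P p.2) =
  \sum_(p <- picks (filter P s)) E p.1 p.2.
Proof.
elim: s E => [|x s IHs] E; first by rewrite !big_nil.
rewrite /= big_cons big_map /=; case: ifP => Px.
  by rewrite big_cons big_map /= Px (IHs (fun y u => E y (x :: u))).
by rewrite -IHs /=; apply: eq_bigr => p _; rewrite Px.
Qed.

Fixpoint pairs (g : T -> T -> R) s : R :=
  if s is x :: s' then (\prod_(y <- s') g x y) * pairs g s' else 1.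

Lemma pairs_cat g s1 s2 : pairs g (s1 ++ s2) =
  pairs g s1 * pairs g s2 * \prod_(x <- s1) \prod_(y <- s2) g x y.
Proof.
elim: s1 => [|x s1 IHs] /=; first by rewrite big_nil mulr1 mul1r.
by rewrite IHs big_cat big_cons /=; ring.
Qed.

Lemma pairs_perm g : (forall x y, g x y = g y x) -> perm_invariant (pairs g).
Proof.
move=> symg; apply: catCA_perm_subst => a b c; rewrite !pairs_cat.
have catE u v w : \prod_(x <- u) \prod_(y <- v ++ w) g x y =
    (\prod_(x <- u) \prod_(y <- v) g x y) * \prod_(x <- u) \prod_(y <- w) g x y.
  by rewrite -big_split; apply: eq_bigr => x _; rewrite big_cat.
rewrite !catE [\prod_(x <- b) \prod_(y <- a) _]exchange_big /=.
under [\prod_(j <- a) \prod_(i <- b) _]eq_bigr => x _.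
  under eq_bigr => y _ do rewrite symg.
  over.
by ring.
Qed.

Lemma eq_pairs g g' s : {in s &, g =2 g'} -> pairs g s = pairs g' s.
Proof.
elim: s => //= x s IHs gg'; rewrite IHs => [|y y' ys y's]; last first.
  by apply: gg'; rewrite inE ?ys ?y's orbT.
congr (_ * _); apply: eq_big_seq => y ys.
by apply: gg'; rewrite inE ?ys ?eqxx ?orbT.
Qed.

End Sums.

End Lists.

Lemma pairs_map (T T' : eqType) (R : comNzRingType) (f : T' -> T) (g : T -> T -> R) s :
  pairs g (map f s) = pairs (fun x y => g (f x) (f y)) s.
Proof. by elim: s => //= x s ->; rewrite big_map. Qed.

(** * Sums over reflections of an alphabet *)

Section Reflection.
Variables (K : fieldType) (z t : K).
Implicit Types (x y : K) (s h : seq K).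

(** Reflecting one argument turns the symmetric factor into the Hall-Littlewood one:
    [fq (z * refl x * y)] is [fq (y / x)], that is [kap x y]. This links sums over reflections to
    convolutions. *)
Definition refl x : K := (z * x)^-1.

Fixpoint configs s : seq (seq K) :=
  if s is x :: s' then
    [seq x :: h | h <- configs s'] ++ [seq refl x :: h | h <- configs s']
  else [:: [::]].

Lemma big_configs_cons x s (E : seq K -> K) :
  \sum_(h <- configs (x :: s)) E h =
  \sum_(h <- configs s) E (x :: h) + \sum_(h <- configs s) E (refl x :: h).
Proof. by rewrite /= big_cat !big_map. Qed.

Lemma configs_splits s (E : seq K -> K) : perm_invariant E ->
  \sum_(h <- configs s) E h =
  \sum_(p <- splits s) E (map refl p.1 ++ p.2).
Proof.
elim: s E => [|x s IHs] E invE; first by rewrite big_splits_nil big_seq1.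
rewrite big_configs_cons big_splits_cons big_split /= addrC.
rewrite (IHs _ (perm_invariant_cons x invE)) (IHs _ (perm_invariant_cons _ invE)).
congr (_ + _); apply: eq_bigr => p _; apply: invE.
by rewrite perm_sym -cat1s perm_catCA.
Qed.

Lemma configs_cat s1 s2 (E : seq K -> K) :
  \sum_(h <- configs (s1 ++ s2)) E h =
  \sum_(h1 <- configs s1) \sum_(h2 <- configs s2) E (h1 ++ h2).
Proof.
elim: s1 E => [|x s IHs] E; first by rewrite big_seq1.
by rewrite cat_cons !big_configs_cons !IHs.
Qed.

Lemma configs_perm_sum s1 s2 (E : seq K -> K) : perm_invariant E ->
  perm_eq s1 s2 -> \sum_(h <- configs s1) E h = \sum_(h <- configs s2) E h.
Proof.
move=> invE s12; rewrite !configs_splits //.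
apply: (splits_perm_sum (E := fun a b => E (map refl a ++ b))) s12.
  by move=> b a a' aa'; apply: invE; rewrite perm_cat2r perm_map.
by move=> a b b' bb'; apply: invE; rewrite perm_cat2l.
Qed.

Definition fq y : K := (1 - t * y) / (1 - y).

Definition weight (phi : K -> K) h : K :=
  (\prod_(x <- h) phi x) * pairs (fun x y => fq (z * x * y)) h.

Lemma weight_perm phi : perm_invariant (weight phi).
Proof.
move=> h1 h2 h12; rewrite /weight (perm_big _ h12) (pairs_perm _ h12) //.
by move=> x y; rewrite mulrAC.
Qed.

Definition Gsum phi s : K := \sum_(h <- configs s) weight phi h.

(** The case [x = y] of the last condition keeps [1 - z * x ^+ 2] away from 0. Altogether the
    letters and their reflections are pairwise distinct and nonzero, which gives the roots counted
    below. *)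
Definition generic s :=
  [&& uniq s, 0 \notin s & all (fun x => all (fun y => z * x * y != 1) s) s].

Lemma genericP s : reflect
  [/\ uniq s, {in s, forall x, x != 0} & {in s &, forall x y, z * x * y != 1}]
  (generic s).
Proof.
apply: (iffP and3P) => -[us s0 sz]; split=> //.
- by move=> x xs; apply: contraNneq s0 => <-.
- by move=> x y xs ys; move/allP/(_ x xs)/allP/(_ y ys): sz.
- by apply/negP => /s0; rewrite eqxx.
by apply/allP=> x xs; apply/allP=> y ys; apply: sz.
Qed.

Lemma sub_generic s s' : uniq s' -> {subset s' <= s} -> generic s -> generic s'.
Proof.
move=> us' ss' /genericP[us s0 sz]; apply/genericP; split=> // [x|x y] xs.
  by apply: s0; apply: ss'.
by move=> ys; apply: sz; apply: ss'.
Qed.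

Lemma generic_cons x s : generic (x :: s) -> generic s.
Proof.
move=> gs; apply: sub_generic (gs); first by case/genericP: gs => /andP[].
by move=> y ys; rewrite inE ys orbT.
Qed.

Lemma generic_perm s s' : perm_eq s s' -> generic s -> generic s'.
Proof.
move=> ss' gs; apply: sub_generic (gs).
  by rewrite -(perm_uniq ss'); case/genericP: gs.
by move=> x; rewrite (perm_mem ss').
Qed.

Hypothesis z0 : z != 0.

(** * The constant-term identity *)

Section ConstantTerm.
Variables e f a b : K.

Let phi x := (e - a * x) * (f - b * x) / (1 - z * x ^+ 2).
Let Const n := \prod_(k < n) (e * f - t ^+ k * (a * b / z)).

(** Numerators over the common denominator [DD x] of the factor [fq] between a new letter X and the
    letter [x]. The first initial tells whether X is kept (P) or reflected (M), the second whether
    [x] is kept (P) or reflected (Q). *)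
Let PP x : {poly K} := (1 - (t * z * x) *: 'X) * ('X - x%:P).
Let PQ x : {poly K} := (t *: 'X - x%:P) * (1 - (z * x) *: 'X).
Let MP x : {poly K} := ('X - (t * x)%:P) * (1 - (z * x) *: 'X).
Let MQ x : {poly K} := (t%:P - (z * x) *: 'X) * ('X - x%:P).
Let DD x : {poly K} := (1 - (z * x) *: 'X) * ('X - x%:P).
Let W : {poly K} := 1 - z *: 'X^2.
Let phiP : {poly K} := (e%:P - a *: 'X) * (f%:P - b *: 'X).
Let phiM : {poly K} := (e *: 'X - (a / z)%:P) * ((z * f) *: 'X - b%:P).

Let PPQ (A B : seq K) := (\prod_(x <- A) PQ x) * \prod_(x <- B) PP x.
Let MPQ (A B : seq K) := (\prod_(x <- A) MQ x) * \prod_(x <- B) MP x.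
Let wt (A B : seq K) := weight phi (map refl A ++ B).
Let term A B := (wt A B)%:P * (phiP * PPQ A B - phiM * MPQ A B).
(** The identity for the alphabet [s] enlarged by an unknown letter X, cleared of its denominators
    [W] and [DD x]. It is shown to vanish identically in X. *)
Let main s : {poly K} :=
  \sum_(p <- splits s) term p.1 p.2 -
  (Const (size s).+1)%:P * W * \prod_(x <- s) DD x.

Let dvd_prod (I : Type) (r : seq I) (F G : I -> {poly K}) :
  (forall i, W %| F i - G i) -> W %| \prod_(i <- r) F i - \prod_(i <- r) G i.
Proof.
move=> FG; elim: r => [|i r IHr]; first by rewrite !big_nil subrr dvdp0.
rewrite !big_cons; set u := \prod_(j <- r) F j; set v := \prod_(j <- r) G j.
have -> : F i * u - G i * v = (F i - G i) * u + G i * (u - v) by ring.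
by apply: dvdp_add; [apply: dvdp_mulr | apply: dvdp_mull].
Qed.

Let dvd_mul2 (p p' r r' : {poly K}) :
  W %| p - p' -> W %| r - r' -> W %| p * r - p' * r'.
Proof.
move=> pp' rr'; have -> : p * r - p' * r' = (p - p') * r + p' * (r - r') by ring.
by apply: dvdp_add; [apply: dvdp_mulr | apply: dvdp_mull].
Qed.

(** At the zeros of [W], the fixed points of the reflection, keeping or reflecting X amounts to the
    same and the two numerators cancel. Divisibility replaces evaluation because these zeros need
    not lie in [K], nor be distinct in characteristic 2. *)
Let dvd_main s : W %| main s.
Proof.
rewrite dvdp_sub //; last by rewrite -mulrA dvdp_mull // dvdp_mulr.
elim/big_ind: _ => [|p r|p _]; rewrite ?dvdp0 //; first exact: dvdp_add.
apply: dvdp_mull; apply: dvd_mul2.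
  have -> : phiP - phiM = (e * f - a * b / z)%:P * W.
    rewrite /phiP /phiM /W mulrAC; move: (divfK z0 a); move: (a / z) => c <-.
    by rewrite -!mul_polyC !rmorphM rmorphB !rmorphM /=; ring.
  by rewrite dvdp_mull.
apply: dvd_mul2; apply: dvd_prod => x.
  have -> : PQ x - MQ x = ((t - 1) * x)%:P * W; last by rewrite dvdp_mull.
  rewrite /PQ /MQ /W -!mul_polyC !rmorphM rmorphB /=; ring.
have -> : PP x - MP x = ((t - 1) * x)%:P * W; last by rewrite dvdp_mull.
rewrite /PP /MP /W -!mul_polyC !rmorphM rmorphB /=; ring.
Qed.

Let horner1 (c : K) : (1 : {poly K}).[c] = 1.
Proof. by rewrite -polyC1 hornerC. Qed.

Let evalE := (hornerM, hornerD, hornerN, hornerZ, hornerX, hornerC, horner1, hornerXn).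

Let regular (c x : K) := [&& x != 0, c != x & z * c * x != 1].

Let eval_factor (c x : K) : c != 0 -> regular c x ->
  [/\ (PP x).[c] = (DD x).[c] * fq (z * c * x),
      (PQ x).[c] = (DD x).[c] * fq (z * c * refl x),
      (MP x).[c] = (DD x).[c] * fq (z * refl c * x) &
      (MQ x).[c] = (DD x).[c] * fq (z * refl c * refl x)].
Proof.
move=> c0 /and3P[x0 cx zcx]; rewrite /PP /PQ /MP /MQ /DD !evalE /fq /refl.
have nz1 : 1 - z * c * x != 0 by rewrite subr_eq0 eq_sym.
have nz2 : x - c != 0 by rewrite subr_eq0 eq_sym.
have nz3 : c - x != 0 by rewrite subr_eq0.
have nz4 : c * (z * x) - 1 != 0 by rewrite subr_eq0 mulrCA mulrA.
by split; field; rewrite ?x0 ?c0 ?z0.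
Qed.

Let G c h := \prod_(y <- h) fq (z * c * y).
Let D c s := \prod_(x <- s) (DD x).[c].

Let eval_products (c : K) A B : c != 0 -> all (regular c) (A ++ B) ->
  (PPQ A B).[c] = D c A * D c B * G c (map refl A ++ B) /\
  (MPQ A B).[c] = D c A * D c B * G (refl c) (map refl A ++ B).
Proof.
move=> c0; rewrite all_cat => /andP[/allP rA /allP rB].
rewrite /PPQ /MPQ !hornerM !horner_prod /D /G !big_cat !big_map /= !(mulrACA _ _ (\prod_(_ <- A) _)).
rewrite -!big_split /=.
by split; congr (_ * _); apply: eq_big_seq => x; [move/rA | move/rB | move/rA | move/rB];
  case/(eval_factor c0).
Qed.

Let eval_phi (c : K) : c != 0 -> z * c * c != 1 ->
  phiP.[c] = phi c * (1 - z * c ^+ 2) /\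
  phiM.[c] = - (phi (refl c) * (1 - z * c ^+ 2)).
Proof.
move=> c0 zc; rewrite /phiP /phiM !evalE /phi /refl.
have nz : 1 - z * c ^+ 2 != 0 by rewrite subr_eq0 eq_sym expr2 mulrA.
have nz' : z * c ^+ 2 - 1 != 0 by rewrite subr_eq0 expr2 mulrA.
by split; field; rewrite ?c0 ?z0 ?nz.
Qed.

Let weight_cons c h : weight phi (c :: h) = phi c * G c h * weight phi h.
Proof. by rewrite /weight /= big_cons /G; ring. Qed.

Let weight_rcons c A B : wt A (c :: B) = phi c * G c (map refl A ++ B) * wt A B.
Proof. by rewrite -weight_cons; apply: weight_perm; rewrite -cat1s perm_catCA. Qed.

Let term_perm s s' : perm_eq s s' -> main s = main s'.
Proof.
move=> ss'; rewrite /main (perm_size ss') (perm_big _ ss'); congr (_ - _).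
apply: (splits_perm_sum (E := term)) ss' => [B A A' AA' | A B B' BB'].
  rewrite /term /wt /PPQ /MPQ !(perm_big _ AA').
  by rewrite (@weight_perm phi _ (map refl A' ++ B)) // perm_cat2r perm_map.
rewrite /term /wt /PPQ /MPQ !(perm_big _ BB').
by rewrite (@weight_perm phi _ (map refl A ++ B')) // perm_cat2l.
Qed.

Let regular_generic c s : generic (c :: s) -> all (regular c) s.
Proof.
case/genericP=> /andP[cs _] s0 sz; apply/allP => x xs; apply/and3P; split.
- by apply: s0; rewrite inE xs orbT.
- by apply: contraNneq cs => ->.
by apply: sz; rewrite inE ?eqxx ?xs ?orbT.
Qed.

Let regular_refl (c : K) s : c != 0 -> all (regular c) s -> all (regular (refl c)) s.
Proof.
move=> c0; apply: sub_all => x /and3P[x0 cx zcx]; apply/and3P; split=> //.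
  apply: contraNneq zcx => <-; rewrite /refl; apply/eqP; field.
  by rewrite c0 z0.
apply: contraNneq cx; rewrite /refl => cx; apply/eqP; rewrite -[c]mulr1 -cx.
by field; rewrite c0 z0.
Qed.

Let refl_neq0 (c : K) : c != 0 -> refl c != 0.
Proof. by move=> c0; rewrite /refl invr_eq0 mulf_neq0. Qed.

Let reflK (c : K) : c != 0 -> refl (refl c) = c.
Proof. by move=> c0; rewrite /refl; field; rewrite c0 z0 oner_neq0. Qed.

Let termE A B c : (term A B).[c] =
  wt A B * (phiP.[c] * (PPQ A B).[c] - phiM.[c] * (MPQ A B).[c]).
Proof. by rewrite /term !evalE. Qed.

Let horner_cons x A B c :
  [/\ (PPQ (x :: A) B).[c] = (PQ x).[c] * (PPQ A B).[c],
      (PPQ A (x :: B)).[c] = (PP x).[c] * (PPQ A B).[c],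
      (MPQ (x :: A) B).[c] = (MQ x).[c] * (MPQ A B).[c] &
      (MPQ A (x :: B)).[c] = (MP x).[c] * (MPQ A B).[c]].
Proof. by rewrite /PPQ /MPQ !big_cons !hornerM; split; ring. Qed.

(** The apparent poles at X = x and X = refl x cancel. The terms that survive there are those in
    which X and [x] end up as the same pair, x together with its reflection; the two ways of getting
    it have opposite residues. *)
Let term_pair_vanish (x : K) A B (c : K) : generic (x :: A ++ B) ->
  c = x \/ c = refl x -> (term (x :: A) B).[c] + (term A (x :: B)).[c] = 0.
Proof.
move=> gx cE; have rx := regular_generic gx.
have [_ s0 sz] := genericP _ gx; have x0 : x != 0 by apply: s0; rewrite inE eqxx.
have zx : z * x * x != 1 by apply: sz; rewrite inE eqxx.
have r0 := refl_neq0 x0; have rK := reflK x0; have rr := regular_refl x0 rx.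
have zr : z * refl x * refl x != 1.
  apply: contraNneq zx => zr; have -> : z * x * x = (z * refl x * refl x)^-1.
    by rewrite /refl; field; rewrite x0 z0 oner_neq0.
  by rewrite zr invr1.
rewrite !termE weight_rcons [wt (x :: A) B]weight_cons.
have [-> -> -> ->] := horner_cons x A B c; rewrite -/(wt A B); case: cE => ->.
  have [-> ->] := eval_phi x0 zx; have [-> ->] := eval_products x0 rx.
  rewrite /PP /PQ /MP /MQ !evalE; ring.
have [-> ->] := eval_phi r0 zr; have [-> ->] := eval_products r0 rr; rewrite rK.
rewrite /PP /PQ /MP /MQ !evalE.
have -> : z * x * refl x = 1 by rewrite /refl mulfV // mulf_neq0.
have -> : t * z * x * refl x = t by rewrite -!mulrA [z * _]mulrA /refl mulfV ?mulr1 // mulf_neq0.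
ring.
Qed.

Let root_main (x : K) s (c : K) : generic s -> x \in s -> c = x \/ c = refl x ->
  root (main s) c.
Proof.
move=> gs xs cE; have ss' := perm_to_rem xs; rewrite (term_perm ss').
have gs' := generic_perm ss' gs; apply/rootP; rewrite /main !evalE big_cons !evalE.
have -> : (1 - z * x * c) * (c - x) = 0.
  case: cE => ->; first by rewrite subrr mulr0.
  rewrite /refl mulfV ?subrr ?mul0r // mulf_neq0 //.
  by case/genericP: gs => _ /(_ x xs).
rewrite mul0r mulr0 subr0 horner_sum big_splits_cons big1_seq // => p /andP[_ ps].
apply: term_pair_vanish => //; apply: generic_perm gs'.
by rewrite perm_cons perm_sym splits_perm.
Qed.

(** At X = 0 each factor is a constant times -x: the constant is 1 if X is kept and [t] if it is
    reflected. So all terms share one multiplier, and the identity for [s] itself finishes. *)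
Let main0 s : generic s -> \sum_(p <- splits s) wt p.1 p.2 = Const (size s) ->
  root (main s) 0.
Proof.
move=> gs IHs; apply/rootP; rewrite /main !evalE horner_sum.
have prodE (P : K -> {poly K}) k A : (forall x, (P x).[0] = - (k * x)) ->
    (\prod_(x <- A) P x).[0] = k ^+ size A * \prod_(x <- A) - x.
  move=> P0; elim: A => [|y A IHA]; first by rewrite !big_nil !evalE mulr1.
  by rewrite !big_cons hornerM IHA P0 /= exprS; ring.
rewrite (eq_big_seq (fun p => wt p.1 p.2 * ((e * f - t ^+ size s * (a * b / z)) *
   \prod_(x <- s) - x))); last first.
  move=> p /splits_perm ps; rewrite termE /PPQ /MPQ !hornerM.
  rewrite (prodE MQ t) => [|x]; last by rewrite /MQ !evalE; ring.
  rewrite (prodE MP t) => [|x]; last by rewrite /MP !evalE; ring.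
  rewrite (prodE PQ 1) => [|x]; last by rewrite /PQ !evalE; ring.
  rewrite (prodE PP 1) => [|x]; last by rewrite /PP !evalE; ring.
  rewrite -(perm_big _ ps) -(perm_size ps) big_cat size_cat exprD !expr1n /phiP /phiM.
  by rewrite /= !evalE; ring.
rewrite -mulr_suml IHs (prodE DD 1) => [|x]; last by rewrite /DD !evalE; ring.
by rewrite /Const big_ord_recr expr1n /=; ring.
Qed.

Let size_mul2 (p r : {poly K}) (i j : nat) :
  (size p <= i.+1)%N -> (size r <= j.+1)%N -> (size (p * r)%R <= (i + j).+1)%N.
Proof.
move=> pi rj; apply: leq_trans (size_polyMleq _ _) _.
by rewrite -subn1 leq_subLR add1n -addSn -addnS leq_add.
Qed.

Let size_main s : (size (main s) <= (2 * size s).+3)%N.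
Proof.
have prod_size (P : K -> {poly K}) A : (forall x, size (P x) <= 3)%N ->
    (size (\prod_(x <- A) P x)%R <= (2 * size A).+1)%N.
  move=> P3; elim: A => [|y A IHA]; first by rewrite big_nil size_poly1.
  by rewrite big_cons mulnS; apply: size_mul2.
have quad (p r : {poly K}) : (size p <= 2)%N -> (size r <= 2)%N -> (size (p * r : {poly K})%R <= 3)%N.
  by move=> p2 r2; exact: size_mul2 p2 r2.
have lin (c d : K) : (size (c *: 'X - d%:P : {poly K})%R <= 2)%N.
  apply: leq_trans (size_polyD _ _) _; rewrite geq_max size_polyN.
  rewrite (leq_trans (size_scale_leq _ _)) ?size_polyX //.
  by rewrite size_polyC; case: eqP.
have lin' (c d : K) : (size (d%:P - c *: 'X : {poly K})%R <= 2)%N.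
  by rewrite -opprB size_polyN.
have lin1 (c : K) : (size (1 - c *: 'X : {poly K})%R <= 2)%N by rewrite -polyC1.
have linX (d : K) : (size ('X - d%:P : {poly K})%R <= 2)%N by rewrite size_XsubC.
have sW : (size W <= 3)%N.
  apply: leq_trans (size_polyD _ _) _; rewrite geq_max size_poly1 size_polyN.
  by apply: leq_trans (size_scale_leq _ _) _; rewrite size_polyXn.
apply: leq_trans (size_polyD _ _) _; rewrite geq_max size_polyN; apply/andP; split.
  apply: leq_trans (size_sum _ _ _) _; apply/bigmax_leqP_seq => p /splits_perm ps _.
  rewrite /term mul_polyC; apply: leq_trans (size_scale_leq _ _) _.
  apply: leq_trans (size_polyD _ _) _; rewrite geq_max size_polyN.
  rewrite -(perm_size ps) size_cat mulnDr -[(_ + _).+3]/(2 + (_ + _)).+1.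
  apply/andP; split; apply: size_mul2.
  - exact: quad.
  - by apply: size_mul2; apply: prod_size => x; apply: quad.
  - exact: quad.
  by apply: size_mul2; apply: prod_size => x; apply: quad.
rewrite -mulrA mul_polyC; apply: leq_trans (size_scale_leq _ _) _.
by apply: (@size_mul2 _ _ 2) => //; apply: prod_size => x; apply: quad.
Qed.

(** The letters, their reflections and 0 give 2|s| + 1 distinct roots, none of them a root of [W].
    Together with [W] they form a divisor of degree 2|s| + 3, while the degree of [main s] is at
    most 2|s| + 2. *)
Let main_eq0 s : generic s -> \sum_(p <- splits s) wt p.1 p.2 = Const (size s) ->
  main s = 0.
Proof.
move=> gs IHs; have [us s0 sz] := genericP _ gs.
pose rs := 0 :: s ++ map refl s.
have rootsP c : c \in s ++ map refl s -> exists2 x, x \in s & c = x \/ c = refl x.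
  rewrite mem_cat => /orP[cs|/mapP[x xs ->]]; first by exists c; [|left].
  by exists x; [|right].
have urs : uniq rs.
  rewrite /= cat_uniq us map_inj_in_uniq ?us => [|x y xs ys /invr_inj/(mulfI z0) //].
  rewrite !andbT; apply/andP; split.
    apply/negP => /rootsP[x xs [x0|x0]]; first by case/eqP: (s0 _ xs).
    by have := refl_neq0 (s0 _ xs); rewrite -x0 eqxx.
  rewrite -all_predC; apply/allP => y /mapP[x xs ->] /=; apply/negP => rs'.
  by have := sz _ _ xs rs'; rewrite /refl mulfV ?eqxx // mulf_neq0 // s0.
have rrs : all (root (main s)) rs.
  rewrite /= main0 //=; apply/allP => c /rootsP[x xs cE]; exact: root_main xs cE.
have Wnz c : c \in rs -> ~~ root W c.
  rewrite /root /W !evalE inE => /predU1P[->|]; first by rewrite !mulr0 subr0 oner_eq0.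
  case/rootsP => x xs cE; rewrite subr_eq0 eq_sym; have := sz _ _ xs xs.
  case: cE => ->; first by rewrite mulrA.
  apply: contra => /eqP rx; have -> : z * x * x = (z * (refl x * refl x))^-1.
    by rewrite /refl; field; rewrite (s0 _ xs) z0 oner_neq0.
  by rewrite rx invr1.
have cop : coprimep W (\prod_(c <- rs) ('X - c%:P)).
  elim: (rs) Wnz => [|c l IHl] Wnz; first by rewrite big_nil coprimep1.
  rewrite big_cons coprimepMr coprimep_XsubC Wnz ?inE ?eqxx //=.
  by apply: IHl => d dl; apply: Wnz; rewrite inE dl orbT.
apply/eqP; apply: contraT => nz.
have : W * \prod_(c <- rs) ('X - c%:P) %| main s.
  by rewrite Gauss_dvdp // dvd_main uniq_roots_dvdp // uniq_rootsE.
move/(dvdp_leq nz); rewrite leqNgt => /negP[]; apply: leq_ltn_trans (size_main s) _.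
have sW : size W = 3%N.
  rewrite /W -opprB size_polyN -mul_polyC size_polyDl ?size_polyN size_Cmul ?size_polyXn ?size_poly1 //.
have W0 : W != 0 by rewrite -size_poly_eq0 sW.
rewrite size_mul ?sW // ?size_prod_XsubC; last first.
  by rewrite -size_poly_eq0 size_prod_XsubC.
by rewrite /= size_cat size_map addnn mul2n.
Qed.

(** Induction on the alphabet: the identity for [u :: s] is the vanishing of [main s] at X = u,
    divided by the nonzero values of [W] and of the [DD x] there. *)
Lemma Gsum_const s : generic s ->
  Gsum (fun x => (e - a * x) * (f - b * x) / (1 - z * x ^+ 2)) s =
  \prod_(k < size s) (e * f - t ^+ k * (a * b / z)).
Proof.
rewrite -/phi -/(Const (size s)) => gs; have wi := @weight_perm phi.
rewrite /Gsum configs_splits // -/wt.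
elim: s gs => [|u s IHs] gus.
  by rewrite big_splits_nil /Const big_ord0 /wt /weight /= big_nil mulr1.
have gs := generic_cons gus; have us := regular_generic gus.
have [_ s0 sz] := genericP _ gus; have u0 : u != 0 by apply: s0; rewrite inE eqxx.
have zu : z * u * u != 1 by apply: sz; rewrite inE eqxx.
have wnz : 1 - z * u ^+ 2 != 0 by rewrite subr_eq0 eq_sym expr2 mulrA.
have Dnz : D u s != 0.
  rewrite /D prodf_seq_neq0; apply/allP => x /(allP us)/and3P[x0 ux zux].
  by rewrite /DD !evalE mulf_neq0 // subr_eq0 // eq_sym mulrAC.
have := congr1 (fun p => p.[u]) (main_eq0 gs (IHs gs)).
rewrite /main !evalE horner_sum horner_prod -/(D u s) -expr2.
rewrite (eq_big_seq (fun p => (wt (u :: p.1) p.2 + wt p.1 (u :: p.2)) *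
  ((1 - z * u ^+ 2) * D u s))); last first.
  move=> p /splits_perm ps; have rp : all (regular u) (p.1 ++ p.2).
    by rewrite (perm_all _ ps).
  rewrite termE; have [-> ->] := eval_products u0 rp; have [-> ->] := eval_phi u0 zu.
  rewrite weight_rcons [wt (u :: p.1) _]weight_cons -/(wt p.1 p.2).
  rewrite /D -(perm_big _ ps) big_cat /=; ring.
rewrite -mulr_suml -mulrA -mulrBl => /eqP.
rewrite mulf_eq0 [_ * D u s == 0]mulf_eq0 (negPf wnz) (negPf Dnz) !orbF subr_eq0.
by move/eqP; rewrite big_splits_cons.
Qed.

End ConstantTerm.
End Reflection.

(** * The bounded Hall-Littlewood sum as a sum over reflections *)

Section BoundedSum.
Variables (K : fieldType) (t : K).
Implicit Types (x y : K) (s : seq K) (f g h : seq K -> K).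

Definition kap x y : K := (x - t * y) / (x - y).

Definition cross s1 s2 : K := \prod_(x <- s1) \prod_(y <- s2) kap x y.

Definition conv f g s : K :=
  \sum_(p <- splits s) f p.1 * g p.2 * cross p.1 p.2.

Lemma cross_catl s1 s2 s3 : cross (s1 ++ s2) s3 = cross s1 s3 * cross s2 s3.
Proof. by rewrite /cross big_cat. Qed.

Lemma cross_catr s1 s2 s3 : cross s1 (s2 ++ s3) = cross s1 s2 * cross s1 s3.
Proof. by rewrite /cross -big_split; apply: eq_bigr => x _; rewrite big_cat. Qed.

Lemma cross_perml s : perm_invariant (cross^~ s).
Proof. by move=> s1 s2 s12; apply: perm_big. Qed.

Lemma cross_permr s : perm_invariant (cross s).
Proof. by move=> s1 s2 s12; apply: eq_bigr => x _; apply: perm_big. Qed.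

Lemma convA f g h s : conv (conv f g) h s = conv f (conv g h) s.
Proof.
pose E a b c := f a * g b * h c * (cross a b * cross a c * cross b c).
transitivity (\sum_(p <- splits s) \sum_(r <- splits p.1) E r.1 r.2 p.2).
  apply: eq_bigr => p _; rewrite /conv -mulrA mulr_suml; apply: eq_big_seq => r rp.
  by rewrite -(cross_perml p.2 (splits_perm rp)) cross_catl /E; ring.
rewrite splits_assoc; apply: eq_bigr => p _.
rewrite /conv mulr_sumr mulr_suml; apply: eq_big_seq => r rp.
by rewrite -(cross_permr p.1 (splits_perm rp)) cross_catr /E; ring.
Qed.

Lemma splits_nill (E : seq K -> K) s :
  \sum_(p <- splits s) (if p.1 is [::] then E p.2 else 0) = E s.
Proof.
elim: s E => [|x s IHs] E; first by rewrite big_splits_nil.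
by rewrite big_splits_cons -(IHs (fun u => E (x :: u))); apply: eq_bigr => p _; rewrite add0r.
Qed.

Lemma splits_nilr (E : seq K -> K) s :
  \sum_(p <- splits s) (if p.2 is [::] then E p.1 else 0) = E s.
Proof.
elim: s E => [|x s IHs] E; first by rewrite big_splits_nil.
by rewrite big_splits_cons -(IHs (fun u => E (x :: u))); apply: eq_bigr => p _; rewrite addr0.
Qed.

Variable z : K.

Definition mon s : K := \prod_(x <- s) (z * x ^+ 2).

Lemma mon_splits s p : p \in splits s -> mon s = mon p.1 * mon p.2.
Proof. by move=> ps; rewrite /mon -(perm_big _ (splits_perm ps)) big_cat. Qed.

Lemma mon_conv f g s :
  mon s * conv f g s = conv (fun u => mon u * f u) (fun u => mon u * g u) s.
Proof.
rewrite /conv mulr_sumr; apply: eq_big_seq => p ps.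
by rewrite (mon_splits ps); ring.
Qed.

Fixpoint levels (L : seq nat) s : seq (seq (K * nat)) :=
  if s is x :: s' then [seq (x, k) :: l | k <- L, l <- levels L s'] else [:: [::]].

Definition kapl (u v : K * nat) : K :=
  if (v.2 < u.2)%N then kap u.1 v.1 else if (u.2 < v.2)%N then kap v.1 u.1 else 1.

Definition lweight (l : seq (K * nat)) : K :=
  (\prod_(u <- l) (z * u.1 ^+ 2) ^+ u.2) * pairs kapl l.

Lemma kaplC u v : kapl u v = kapl v u.
Proof. by rewrite /kapl; case: ltngtP. Qed.

Lemma lweight_perm : perm_invariant lweight.
Proof.
by move=> l l' ll'; rewrite /lweight (perm_big _ ll') (pairs_perm kaplC ll').
Qed.

Lemma big_levels_cons L x s (E : seq (K * nat) -> K) :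
  \sum_(l <- levels L (x :: s)) E l =
  \sum_(k <- L) \sum_(l <- levels L s) E ((x, k) :: l).
Proof. by rewrite /= big_allpairs_dep. Qed.

Lemma levels_fst L s l : l \in levels L s -> map fst l = s.
Proof.
elim: s l => [|x s IHs] l /=; first by rewrite inE => /eqP->.
by case/allpairsP=> [[k l']] /= [_ /IHs <- ->].
Qed.

Lemma levels_snd L s l : l \in levels L s -> {subset map snd l <= L}.
Proof.
elim: s l => [|x s IHs] l /=; first by rewrite inE => /eqP->.
case/allpairsP=> [[k l']] /= [kL /IHs l'L ->] k' /=.
by rewrite inE => /predU1P[->|/l'L].
Qed.

Lemma levels_splits m s (E : seq (K * nat) -> K) : perm_invariant E ->
  \sum_(l <- levels (iota 0 m.+1) s) E l =
  \sum_(p <- splits s) \sum_(l <- levels (iota 0 m) p.1)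
    E ([seq (u.1, u.2.+1) | u <- l] ++ [seq (y, 0%N) | y <- p.2]).
Proof.
elim: s E => [|x s IHs] E invE; first by rewrite big_splits_nil !big_seq1.
rewrite big_levels_cons big_splits_cons big_split /= big_cons addrC; congr (_ + _).
  rewrite [LHS](IHs _ (perm_invariant_cons (x, 0%N) invE)).
  apply: eq_bigr => p _; apply: eq_bigr => l _; apply: invE.
  by rewrite perm_sym -cat1s perm_catCA.
have shift (F : nat -> K) : \sum_(k <- iota 1 m) F k = \sum_(k <- iota 0 m) F k.+1.
  by rewrite (iotaDl 1 0 m) big_map.
rewrite shift; under [RHS]eq_bigr do rewrite big_allpairs_dep.
rewrite [RHS]exchange_big /=; apply: eq_bigr => k _.
exact: (IHs _ (perm_invariant_cons (x, k.+1) invE)).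
Qed.

Definition level_sum m s : K := \sum_(l <- levels (iota 0 m.+1) s) lweight l.

Lemma level_sum0 s : level_sum 0 s = 1.
Proof.
elim: s => [|x s IHs].
  by rewrite /level_sum big_seq1 /lweight /= big_nil mulr1.
rewrite /level_sum big_levels_cons big_seq1 -[RHS]IHs.
apply: eq_big_seq => l /levels_snd l0.
rewrite /lweight big_cons expr0 mul1r /=.
suff -> : \prod_(u <- l) kapl (x, 0%N) u = 1 by rewrite mul1r.
rewrite big1_seq // => u /andP[_ ul].
have /l0 : u.2 \in map snd l by apply: map_f.
by rewrite inE /kapl => /eqP->.
Qed.

(** Split off the letters of level 0 as the right factor. The others all have larger level, which
    gives [cross], and lowering their levels by one costs [mon]. *)
Lemma level_sumS m s :
  level_sum m.+1 s = conv (fun u => mon u * level_sum m u) (fun=> 1) s.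
Proof.
rewrite /level_sum levels_splits; last exact: lweight_perm.
apply: eq_bigr => p _; rewrite mulr1 mulr_sumr mulr_suml.
apply: eq_big_seq => l /levels_fst lp.
rewrite /lweight big_cat pairs_cat !big_map /=.
rewrite (big1 _ _ (fun y : K => (z * y ^+ 2) ^+ 0)) // mulr1.
have -> : \prod_(u <- l) (z * u.1 ^+ 2) ^+ u.2.+1 =
    mon p.1 * \prod_(u <- l) (z * u.1 ^+ 2) ^+ u.2.
  by rewrite -lp /mon big_map -big_split; apply: eq_bigr => u _; rewrite exprS.
have -> : pairs kapl [seq (u.1, u.2.+1) | u <- l] = pairs kapl l.
  by rewrite pairs_map; apply: eq_pairs => u v _ _; rewrite /kapl /= !ltnS.
have -> : pairs kapl [seq (y, 0%N) | y <- p.2] = 1.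
  by elim: p.2 => //= y u ->; rewrite big_map big1 ?mulr1.
have -> : \prod_(u <- l) \prod_(v <- [seq (y, 0%N) | y <- p.2]) kapl (u.1, u.2.+1) v =
    cross p.1 p.2.
  by rewrite -lp /cross big_map; apply: eq_bigr => u _; rewrite big_map.
by ring.
Qed.

Hypothesis z0 : z != 0.

Let phi0 x : K := (1 - z * x ^+ 2)^-1.
Let plus := weight z t phi0.
Let minus s := plus (map (refl z) s).

Lemma eq_Gsum phi phi' s : phi =1 phi' -> Gsum z t phi s = Gsum z t phi' s.
Proof.
by move=> pp'; apply: eq_bigr => h _; rewrite /weight (eq_bigr _ (fun i _ => pp' i)).
Qed.

Lemma Gsum_conv phi s : generic z s ->
  Gsum z t phi s =
  conv (fun u => weight z t phi (map (refl z) u)) (weight z t phi) s.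
Proof.
move=> gs; rewrite /Gsum configs_splits; last exact: weight_perm.
apply: eq_big_seq => p /splits_perm ps; rewrite /weight pairs_cat big_cat big_map /=.
have -> : \prod_(x <- map (refl z) p.1) \prod_(y <- p.2) fq t (z * x * y) = cross p.1 p.2.
  rewrite big_map /cross; apply: eq_big_seq => x xp; apply: eq_big_seq => y yp.
  have /genericP[_ s0 _] : generic z (p.1 ++ p.2) by rewrite (generic_perm _ gs) // perm_sym.
  have x0 : x != 0 by apply: s0; rewrite mem_cat xp.
  rewrite /fq /kap /refl.
  (* For [x = y] both sides are 0, since the inverse of 0 is 0. *)
  have [xy|xy] := eqVneq x y.
    have -> : z * (z * x)^-1 * y = 1 by rewrite -xy; field; rewrite z0 x0.
    by rewrite xy !subrr !invr0 !mulr0.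
  have xy0 : x - y != 0 by rewrite subr_eq0.
  by field; rewrite z0 x0 xy0.
by ring.
Qed.

(** The constant-term identity with numerator 1, that is e = f = 1 and a = b = 0, where every factor
    of the constant is 1. *)
Lemma conv_minus_plus s : generic z s -> conv minus plus s = 1.
Proof.
move=> gs; have := Gsum_const t z0 1 1 0 0 gs.
rewrite (@eq_Gsum _ phi0) => [|x]; last by rewrite !mul0r subr0 mul1r mul1r.
rewrite Gsum_conv // => ->; apply: big1 => k _.
by rewrite !mul0r mulr0 subr0 mul1r.
Qed.

Let pr s := \prod_(y <- s) y.

Let pr_mon s : {in s, forall y, y != 0} -> pr s = mon s * pr (map (refl z) s).
Proof.
move=> s0; rewrite /pr /mon big_map -big_split; apply: eq_big_seq => y /s0 y0 /=.
by rewrite /refl; field; rewrite z0 y0.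
Qed.

Let pr_splits s p : p \in splits s -> pr s = pr p.1 * pr p.2.
Proof. by move=> ps; rewrite /pr -(perm_big _ (splits_perm ps)) big_cat. Qed.

(** The constant-term identity with numerator y, that is e = 1, f = a = 0, b = -1: the constant then
    contains a factor 0 unless the alphabet is empty. The product of the letters of a configuration
    is exchanged for [mon] by [pr_mon]. *)
Lemma conv_minus_monplus s : generic z s ->
  conv minus (fun u => mon u * plus u) s = (s == [::])%:R.
Proof.
case: s => [|x s] gs.
  by rewrite /conv big_splits_nil /minus /plus /weight /mon /cross /= !big_nil !mulr1.
have [_ s0 _] := genericP _ _ gs.
have := Gsum_const t z0 1 0 0 (-1) gs; rewrite /= big_ord_recl.
rewrite [X in X * _](_ : _ = 0) ?mul0r; last by rewrite !mulr0 subr0.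
rewrite (@eq_Gsum _ (fun y => y / (1 - z * y ^+ 2))) => [|y]; last first.
  by rewrite mul0r subr0 mul1r sub0r mulN1r opprK.
rewrite Gsum_conv //.
set u := x :: s in gs s0 *.
have wE v : weight z t (fun y => y / (1 - z * y ^+ 2)) v = pr v * plus v.
  by rewrite /plus /weight mulrA -big_split.
have ru : pr u != 0 by rewrite prodf_seq_neq0; apply/allP => y /s0.
have mnz : mon u != 0.
  by rewrite prodf_seq_neq0; apply/allP => y yu; rewrite mulf_neq0 // expf_neq0 // s0.
move=> E0; apply: (mulfI ru); rewrite mulr0 -(mulr0 (mon u)) -E0 /conv !mulr_sumr.
apply: eq_big_seq => p pu; rewrite !wE (mon_splits pu) (pr_splits pu) pr_mon => [|y yp].
  by rewrite -/(minus p.1); ring.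
by apply: s0; rewrite -(perm_mem (splits_perm pu)) mem_cat yp.
Qed.

Lemma generic_splits s p : p \in splits s -> generic z s -> generic z p.1 /\ generic z p.2.
Proof.
move=> ps gs; have gp : generic z (p.1 ++ p.2).
  by apply: generic_perm gs; rewrite perm_sym splits_perm.
have /genericP[] := gp; rewrite cat_uniq => /and3P[u1 _ u2] _ _; split.
  by apply: sub_generic (gp) => // x xp; rewrite mem_cat xp.
by apply: sub_generic (gp) => // x xp; rewrite mem_cat xp orbT.
Qed.

Lemma eq_conv_generic f f' g g' s : generic z s ->
  (forall u, generic z u -> f u = f' u) -> (forall u, generic z u -> g u = g' u) ->
  conv f g s = conv f' g' s.
Proof.
move=> gs ff' gg'; apply: eq_big_seq => p ps.
by have [g1 g2] := generic_splits ps gs; rewrite ff' // gg'.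
Qed.

Lemma conv_deltal g s : conv (fun u => (u == [::])%:R) g s = g s.
Proof.
rewrite -[RHS]splits_nill; apply: eq_bigr => p _; case: p.1 => [|x u] /=.
  by rewrite mul1r /cross big_nil mulr1.
by rewrite !mul0r.
Qed.

(* A left inverse is a right inverse: the product taken in the other order is
   idempotent with value 1 at [::]. *)
Lemma conv_monplus_minus s : generic z s ->
  conv (fun u => mon u * plus u) minus s = (s == [::])%:R.
Proof.
set D := conv _ _.
have idem u : generic z u -> conv D D u = D u.
  move=> gu; rewrite /D convA; apply: eq_conv_generic => // v gv.
  rewrite -convA (eq_conv_generic gv conv_minus_monplus (g' := minus)) //.
  exact: conv_deltal.
have D0 : D [::] = 1.
  by rewrite /D /conv big_splits_nil /minus /plus /weight /mon /cross /= !big_nil !mulr1.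
have [k] := ubnP (size s); elim: k s => // k IHk s sk gs.
have [->|s0] := eqVneq s [::]; first by rewrite D0.
apply: (addrI (D s)); rewrite addr0 -{3}(idem s gs).
rewrite -{1}(splits_nill D s) -{1}(splits_nilr D s) -big_split.
apply: eq_big_seq => p ps; have [g1 g2] := generic_splits ps gs.
have ss := perm_size (splits_perm ps); rewrite size_cat in ss.
case: p ps g1 g2 ss => [[|y a] [|y' b]] ps g1 g2 ss /=.
- by move: s0; rewrite -size_eq0 -ss.
- by rewrite addr0 D0 mul1r /cross big_nil mulr1.
- by rewrite add0r D0 mulr1 /cross big1 ?mulr1 // => v _; rewrite big_nil.
rewrite (IHk (y :: a)) // ?mul0r ?addr0 //.
by rewrite -ltnS; apply: leq_ltn_trans sk; rewrite -ss /= addnS ltnS leq_addr.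
Qed.

(** Write the right factor 1 as [conv minus plus]; its left half is cancelled by [mon * plus]. *)
Lemma conv_monplus_one s : generic z s ->
  conv (fun u => mon u * plus u) (fun=> 1) s = plus s.
Proof.
move=> gs; rewrite (eq_conv_generic (f' := fun u => mon u * plus u)
  (g' := conv minus plus) gs) // => [|u gu]; last by rewrite conv_minus_plus.
rewrite -convA (eq_conv_generic gs conv_monplus_minus (g' := plus)) //.
exact: conv_deltal.
Qed.

(** The telescoping: multiplying the formula for [m] by [mon] leaves [mon * plus] on the right, and
    the next factor 1 turns this into [plus]. *)
Lemma level_sum_conv m s : generic z s ->
  level_sum m s = conv (fun u => mon u ^+ m * minus u) plus s.
Proof.
elim: m s => [|m IHm] s gs.
  rewrite level_sum0 -(conv_minus_plus gs).
  by apply: eq_conv_generic => // u _; rewrite mul1r.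
rewrite level_sumS.
rewrite (eq_conv_generic gs (f' := conv (fun u => mon u ^+ m.+1 * minus u)
   (fun u => mon u * plus u)) (g' := fun=> 1)) // => [|u gu]; last first.
  rewrite IHm // mon_conv; apply: eq_conv_generic => // v _.
  by rewrite exprS mulrA.
rewrite convA; apply: eq_conv_generic => // u gu; exact: conv_monplus_one.
Qed.

(** For a splitting with reflected part [p.1], [mon p.1] is the product of all letters of [s]
    divided by the product of the letters of the configuration. So [mon p.1 ^+ m] becomes a
    prefactor and a power x^-m for each letter of the configuration. *)
Theorem level_sum_Gsum m s : generic z s ->
  level_sum m s = (\prod_(x <- s) x) ^+ m *
    Gsum z t (fun x => x ^- m / (1 - z * x ^+ 2)) s.
Proof.
move=> gs; rewrite level_sum_conv // Gsum_conv // /conv mulr_sumr.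
have wE v : weight z t (fun y => y ^- m / (1 - z * y ^+ 2)) v = (pr v) ^- m * plus v.
  by rewrite /plus /weight mulrA /pr -prodrXl -prodfV -big_split.
apply: eq_big_seq => p ps; rewrite !wE -/(pr s) (pr_splits ps).
have [_ s0 _] := genericP _ _ gs.
have s1 : {in p.1, forall y, y != 0}.
  by move=> y yp; apply: s0; rewrite -(perm_mem (splits_perm ps)) mem_cat yp.
have r1 : pr (map (refl z) p.1) ^+ m != 0.
  rewrite expf_neq0 // prodf_seq_neq0; apply/allP => y /mapP[x /s1 xp ->].
  by rewrite /refl invr_eq0 mulf_neq0.
have r2 : pr p.2 ^+ m != 0.
  rewrite expf_neq0 // prodf_seq_neq0; apply/allP => y yp.
  by rewrite s0 // -(perm_mem (splits_perm ps)) mem_cat yp orbT.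
rewrite (pr_mon s1).
rewrite !exprMn -/(minus p.1); field.
by rewrite r1 r2.
Qed.

End BoundedSum.

(** * Hall-Littlewood polynomials as sums over level assignments *)

Section Orderings.
Variables (T : eqType) (R : comNzRingType).
Implicit Type s : seq T.

Fixpoint orderings n s : seq (seq T) :=
  if n is n'.+1 then
    flatten [seq [seq p.1 :: u | u <- orderings n' p.2] | p <- picks s]
  else [:: [::]].

Lemma big_orderingsS n s (E : seq T -> R) :
  \sum_(u <- orderings n.+1 s) E u =
  \sum_(p <- picks s) \sum_(u <- orderings n p.2) E (p.1 :: u).
Proof. by rewrite /= big_flatten big_map; apply: eq_bigr => p _; rewrite big_map. Qed.

Lemma orderings_perm n s u : size s = n -> u \in orderings n s -> perm_eq u s.
Proof.
elim: n s u => [|n IHn] s u /= sn.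
  by rewrite inE => /eqP->; rewrite (size0nil sn).
case/flattenP => _ /mapP[p ps ->] /mapP[v vp ->].
have pps := picks_perm ps; apply: perm_trans (pps); rewrite perm_cons.
by apply: IHn vp; move: (perm_size pps); rewrite sn => -[].
Qed.

Lemma big_picks_ord n (x : 'I_n.+1 -> T) (F : T * seq T -> R) :
  \sum_(p <- picks [seq x i | i <- enum 'I_n.+1]) F p =
  \sum_(a < n.+1) F (x a, [seq x (lift a j) | j <- enum 'I_n]).
Proof.
elim: n x F => [|n IHn] x F.
  by rewrite enum_ordSl big_ord_recl big_ord0 /= enum_ord0 big_seq1 addr0.
rewrite enum_ordSl big_ord_recl /= big_cons -map_comp; congr (_ + _).
rewrite big_map (IHn _ (fun p => F (p.1, x ord0 :: p.2))); apply: eq_bigr => a _ /=.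
congr (F (_, _)); rewrite [in RHS]enum_ordSl /=; congr (_ :: _).
  by congr x; apply/val_inj.
rewrite -map_comp; apply: eq_map => j /=; congr x; apply/val_inj => /=.
by rewrite /bump /= !add1n ltnS addnS.
Qed.

Lemma lift_perm_bij n (i j : 'I_n.+1) :
  {on [pred w : 'S_n.+1 | w i == j], bijective (lift_perm i j)}.
Proof.
have lk (w : 'S_n.+1) k : exists k', w (lift i k) = lift (w i) k'.
  case: (unliftP (w i) (w (lift i k))) => [k' ->|]; first by exists k'.
  by move/perm_inj/eqP; rewrite eq_sym (negPf (neq_lift _ _)).
pose f (w : 'S_n.+1) k := odflt k (unlift (w i) (w (lift i k))).
have fK (w : 'S_n.+1) k : lift (w i) (f w k) = w (lift i k).
  by rewrite /f; have [k' ->] := lk w k; rewrite liftK.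
have f_inj (w : 'S_n.+1) : injective (f w).
  move=> k1 k2 /(congr1 (lift (w i))); rewrite !fK.
  by move/perm_inj/lift_inj.
exists (fun w => perm (@f_inj w)) => [w _ | w /eqP wi].
  apply/permP=> k; rewrite permE.
  by have := fK (lift_perm i j w) k; rewrite lift_perm_id lift_perm_lift => /lift_inj.
apply/permP=> k; case: (unliftP i k) => [k'|] ->; last by rewrite lift_perm_id.
by rewrite lift_perm_lift permE -wi fK.
Qed.

Lemma sum_perm_orderings n (x : 'I_n -> T) (E : seq T -> R) :
  \sum_(w : 'S_n) E [seq x (w i) | i <- enum 'I_n] =
  \sum_(u <- orderings n [seq x i | i <- enum 'I_n]) E u.
Proof.
elim: n x E => [|n IHn] x E.
  rewrite big_seq1 enum_ord0 /= (eq_bigr (fun=> E [::])) // sumr_const.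
  by rewrite card_Sn mulr1n.
rewrite big_orderingsS big_picks_ord /=.
rewrite (partition_big (fun w : 'S_n.+1 => w ord0) xpredT) //=.
apply: eq_bigr => a _; rewrite -(IHn (fun j => x (lift a j)) (fun u => E (x a :: u))).
rewrite (reindex (lift_perm ord0 a)); last exact: lift_perm_bij.
apply: eq_big => [w|w _]; first by rewrite lift_perm_id eqxx.
rewrite enum_ordSl /= lift_perm_id -map_comp; congr (E (_ :: _)).
by apply: eq_map => i /=; rewrite lift_perm_lift.
Qed.

End Orderings.

Lemma pairs_ord (T : eqType) (R : comNzRingType) n (f : 'I_n -> T) (g : T -> T -> R) :
  pairs g [seq f i | i <- enum 'I_n] = \prod_(i < n) \prod_(j < n | (i < j)%N) g (f i) (f j).
Proof.
elim: n f => [|n IHn] f; first by rewrite enum_ord0 big_ord0.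
rewrite enum_ordSl /= big_ord_recl -map_comp IHn big_map big_enum /=.
congr (_ * _); first by rewrite [RHS]big_mkcond big_ord_recl /= mul1r.
apply: eq_bigr => i _; rewrite [RHS]big_mkcond big_ord_recl /= mul1r -big_mkcond /=.
by apply: eq_bigl => j.
Qed.

Section HallLittlewoodLevels.
Variables (K : fieldType) (t : K).
Hypothesis t1 : forall k, t ^+ k.+1 != 1.
Implicit Types (s u : seq K) (mu la : seq nat).

Let tnz k : 1 - t ^+ k.+1 != 0. Proof. by rewrite subr_eq0 eq_sym. Qed.

(** Partial fractions in [a]: the value at infinity is [t ^+ size s], and the coefficient at the
    pole a = 1/x is 1 - t times the product of the [kap t x y]. Setting a = 0 gives the sum in
    [sum_picks_kap]. *)
Lemma prod_partial_fraction (a : K) s : uniq s -> 0 \notin s ->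
  {in s, forall y, a * y != 1} ->
  \prod_(y <- s) ((1 - t * a * y) / (1 - a * y)) =
  t ^+ size s + (1 - t) * \sum_(p <- picks s)
     (1 - a * p.1)^-1 * \prod_(y <- p.2) kap t p.1 y.
Proof.
elim: s a => [|y s IHs] a; first by rewrite !big_nil mulr0 addr0.
rewrite /= inE negb_or eq_sym => /andP[ys us] /andP[y0 s0] sa.
have ay : 1 - a * y != 0 by rewrite subr_eq0 eq_sym sa ?inE ?eqxx.
rewrite !big_cons big_map IHs // => [|x xs]; last by apply: sa; rewrite inE xs orbT.
(* The induction hypothesis at a = 1/y, where each factor of its left side is [kap t y x]. *)
have Ey : \prod_(x <- s) kap t y x = t ^+ size s + (1 - t) * \sum_(p <- picks s)
     (1 - y^-1 * p.1)^-1 * \prod_(x <- p.2) kap t p.1 x.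
  rewrite -IHs // => [|x xs]; last first.
    by apply: contraNneq ys => /(canRL (mulVKf y0)); rewrite mulr1 => <-.
  apply: eq_big_seq => x xs; rewrite /kap.
  have yx : y - x != 0 by rewrite subr_eq0; apply: contraNneq ys => ->.
  by field; rewrite y0 yx.
rewrite Ey exprS.
have -> : \sum_(p <- picks s) (1 - a * p.1)^-1 * (\prod_(x <- y :: p.2) kap t p.1 x) =
    \sum_(p <- picks s) ((1 - a * p.1)^-1 * \prod_(x <- p.2) kap t p.1 x *
      ((1 - t * a * y) / (1 - a * y)) -
    (1 - t) / (1 - a * y) * ((1 - y^-1 * p.1)^-1 * \prod_(x <- p.2) kap t p.1 x)).
  apply: eq_big_seq => -[x v] /picks_perm /perm_mem pv; rewrite big_cons /=.
  have xs : x \in s by rewrite -pv inE eqxx.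
  have xy : x - y != 0 by rewrite subr_eq0; apply: contraNneq ys => <-.
  have yx : y - x != 0 by rewrite -opprB oppr_eq0.
  have ax : 1 - a * x != 0 by rewrite subr_eq0 eq_sym sa // inE xs orbT.
  by rewrite /kap; field; rewrite ax ay xy y0 yx.
rewrite big_split /= -mulr_suml sumrN -mulr_sumr.
by field.
Qed.

Lemma sum_picks_kap s : uniq s -> 0 \notin s ->
  \sum_(p <- picks s) \prod_(y <- p.2) kap t p.1 y = (1 - t ^+ size s) / (1 - t).
Proof.
move=> us s0; have t10 := tnz 0; rewrite expr1 in t10.
have := prod_partial_fraction (a := 0) us s0.
rewrite big1 => [|y _]; last by rewrite mulr0 !mul0r subr0 divr1.
rewrite (eq_bigr (fun p => \prod_(y <- p.2) kap t p.1 y)) => [E|p _]; last first.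
  by rewrite mul0r subr0 invr1 mul1r.
apply: (mulIf t10); rewrite divfK // mulrC [in RHS]E => [|y _]; first by ring.
by rewrite mul0r eq_sym oner_eq0.
Qed.

Lemma picks_map (T T' : eqType) (f : T -> T') v :
  picks (map f v) = [seq (f p.1, map f p.2) | p <- picks v].
Proof.
by elim: v => //= x v ->; rewrite -!map_comp; congr (_ :: _); apply: eq_map => p.
Qed.

Lemma picks_levels (k : nat) L s (E : K * nat -> seq (K * nat) -> K) :
  uniq L -> k \in L ->
  \sum_(p <- picks s) \sum_(l <- levels L p.2) E (p.1, k) l =
  \sum_(l <- levels L s) \sum_(r <- picks l | r.1.2 == k) E r.1 r.2.
Proof.
move=> uL kL; elim: s E => [|x s IHs] E; first by rewrite big_nil big_seq1 big_nil.
rewrite big_cons big_levels_cons big_map.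
under [in RHS]eq_bigr => j _ do under eq_bigr => l _ do rewrite /= big_cons big_map.
rewrite (bigD1_seq k) //= eqxx big_split /= -addrA; congr (_ + _).
transitivity (\sum_(j <- L) \sum_(l <- levels L s)
    \sum_(r <- picks l | r.1.2 == k) E r.1 ((x, j) :: r.2)).
  under eq_bigr do rewrite big_levels_cons.
  rewrite exchange_big; apply: eq_bigr => j _.
  exact: (IHs (fun a l => E a ((x, j) :: l))).
rewrite (bigD1_seq k) //=; congr (_ + _).
by apply: eq_bigr => j jk; apply: eq_bigr => l _; rewrite (negPf jk).
Qed.

Definition expo mu u : K := \prod_(p <- zip u mu) p.1 ^+ p.2.

(** The normalization v_la built one part at a time: counting the remaining copies of the part
    produces each (1 - t^j)/(1 - t) once per multiplicity. *)
Fixpoint vnorm mu : K :=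
  if mu is k :: mu' then (1 - t ^+ (count_mem k mu').+1) / (1 - t) * vnorm mu' else 1.

Definition monomial (l : seq (K * nat)) : K :=
  (\prod_(v <- l) v.1 ^+ v.2) * pairs (kapl t) l.

(** An ordering starts with a letter of maximal exponent k. Its factors with letters of lower
    exponent already occur in [monomial l]; those with the other letters of exponent k do not, and
    summing over which of these letters comes first gives one factor of [vnorm]. *)
Lemma sum_orderings_levels mu s L : sorted geq mu -> size s = size mu ->
  uniq s -> 0 \notin s -> uniq L -> {subset mu <= L} ->
  \sum_(u <- orderings (size mu) s) expo mu u * pairs (kap t) u =
  vnorm mu * \sum_(l <- levels L s | perm_eq (map snd l) mu) monomial l.
Proof.
move=> smu sz us s0 uL; elim: mu s smu sz us s0 => [|k mu IH] s smu sz us s0 muL.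
  by rewrite (size0nil sz) [in RHS]big_mkcond !big_seq1 /monomial /expo /= !big_nil !mulr1.
have kL : k \in L by rewrite muL ?inE ?eqxx.
have kmax : all (geq k) mu by apply: order_path_min smu => a b c /= ba cb; apply: leq_trans ba.
pose D l := if perm_eq (map snd l) mu then monomial l else 0.
rewrite big_orderingsS.
transitivity (vnorm mu * \sum_(p <- picks s) \sum_(l <- levels L p.2)
  p.1 ^+ k * (\prod_(v <- l) kap t p.1 v.1) * D l).
  rewrite mulr_sumr; apply: eq_big_seq => p /picks_perm ps.
  have /andP[_ up2] : uniq (p.1 :: p.2) by rewrite (perm_uniq ps).
  have sp2 : size p.2 = size mu by move: (perm_size ps); rewrite sz => -[].
  have p20 : 0 \notin p.2 by apply: contra s0; rewrite -(perm_mem ps) inE orbC => ->.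
  transitivity (p.1 ^+ k * (\prod_(y <- p.2) kap t p.1 y) *
     \sum_(u <- orderings (size mu) p.2) expo mu u * pairs (kap t) u).
    rewrite mulr_sumr; apply: eq_big_seq => u /(orderings_perm sp2) up.
    by rewrite /expo /= big_cons (perm_big _ up) /=; ring.
  rewrite IH ?(path_sorted smu) // => [|j jmu]; last by rewrite muL // inE jmu orbT.
  rewrite mulrCA; congr (_ * _); rewrite mulr_sumr [LHS]big_mkcond.
  apply: eq_big_seq => l /levels_fst <-; rewrite big_map /D.
  by case: ifP; rewrite ?mulr0.
rewrite (@picks_levels k L s (fun a l => a.1 ^+ k * (\prod_(v <- l) kap t a.1 v.1) * D l)) //.
rewrite [vnorm (k :: mu)]/= [_ / _ * _]mulrC -mulrA; congr (_ * _).
rewrite [in RHS]big_mkcond mulr_sumr.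
apply: eq_big_seq => l ls; case: ifPn => [pl|npl]; last first.
  rewrite mulr0 big1_seq // => r /andP[/eqP rk /picks_perm rl]; rewrite /D ifN ?mulr0 //.
  apply: contra npl => pr; have := perm_map snd rl; rewrite perm_sym => /permPl->.
  by rewrite /= rk perm_cons.
have lk v : v \in l -> (v.2 <= k)%N.
  move=> vl; have : v.2 \in map snd l by apply: map_f.
  by rewrite (perm_mem pl) inE => /predU1P[->//|/(allP kmax)].
transitivity (monomial l *
    \sum_(r <- picks l | r.1.2 == k) \prod_(v <- r.2 | v.2 == k) kap t r.1.1 v.1).
  rewrite big_mkcond [X in _ * X]big_mkcond mulr_sumr; apply: eq_big_seq => r.
  move=> /picks_perm rl; case: eqP => [rk|]; last by rewrite mulr0.
  rewrite /D ifT; last first.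
    have := perm_map snd rl; rewrite perm_sym => /permPl lr.
    by move: pl; rewrite lr /= rk perm_cons.
  have -> : monomial l = monomial (r.1 :: r.2).
    by rewrite /monomial -(perm_big _ rl) -(pairs_perm (kaplC t) rl).
  rewrite /monomial big_cons /= rk.
  have -> : \prod_(v <- r.2) kap t r.1.1 v.1 =
     \prod_(v <- r.2) kapl t r.1 v * \prod_(v <- r.2 | v.2 == k) kap t r.1.1 v.1.
    rewrite [X in _ * X]big_mkcond -big_split; apply: eq_big_seq => v vr /=.
    have := lk v; rewrite -(perm_mem rl) inE vr orbT => /(_ isT).
    rewrite /kapl rk leq_eqVlt; case: ltngtP => //= _ _; first by rewrite mulr1.
    by rewrite mul1r.
  by ring.
(* What is left is the sum over the first letter within level k alone, to be evaluated by
   [sum_picks_kap]. *)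
rewrite mulrC; congr (_ * _).
pose P (v : K * nat) := v.2 == k.
have -> : \sum_(r <- picks l | r.1.2 == k) \prod_(v <- r.2 | v.2 == k) kap t r.1.1 v.1 =
    \sum_(r <- picks (filter P l)) \prod_(v <- r.2) kap t r.1.1 v.1.
  rewrite -(big_picks_filter P (fun a v => \prod_(w <- v) kap t a.1 w.1)).
  by apply: eq_bigr => r _; rewrite big_filter.
have uf : uniq (map fst (filter P l)).
  apply: subseq_uniq (us); rewrite -(levels_fst ls).
  by apply: map_subseq; apply: filter_subseq.
have f0 : 0 \notin map fst (filter P l).
  apply: contra s0; rewrite -(levels_fst ls) => /mapP[v].
  by rewrite mem_filter => /andP[_ vl] ->; apply: map_f.
have sf : size (filter P l) = (count_mem k mu).+1.
  have -> : size (filter P l) = count_mem k (map snd l) by rewrite size_filter count_map.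
  by move/seq.permP: pl => ->; rewrite /= eqxx.
rewrite -sf -(size_map fst (filter P l)) -sum_picks_kap // picks_map big_map.
by apply: eq_bigr => r _; rewrite big_map.
Qed.

Definition pad N la : seq nat := mkseq (nth 0%N la) N.

Lemma pad_cat N la : (size la <= N)%N -> pad N la = la ++ nseq (N - size la) 0%N.
Proof.
move=> laN; apply: (@eq_from_nth _ 0%N) => [|i].
  by rewrite size_mkseq size_cat size_nseq subnKC.
rewrite size_mkseq => iN; rewrite nth_mkseq // nth_cat nth_nseq.
by case: ltnP => // lai; rewrite nth_default //; case: ifP.
Qed.

Lemma sorted_pad N la : (size la <= N)%N -> sorted geq la -> sorted geq (pad N la).
Proof.
have tr : transitive geq by move=> a b c /= ba cb; apply: leq_trans ba.
move=> laN; rewrite pad_cat // !(sorted_pairwise tr) pairwise_cat => ->.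
rewrite andTb; apply/andP; split.
  by apply/allrelP => a b _ /nseqP[-> _] /=.
by elim: (_ - _)%N => //= k ->; rewrite all_nseq orbT.
Qed.

Lemma HL_v_vnorm N la : sorted geq la -> (size la <= N)%N -> HL_v N la t = vnorm (pad N la).
Proof.
move=> sla laN.
have mE i : multiplicity N la i = count_mem i (pad N la).
  rewrite /multiplicity /pad count_map -sum1_count [RHS]big_mkcond /=.
  have -> : iota 0 N = index_iota 0 N by rewrite /index_iota subn0.
  by rewrite big_mkord; apply: eq_bigr => j _; case: eqP.
have lt : {in pad N la, forall i, (i < (nth 0 la 0).+1)%N}.
  move=> i; rewrite pad_cat // mem_cat => /orP[|/nseqP[->]] //.
  case: la sla {laN mE} => //= k la' /(order_path_min) kla.
  rewrite inE => /predU1P[->//|ila]; rewrite ltnS.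
  have tr : transitive geq by move=> a b c /= ba cb; apply: leq_trans ba.
  by move/(_ tr)/allP/(_ i ila): kla.
rewrite /HL_v; under eq_bigr do rewrite mE.
elim: (pad N la) (_.+1) lt => [|k mu IH] B muB.
  by apply: big1 => i _; rewrite /qpoch big_geq // expr0 divr1.
have kB : (k < B)%N by apply: muB; rewrite inE eqxx.
rewrite /= -(IH B) => [|i imu]; last by apply: muB; rewrite inE imu orbT.
rewrite !big_mkord (bigD1 (Ordinal kB)) // [in RHS](bigD1 (Ordinal kB)) //= eqxx mulrA.
congr (_ * _).
  rewrite /qpoch big_nat_recr //= -/(qpoch _ _ _) add1n [in X in _ / X]exprS exprS invfM.
  by ring.
apply: eq_bigr => i; rewrite -val_eqE /= => ik.
by rewrite eq_sym (negPf ik).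
Qed.

Lemma vnorm_neq0 mu : vnorm mu != 0.
Proof.
elim: mu => [|k mu IH] /=; first exact: oner_neq0.
by rewrite !mulf_neq0 ?invr_eq0 //; have := tnz 0; rewrite expr1.
Qed.

(** The list [L] of admissible levels is left free so that it can later consist of even numbers, as
    suits the partitions 2 la. *)
Theorem HL_P_levels N la (x : 'I_N -> K) L : sorted geq la -> (size la <= N)%N ->
  injective x -> (forall i, x i != 0) -> uniq L -> {subset pad N la <= L} ->
  HL_P la x t = \sum_(l <- levels L [seq x i | i <- enum 'I_N]
                       | perm_eq (map snd l) (pad N la)) monomial l.
Proof.
move=> sla laN xi x0 uL laL; rewrite /HL_P laN HL_v_vnorm //.
set s := [seq x i | i <- enum 'I_N].
have sp : size (pad N la) = N by rewrite size_mkseq.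
have ss : size s = size (pad N la) by rewrite size_map size_enum_ord sp.
have us : uniq s by rewrite map_inj_uniq ?enum_uniq.
have s0 : 0 \notin s by apply/mapP=> -[i _ xi0]; case/eqP: (x0 i).
apply: (mulfI (vnorm_neq0 (pad N la))); rewrite mulVKf ?vnorm_neq0 //.
rewrite -sum_orderings_levels ?sorted_pad // sp.
rewrite -(sum_perm_orderings x (fun u => expo (pad N la) u * pairs (kap t) u)).
apply: eq_bigr => w _; rewrite pairs_ord; congr (_ * _).
rewrite /expo /pad /mkseq -val_enum_ord -map_comp.
have zm (A B C : Type) (f : A -> B) (g : A -> C) v :
    zip (map f v) (map g v) = [seq (f a, g a) | a <- v].
  by elim: v => //= a v ->.
by rewrite zm big_map big_enum.
Qed.

End HallLittlewoodLevels.

(** * q-adic analysis in Q((q)) *)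

Local Notation "x %:F" := (@FracField.tofrac (fps rat) x).

Section PowerSeries.
Implicit Types f g h : fps rat.

Lemma fcoefD f g k : fcoef (f + g) k = fcoef f k + fcoef g k. Proof. by []. Qed.

Lemma fcoefB f g k : fcoef (f - g) k = fcoef f k - fcoef g k. Proof. by []. Qed.

Lemma fcoefM f g k : fcoef (f * g) k = \sum_(i < k.+1) fcoef f i * fcoef g (k - i).
Proof. by []. Qed.

Definition vanish_below d f := forall i, (i < d)%N -> fcoef f i = 0.

Lemma vanish_belowM a b f g :
  vanish_below a f -> vanish_below b g -> vanish_below (a + b) (f * g).
Proof.
move=> fa gb k kab; rewrite fcoefM big1 // => i _.
have [ia|ai] := ltnP i a; first by rewrite fa // mul0r.
by rewrite gb ?mulr0 //; have := ltn_ord i; lia.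
Qed.

Lemma vanish_belowX f k : vanish_below 1 f -> vanish_below k (f ^+ k).
Proof.
by move=> f1; elim: k => [|k IHk] //; rewrite exprS -add1n; apply: vanish_belowM.
Qed.

Lemma vanish_below_fpsX k : vanish_below k (fpsX rat ^+ k).
Proof. by apply: vanish_belowX => -[]. Qed.

Lemma fcoef_mulX f k : fcoef (fpsX rat * f) k = if k is k'.+1 then fcoef f k' else 0.
Proof.
rewrite fcoefM big_ord_recl /= mul0r add0r.
case: k => [|k]; first by rewrite big_ord0.
rewrite big_ord_recl /= mul1r subn1 big1 ?addr0 // => i _.
by rewrite /= mul0r.
Qed.

(** The geometric series in [h]: the coefficient of index k no longer changes from the partial sum
    [S k] on. *)
Lemma fps_one_sub_unit h : fcoef h 0 = 0 -> exists g, (1 - h) * g = 1.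
Proof.
move=> h0; have h1 : vanish_below 1 h by move=> [].
pose S k := \sum_(i < k.+1) h ^+ i.
have SE j k : (j <= k)%N -> fcoef (S k) j = fcoef (S j) j.
  move=> jk; rewrite -(subnKC jk); elim: (k - j)%N => [|m IHm]; first by rewrite addn0.
  rewrite -IHm addnS /S big_ord_recr fcoefD [X in _ + X]vanish_belowX ?addr0 //.
  by rewrite ltnS leq_addr.
exists (Fps (fun k => fcoef (S k) k)); apply: fpsP => k.
transitivity (fcoef ((1 - h) * S k) k).
  rewrite !fcoefM; apply: eq_bigr => i _; congr (_ * _) => /=.
  by rewrite [RHS]SE // leq_subr.
have -> : (1 - h) * S k = 1 - h ^+ k.+1.
  rewrite -[1 in RHS](expr1n _ k.+1) subrXX; congr (_ * _).
  by apply: eq_bigr => i _; rewrite expr1n mul1r.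
by rewrite fcoefB [X in _ - X]vanish_belowX ?subr0.
Qed.

End PowerSeries.

(** * The q-adic filtration, units congruent to 1, and limits *)

Section Valuation.
Implicit Types (a b : laurent) (d e : int).

(** The fractional ideal q^d Q[[q]]. Negative [d] is allowed because the determinants and Gaussian
    factors below are Laurent polynomials. *)
Definition vge d a : Prop := exists h : fps rat, a = q ^ d * h%:F.

Lemma q_neq0 : q != 0.
Proof.
rewrite tofrac_eq0; apply/eqP => /(congr1 (fun f => fcoef f 1)) /= /eqP.
by rewrite oner_eq0.
Qed.

Lemma qX (k : nat) : q ^+ k = (fpsX rat ^+ k)%:F.
Proof. by rewrite rmorphXn. Qed.

Lemma vge0 d : vge d 0.
Proof. by exists 0; rewrite rmorph0 mulr0. Qed.

Lemma vge_tofrac h : vge 0 h%:F.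
Proof. by exists h; rewrite expr0z mul1r. Qed.

Lemma vge1 : vge 0 1.
Proof. by rewrite -[1]/(1%:F); exact: vge_tofrac. Qed.

Lemma vgeD d a b : vge d a -> vge d b -> vge d (a + b).
Proof. by move=> [f ->] [g ->]; exists (f + g); rewrite rmorphD mulrDr. Qed.

Lemma vgeN d a : vge d a -> vge d (- a).
Proof. by move=> [f ->]; exists (- f); rewrite rmorphN mulrN. Qed.

Lemma vgeB d a b : vge d a -> vge d b -> vge d (a - b).
Proof. by move=> da db; apply: vgeD => //; apply: vgeN. Qed.

Lemma vgeM d e a b : vge d a -> vge e b -> vge (d + e) (a * b).
Proof.
move=> [f ->] [g ->]; exists (f * g).
by rewrite rmorphM expfzDr ?q_neq0 // mulrACA.
Qed.

Lemma vge_le d e a : (e <= d)%R -> vge d a -> vge e a.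
Proof.
move=> ed [f ->]; have dE : d = e + `|d - e|%N by lia.
rewrite {1}dE; exists (fpsX rat ^+ `|d - e|%N * f).
by rewrite rmorphM /= -qX mulrA expfzDr ?q_neq0.
Qed.

Lemma vge_qz d : vge d (q ^ d).
Proof. by exists 1; rewrite rmorph1 mulr1. Qed.

Lemma vge_sum (I : eqType) (r : seq I) (P : pred I) (F : I -> laurent) d :
  (forall i, i \in r -> P i -> vge d (F i)) -> vge d (\sum_(i <- r | P i) F i).
Proof.
move=> rF; rewrite big_seq_cond; elim/big_ind: _ => [||i /andP[/rF]//].
  exact: vge0.
exact: vgeD.
Qed.

Lemma vge_prod (I : eqType) (r : seq I) (P : pred I) (F : I -> laurent) :
  (forall i, i \in r -> P i -> vge 0 (F i)) -> vge 0 (\prod_(i <- r | P i) F i).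
Proof.
move=> rF; rewrite big_seq_cond; elim/big_ind: _ => [||i /andP[/rF]//].
  exact: vge1.
by move=> x y x0 y0; rewrite -[0]addr0; apply: vgeM.
Qed.

Lemma vge_tofracP (d : nat) (f : fps rat) : vge d f%:F <-> vanish_below d f.
Proof.
split=> [[h]|fd].
  rewrite -exprnP qX -rmorphM => /eqP; rewrite tofrac_eq => /eqP-> k kd.
  have := @vanish_belowM d 0 _ h (@vanish_below_fpsX d) => -> //.
  by rewrite addn0.
exists (Fps (fun k => fcoef f (d + k))); rewrite -exprnP qX -rmorphM; congr _%:F.
elim: d f fd => [|d IHd] f fd; first by rewrite mul1r; apply: fpsP.
have fE : f = fpsX rat * Fps (fun k => fcoef f k.+1).
  apply: fpsP => k; rewrite fcoef_mulX; case: k => [|k] //.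
  by rewrite fd.
rewrite exprS -mulrA -(IHd (Fps (fun k => fcoef f k.+1))) //.
by move=> k kd; rewrite /= fd.
Qed.

Lemma vge_eq0 a : (forall d : nat, vge d a) -> a = 0.
Proof.
move=> all_d; have [h] := all_d 0%N; rewrite expr0z mul1r => aE.
rewrite aE (_ : h = 0) ?rmorph0 //; apply: fpsP => k.
by have := all_d k.+1; rewrite aE => /vge_tofracP; apply.
Qed.

Definition cong d a b : Prop := vge d (a - b).

Lemma eqmodqE (d : nat) a b : eqmodq d a b <-> cong d a b. Proof. by []. Qed.

Lemma cong_refl d a : cong d a a. Proof. by rewrite /cong subrr; exact: vge0. Qed.

Lemma cong_sym d a b : cong d a b -> cong d b a.
Proof. by rewrite /cong -opprB => /vgeN; rewrite opprK. Qed.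

Lemma cong_trans d b a c : cong d a b -> cong d b c -> cong d a c.
Proof. by move=> ab bc; rewrite /cong -(subrKA b); apply: vgeD. Qed.

Lemma cong_le d e a b : (e <= d)%R -> cong d a b -> cong e a b.
Proof. exact: vge_le. Qed.

Lemma congD d a a' b b' : cong d a a' -> cong d b b' -> cong d (a + b) (a' + b').
Proof. by move=> aa bb; rewrite /cong opprD addrACA; apply: vgeD. Qed.

Lemma congM e d a a' b b' : vge e a -> vge e b' -> cong (d - e) a a' -> cong (d - e) b b' ->
  cong d (a * b) (a' * b').
Proof.
move=> a0 b0 aa bb; rewrite /cong.
have -> : a * b - a' * b' = a * (b - b') + (a - a') * b' by rewrite mulrBr mulrBl addrA subrK.
by rewrite -[d](subrKC e); apply: vgeD; [|rewrite addrC]; apply: vgeM.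
Qed.

Lemma congM0 d a a' b b' : vge 0 a -> vge 0 b' -> cong d a a' -> cong d b b' ->
  cong d (a * b) (a' * b').
Proof. by move=> a0 b0 aa bb; apply: (@congM 0); rewrite ?subr0. Qed.

Lemma cong_sum (I : eqType) (r : seq I) (P : pred I) (F G : I -> laurent) d :
  (forall i, i \in r -> P i -> cong d (F i) (G i)) ->
  cong d (\sum_(i <- r | P i) F i) (\sum_(i <- r | P i) G i).
Proof. by move=> FG; rewrite /cong -sumrB; apply: vge_sum. Qed.

Lemma cong_prod (I : eqType) (r : seq I) (P : pred I) (F G : I -> laurent) d :
  (forall i, i \in r -> P i -> vge 0 (F i)) -> (forall i, i \in r -> P i -> vge 0 (G i)) ->
  (forall i, i \in r -> P i -> cong d (F i) (G i)) ->
  cong d (\prod_(i <- r | P i) F i) (\prod_(i <- r | P i) G i).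
Proof.
elim: r => [|i r IHr] F0 G0 FG; first by rewrite !big_nil; exact: cong_refl.
have ir := mem_head i r; have sub j : j \in r -> j \in i :: r by rewrite inE orbC => ->.
rewrite !big_cons; case: ifP => Pi; last by apply: IHr => j /sub; auto.
apply: congM0; [exact: F0 | by apply: vge_prod => j /sub; auto | exact: FG |].
by apply: IHr => j /sub; auto.
Qed.

(** The group 1 + q Q[[q]]: on it inversion preserves congruences, so quotients of Pochhammer
    symbols can be approximated factor by factor. *)
Definition one_unit a : Prop := cong 1 a 1.

Lemma one_unit_tofrac a : one_unit a -> exists2 h, fcoef h 0 = 0 & a = (1 - h)%:F.
Proof.
case=> h; rewrite expr1z => /eqP; rewrite subr_eq addrC => /eqP ->.
exists (- (fpsX rat * h)); last by rewrite opprK rmorphD rmorph1 rmorphM.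
by rewrite -mulrN fcoef_mulX.
Qed.

Lemma one_unit_neq0 a : one_unit a -> a != 0.
Proof.
case/one_unit_tofrac => h h0 ->; rewrite tofrac_eq0; apply/eqP.
by move/(congr1 (fun f => fcoef f 0)); rewrite fcoefB h0 subr0 => /eqP; rewrite oner_eq0.
Qed.

Lemma one_unit_vge0 a : one_unit a -> vge 0 a.
Proof. by case/one_unit_tofrac => h _ ->; exact: vge_tofrac. Qed.

Lemma vge_one_unitV a : one_unit a -> vge 0 a^-1.
Proof.
move=> a1; have a0 := one_unit_neq0 a1; have [h h0 aE] := one_unit_tofrac a1.
have [g /(congr1 (fun f => f%:F)) /=] := fps_one_sub_unit h0.
rewrite tofracM tofrac1 -aE => ag; rewrite -[a^-1]mulr1 -ag mulKf //.
exact: vge_tofrac.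
Qed.

Lemma one_unit1 : one_unit 1. Proof. exact: cong_refl. Qed.

Lemma one_unitM a b : one_unit a -> one_unit b -> one_unit (a * b).
Proof.
move=> a1 b1; rewrite /one_unit -[X in cong _ _ X](mulr1 1).
by apply: congM0 => //; [exact: one_unit_vge0 | exact: vge1].
Qed.

Lemma one_unitV a : one_unit a -> one_unit a^-1.
Proof.
move=> a1; have a0 := one_unit_neq0 a1; rewrite /one_unit /cong.
have -> : a^-1 - 1 = (1 - a) * a^-1 by rewrite mulrBl mul1r mulfV.
rewrite -[X in vge X _]addr0; apply: vgeM; last exact: vge_one_unitV.
exact: cong_sym.
Qed.

Lemma one_unit_prod (I : Type) (r : seq I) (P : pred I) (F : I -> laurent) :
  (forall i, P i -> one_unit (F i)) -> one_unit (\prod_(i <- r | P i) F i).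
Proof.
by move=> F1; elim/big_ind: _ => //; [exact: one_unit1 | exact: one_unitM].
Qed.

Lemma congV d a b : one_unit a -> one_unit b -> cong d a b -> cong d a^-1 b^-1.
Proof.
move=> a1 b1 ab; rewrite /cong.
have -> : a^-1 - b^-1 = (b - a) * (a^-1 * b^-1).
  by rewrite mulrBl mulrCA mulfV ?one_unit_neq0 // mulr1 mulrA mulfV ?mul1r ?one_unit_neq0.
rewrite -[d]addr0; apply: vgeM; first exact: cong_sym.
by apply: one_unit_vge0; apply: one_unitM; apply: one_unitV.
Qed.

Lemma one_unit_sub_qz d : (0 < d)%R -> one_unit (1 - q ^ d).
Proof.
move=> d0; rewrite /one_unit /cong addrAC subrr add0r.
by apply: vgeN; apply: vge_le (vge_qz d).
Qed.

Lemma qz_eq1 d : (q ^ d == 1) = (d == 0).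
Proof.
have pos e : (0 < e)%R -> q ^ e != 1.
  move=> e0; have := one_unit_neq0 (one_unit_sub_qz e0).
  by rewrite subr_eq0 eq_sym.
case: (ltgtP d 0) => d0; last by rewrite d0 expr0z eqxx.
  have := pos (- d); rewrite -invr_expz invr_eq1 => /(_ _)/negPf ->; last by lia.
  by apply/esym/eqP; lia.
by rewrite (negPf (pos _ d0)); apply/esym/eqP; lia.
Qed.

Lemma qz_inj : injective (fun d => q ^ d).
Proof.
move=> d e /= de; apply/eqP; rewrite -subr_eq0 -qz_eq1 expfzDr ?q_neq0 // de.
by rewrite -expfzDr ?q_neq0 // subrr expr0z.
Qed.

Lemma converges_unique u l l' : converges_to u l -> converges_to u l' -> l = l'.
Proof.
move=> ul ul'; apply/eqP; rewrite -subr_eq0; apply/eqP/vge_eq0 => d.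
have [N1 u1] := ul d; have [N2 u2] := ul' d; pose N := maxn N1 N2.
have c1 : cong d (u N) l := u1 N (leq_maxl _ _).
have c2 : cong d (u N) l' := u2 N (leq_maxr _ _).
exact: cong_trans (cong_sym c1) c2.
Qed.

Lemma limqE u l : converges_to u l -> limq u = l.
Proof.
move=> ul; rewrite /limq; case: xgetP => [l' _ /= ul'|/(_ l)//].
exact: converges_unique ul' ul.
Qed.

Lemma cauchy_converges u : (forall N, vge 0 (u N)) ->
  (forall N : nat, cong N (u N.+1) (u N)) ->
  exists l, forall N : nat, cong N (u N) l.
Proof.
move=> u0 uC; have /choice[h hE] : forall N, exists h, u N = h%:F.
  by move=> N; have [h] := u0 N; rewrite expr0z mul1r => ->; exists h.
have far (N k : nat) : cong N (u (N + k)%N) (u N).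
  elim: k => [|k IHk]; first by rewrite addn0; exact: cong_refl.
  by apply: cong_trans IHk; rewrite addnS; apply: cong_le (uC _); lia.
(* Precision k + 1 is the first that fixes the coefficient of index k. *)
exists (Fps (fun k => fcoef (h k.+1) k))%:F => N; rewrite /cong hE -rmorphB.
apply/vge_tofracP => k kN; rewrite fcoefB /=.
have := far k.+1 (N - k.+1)%N; rewrite subnKC // /cong !hE -rmorphB.
by move/vge_tofracP => /(_ k (leqnn _)).
Qed.

Lemma cong_converges u l : (forall N : nat, cong N (u N) l) -> converges_to u l.
Proof. by move=> ul d; exists d => N dN; apply: (@cong_le N d); rewrite ?lez_nat. Qed.

Lemma one_unit_limit u l : (forall N : nat, cong N (u N) l) -> (forall N, one_unit (u N)) ->
  one_unit l.
Proof.
by move=> ul u1; apply: (cong_trans (b := u 1%N)); [apply: cong_sym; exact: (ul 1%N) | exact: u1].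
Qed.

Section Pochhammer.
Variables i j : nat.
Hypotheses (i0 : (0 < i)%N) (j0 : (0 < j)%N).

Lemma one_unit_qpoch k : one_unit (qpoch (q ^+ i) (q ^+ j) k).
Proof.
apply: one_unit_prod => l _; rewrite -exprM -exprD.
by apply: (@one_unit_sub_qz (i + j * l)%N); lia.
Qed.

Lemma cong_qpoch_inf (N k : nat) : (N <= k)%N ->
  cong N (qpoch (q ^+ i) (q ^+ j) k) (qpoch_inf (q ^+ i) (q ^+ j)).
Proof.
move=> Nk; suff ul : forall M : nat, cong M (qpoch (q ^+ i) (q ^+ j) M)
    (qpoch_inf (q ^+ i) (q ^+ j)) by apply: cong_le (ul k); rewrite lez_nat.
have [||l ul] := @cauchy_converges (qpoch (q ^+ i) (q ^+ j)).
- by move=> M; apply: one_unit_vge0; apply: one_unit_qpoch.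
- move=> M; rewrite /qpoch big_nat_recr //= -/(qpoch _ _ M) /cong.
  have -> : qpoch (q ^+ i) (q ^+ j) M * (1 - q ^+ i * (q ^+ j) ^+ M) -
    qpoch (q ^+ i) (q ^+ j) M = - (q ^+ i * (q ^+ j) ^+ M * qpoch (q ^+ i) (q ^+ j) M).
    by rewrite mulrBr mulr1 addrAC subrr add0r mulrC.
  apply: vgeN; rewrite -exprM -exprD -[M%:Z]addr0; apply: vgeM.
    apply: vge_le (vge_qz (i + j * M)%N); rewrite lez_nat.
    by apply: leq_trans (leq_addl _ _); rewrite leq_pmull.
  by apply: one_unit_vge0; apply: one_unit_qpoch.
by move=> M; rewrite /qpoch_inf (limqE (cong_converges ul)).
Qed.

Lemma one_unit_qpoch_inf : one_unit (qpoch_inf (q ^+ i) (q ^+ j)).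
Proof.
by apply: one_unit_limit (fun N => cong_qpoch_inf (leqnn N)) _ => N; exact: one_unit_qpoch.
Qed.

End Pochhammer.

End Valuation.

(** * Equality of the two products *)

Section EulerProducts.
Implicit Types (a b : laurent) (e f : nat -> nat) (d k : nat).

(** The infinite product of the (1 - q^k)^(e k), which is congruent to its truncation at d modulo
    q^d. The exponents are natural numbers, so quotients are compared after cross-multiplication. *)
Definition is_euler a e : Prop :=
  forall d, cong d a (\prod_(1 <= k < d.+1) (1 - q ^+ k) ^+ e k).

Lemma one_unit_sub_q k : (0 < k)%N -> one_unit (1 - q ^+ k).
Proof. by move=> k0; apply: (@one_unit_sub_qz k). Qed.

Lemma one_unit_exp a k : one_unit a -> one_unit (a ^+ k).
Proof.
by move=> a1; elim: k => [|k IHk]; [exact: one_unit1 | rewrite exprS; exact: one_unitM].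
Qed.

Lemma one_unit_euler_trunc e d : one_unit (\prod_(1 <= k < d.+1) (1 - q ^+ k) ^+ e k).
Proof.
rewrite big_nat; apply: one_unit_prod => k /andP[k0 _].
by apply: one_unit_exp; apply: one_unit_sub_q.
Qed.

Lemma euler_one_unit a e : is_euler a e -> one_unit a.
Proof. by move=> /(_ 1%N) ae; apply: cong_trans ae (one_unit_euler_trunc e 1). Qed.

Lemma euler_unique a b e : is_euler a e -> is_euler b e -> a = b.
Proof.
move=> ae be; apply/eqP; rewrite -subr_eq0; apply/eqP/vge_eq0 => d.
exact: cong_trans (ae d) (cong_sym (be d)).
Qed.

Lemma eq_euler a e f : (forall k, (0 < k)%N -> e k = f k) -> is_euler a e -> is_euler a f.
Proof.
move=> ef ae d; have := ae d; rewrite big_nat [in X in _ -> X]big_nat.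
by under eq_bigr => k /andP[k0 _] do rewrite ef //.
Qed.

Lemma euler1 : is_euler 1 (fun=> 0%N).
Proof. by move=> d; rewrite big1 => [|k _]; [exact: cong_refl | rewrite expr0]. Qed.

Lemma eulerM a b e f : is_euler a e -> is_euler b f -> is_euler (a * b) (fun k => e k + f k)%N.
Proof.
move=> ae bf d; under eq_bigr do rewrite exprD; rewrite big_split.
apply: congM0 => //; first by apply: one_unit_vge0; apply: euler_one_unit ae.
by apply: one_unit_vge0; apply: one_unit_euler_trunc.
Qed.

Lemma eulerX a e m : is_euler a e -> is_euler (a ^+ m) (fun k => m * e k)%N.
Proof.
move=> ae; elim: m => [|m IHm]; first by apply: eq_euler euler1.
by rewrite exprS; apply: eq_euler (eulerM ae IHm) => k _; rewrite mulSn.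
Qed.

Lemma euler_prod m1 m2 (F : nat -> laurent) (e : nat -> nat -> nat) :
  (forall i, (m1 <= i < m2)%N -> is_euler (F i) (e i)) ->
  is_euler (\prod_(m1 <= i < m2) F i) (fun k => \sum_(m1 <= i < m2) e i k)%N.
Proof.
move=> Fe; have [le|lt] := leqP m2 m1.
  by rewrite big_geq //; apply: eq_euler euler1 => k _; rewrite big_geq.
rewrite -(subnKC (ltnW lt)) in Fe *; elim: (m2 - m1)%N Fe => [|n IHn] Fe.
  by rewrite addn0 big_geq //; apply: eq_euler euler1 => k _; rewrite big_geq.
rewrite addnS big_nat_recr ?leq_addr //=.
apply: eq_euler (eulerM (IHn _) (Fe _ _)) => [k _|i im|]; last by lia.
  by rewrite big_nat_recr ?leq_addr.
by apply: Fe; lia.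
Qed.

Lemma euler_qpoch_inf i j : (0 < i)%N -> (0 < j)%N ->
  is_euler (qpoch_inf (q ^+ i) (q ^+ j)) (fun k => (i <= k) && (j %| k - i))%N.
Proof.
move=> i0 j0 d; apply: cong_trans (cong_sym (cong_qpoch_inf i0 j0 (leqnn d))) _.
have countE k : (k <= d)%N ->
    ((i <= k) && (j %| k - i))%N = (\sum_(0 <= l < d) (k == i + j * l))%N :> nat.
  move=> kd; case: andP => [[ik /dvdnP[c kc]]|nk]; last first.
    rewrite big1 // => l _; apply/eqP; rewrite eqb0; apply/eqP => kl; case: nk; split; first by lia.
    by apply/dvdnP; exists l; lia.
  have cd : (c < d)%N by nia.
  rewrite big_mkord (bigD1 (Ordinal cd)) //= big1 => [|l]; first by have -> : k == (i + j * c)%N by nia.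
  rewrite -val_eqE /= => lc; apply/eqP; rewrite eqb0; apply: contra lc => /eqP kl; apply/eqP; nia.
rewrite big_nat; under eq_bigr => k /andP[_ kd] do
  rewrite countE // (big_morph _ (exprD (1 - q ^+ k)) (expr0 _)).
(* Regrouped by l, the inner product has the single factor with k = i + j l, or is 1 when this index
   exceeds d; in that case the factor of the Pochhammer symbol is 1 modulo q^d. *)
rewrite -big_nat exchange_big /=; apply: cong_prod => [l _ _|l _ _|l _ _].
- by rewrite -exprM -exprD; apply/one_unit_vge0/one_unit_sub_q; lia.
- rewrite big_nat; apply: vge_prod => k _ /andP[k0 _].
  by apply/one_unit_vge0/one_unit_exp/one_unit_sub_q.
rewrite -exprM -exprD; have [le|lt] := leqP (i + j * l) d.
  rewrite (bigD1_seq (i + j * l)%N) ?iota_uniq ?mem_index_iota //=; last by lia.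
  rewrite eqxx expr1 big1 ?mulr1 => [|k /negPf->]; first exact: cong_refl.
  by rewrite expr0.
rewrite big_nat big1 => [|k /andP[_ kd]]; last first.
  by have -> : (k == i + j * l)%N = false by apply/eqP; lia.
rewrite /cong addrAC subrr add0r; apply: vgeN.
by apply: vge_le (vge_qz (i + j * l)%N); rewrite lez_nat; lia.
Qed.

Lemma q_div i j : (i <= j)%N -> q ^+ j / q ^+ i = q ^+ (j - i).
Proof. by move=> ij; rewrite -[in LHS](subnK ij) exprD mulfK // expf_neq0 // q_neq0. Qed.

Lemma euler_theta i j : (0 < i)%N -> (i < j)%N ->
  is_euler (theta (q ^+ i) (q ^+ j)) (fun k => (k %% j == i) + (k %% j == j - i))%N.
Proof.
move=> i0 ij; have j0 : (0 < j)%N by lia.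
have modE k l : (l < j)%N -> ((l <= k) && (j %| k - l))%N = (k %% j == l)%N.
  move=> lj; apply/andP/eqP => [[lk /dvdnP[c kc]]|kl].
    have -> : k = (c * j + l)%N by lia.
    by rewrite modnMDl modn_small.
  have := divn_eq k j; rewrite kl => ->; split; first exact: leq_addl.
  by rewrite addnK dvdn_mull.
rewrite /theta q_div ?(ltnW ij) //.
apply: eq_euler (eulerM (euler_qpoch_inf i0 j0) (euler_qpoch_inf _ j0)); last by lia.
by move=> k k0; rewrite !modE //; lia.
Qed.

Lemma euler_qpoch_inf_self j : (0 < j)%N ->
  is_euler (qpoch_inf (q ^+ j) (q ^+ j)) (fun k => j %| k)%N.
Proof.
move=> j0; apply: eq_euler (euler_qpoch_inf j0 j0) => k k0; congr nat_of_bool.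
apply/andP/idP => [[jk]|]; first by rewrite dvdn_subl.
by move=> jk; have le := dvdn_leq k0 jk; rewrite dvdn_subl.
Qed.

End EulerProducts.

(** * Counting the factors 1 - q^k in the two products *)

Section Counting.
Implicit Types (n s : nat).

Lemma count_eq n s : (\sum_(1 <= i < n.+1) (s == i) = (0 < s <= n))%N.
Proof.
elim: n => [|n IHn]; first by rewrite big_geq //; lia.
by rewrite big_nat_recr //= IHn; lia.
Qed.

Lemma count_shift n s (c : nat) :
  (\sum_(1 <= i < n.+1) (s == i + c) = (c < s <= n + c))%N.
Proof.
elim: n => [|n IHn]; first by rewrite big_geq //; lia.
by rewrite big_nat_recr //= IHn; lia.
Qed.

Lemma count_rev n (c s : nat) : (n <= c)%N ->
  (\sum_(1 <= i < n.+1) (s == c - i) = ((c <= s + n) && (s < c)))%N.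
Proof.
elim: n => [|n IHn] nc; first by rewrite big_geq //; lia.
by rewrite big_nat_recr //= IHn; lia.
Qed.

Lemma count_difference n s :
  (\sum_(1 <= j < n.+1) \sum_(1 <= i < j) (s == j - i) = if s == 0 then 0 else n - s)%N.
Proof.
elim: n => [|n IHn]; first by rewrite big_geq //; case: ifP => ?; lia.
rewrite big_nat_recr //= IHn; case: n {IHn} => [|n]; first by rewrite big_geq //; case: ifP => ?; lia.
by rewrite count_rev //; case: ifP => ?; lia.
Qed.

(** With u = s - c, the index i runs from max(1, u - n) to the integer part of (u - 1)/2. Truncated
    subtraction also gives 0 when u is out of range. *)
Lemma count_sum n s c :
  (\sum_(1 <= j < n.+1) \sum_(1 <= i < j) (s == i + j + c) =
   (s - c - 1)./2 - (s - c - n - 1))%N.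
Proof.
elim: n => [|n IHn]; first by rewrite big_geq //; lia.
rewrite big_nat_recr //= IHn; case: n {IHn} => [|n]; first by rewrite big_geq //; lia.
under [X in (_ + X)%N]eq_bigr do rewrite -addnA.
by rewrite count_shift //; lia.
Qed.

Let pair_count n p s c : nat :=
  ((s - c - 1)./2 - (s - c - n - 1) + ((p - s - c - 1)./2 - (p - s - c - n - 1)))%N.

Lemma sum_pair_counts n s p c : (2 * n + c <= p)%N -> (s < p)%N ->
  (\sum_(1 <= j < n.+1) \sum_(1 <= i < j)
     ((s == j - i) + (s == p - (j - i)) + ((s == i + j + c) + (s == p - (i + j + c)))) =
   (if s == 0 then 0 else n - s) + (n - (p - s)) + pair_count n p s c)%N.
Proof.
move=> np sp; rewrite /pair_count -!count_sum -count_difference.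
have -> : (n - (p - s))%N =
    (\sum_(1 <= j < n.+1) \sum_(1 <= i < j) (p - s == j - i))%N.
  by rewrite count_difference; case: ifP => ?; lia.
rewrite -!big_split; apply: eq_big_nat => j jn; rewrite -!big_split.
by apply: eq_big_nat => i ij /=; lia.
Qed.

(** Writing r = b + 2h makes the halves linear. The truncated subtractions that remain are settled
    by comparing r with n, m and m + 1. *)
Lemma exponent_count_halved (m n h r : nat) (b : bool) : (0 < n)%N -> r = (b + h.*2)%N -> (0 < r)%N -> (r < m + n + 1)%N ->
  ((1 < r <= m + 1) + (m - r + ((h - 1) - (r - (m + 2)) + (m + n - h - b - (m + 2 * n - r)))) +
  (n + 1))%N =
 (~~ b + ((r <= n) + (m < r)) +
  (n - r + ((h - ~~ b) - (r - (n + 1)) + (m + n - h - (2 * m + n + 1 - r)))) + m)%N.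
Proof.
move=> n0 rE r0 rk.
have -> : (1 < r <= m + 1)%N = (0 < h)%N && (r <= m + 1)%N by case: (b) rE; lia.
have -> : (m + n - h - b - (m + 2 * n - r) = h - n)%N by case: (b) rE; lia.
have -> : (m + n - h - (2 * m + n + 1 - r) = h + b - (m + 1))%N by case: (b) rE; lia.
have [h1|h1] := leqP r n; have [h2|h2] := leqP r m; have [h3|h3] := leqP r (m + 1);
  case: b rE => /= rE; case: h rE => [|h'] rE; lia.
Qed.

Lemma exponent_count_low (m n r : nat) : (0 < n)%N -> (0 < r < m + n + 1)%N ->
  let kappa := (2 * (m + n + 1))%N in
  ((1 < r <= m + 1) + (1 < kappa - r <= m + 1) +
   (m - r + (m - (kappa - r)) + pair_count m kappa r 1) + (n + 1) =
   ~~ odd r + ((0 < r <= n) + (m + n + 1 <= r + n)) +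
   (n - r + (n - (kappa - r)) + pair_count n kappa r 0) + m)%N.
Proof.
move=> n0 /andP[r0 rk]; rewrite /pair_count /= !subn0.
have -> : (1 < 2 * (m + n + 1) - r <= m + 1)%N = false by lia.
have -> : (n - (2 * (m + n + 1) - r) = 0)%N by lia.
have -> : (m - (2 * (m + n + 1) - r) = 0)%N by lia.
have -> : (m + n + 1 <= r + n)%N = (m < r)%N by lia.
have -> : (r - 1 - m - 1 = r - (m + 2))%N by lia.
have -> : (r - n - 1 = r - (n + 1))%N by lia.
have -> : (2 * (m + n + 1) - r - n - 1 = 2 * m + n + 1 - r)%N by lia.
have -> : (2 * (m + n + 1) - r - 1 - m - 1 = m + 2 * n - r)%N by lia.
rewrite r0 !addn0 /=.
have rE := odd_double_half r; move: (r./2) (odd r) rE => h b rE.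
have -> : ((r - 1)./2 = h - ~~ b)%N by case: b rE => /= rE; lia.
have -> : ((r - 1 - 1)./2 = h - 1)%N by case: b rE => /= rE; lia.
have -> : ((2 * (m + n + 1) - r - 1)./2 = m + n - h)%N by case: b rE => /= rE; lia.
have -> : ((2 * (m + n + 1) - r - 1 - 1)./2 = m + n - h - b)%N by case: b rE => /= rE; lia.
exact: exponent_count_halved.
Qed.

(** Both sides are invariant under r -> kappa - r, as kappa is even. This reduces the claim to r
    below k2, except for the midpoint r = k2, which is computed directly. *)
Lemma exponent_count_residue (m n r : nat) : (0 < n)%N -> (0 < r < 2 * (m + n + 1))%N ->
  let k2 := (m + n + 1)%N in let kappa := (2 * k2)%N in
  let r2 := (if r < k2 then r else r - k2)%N in
  ((1 < r <= m + 1) + (1 < kappa - r <= m + 1) +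
   (m - r + (m - (kappa - r)) + pair_count m kappa r 1) + (n + 1) =
   ~~ odd r + (r2 == 0) + ((0 < r2 <= n) + (k2 <= r2 + n)) +
   (n - r + (n - (kappa - r)) + pair_count n kappa r 0) + m)%N.
Proof.
move=> n0 /andP[r0 rk] /=; case: (ltngtP r (m + n + 1)) => rk2.
- rewrite (gtn_eqF r0) addn0; apply: exponent_count_low => //; exact/andP.
- have r'0 : (0 < 2 * (m + n + 1) - r < m + n + 1)%N by lia.
  have := exponent_count_low n0 r'0.
  rewrite /= subKn ?(ltnW rk) // oddB ?(ltnW rk) // oddM /=.
  have -> : (0 < 2 * (m + n + 1) - r <= n)%N = (m + n + 1 <= r - (m + n + 1) + n)%N by lia.
  have -> : (m + n + 1 <= 2 * (m + n + 1) - r + n)%N = (0 < r - (m + n + 1) <= n)%N by lia.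
  have -> : (r - (m + n + 1) == 0)%N = false by lia.
  have mirror p c : pair_count p (2 * (m + n + 1)) (2 * (m + n + 1) - r) c =
      pair_count p (2 * (m + n + 1)) r c by rewrite /pair_count subKn ?(ltnW rk) // addnC.
  rewrite !mirror addn0 [((1 < r <= _) + _)%N]addnC [(m - r + _)%N]addnC [(n - r + _)%N]addnC => ->.
  by congr (_ + _ + _ + _)%N; rewrite addnC.
rewrite rk2 subnn /pair_count !subn0 /=.
have -> : (2 * (m + n + 1) - (m + n + 1) = m + n + 1)%N by lia.
have -> : (1 < m + n + 1 <= m + 1)%N = false by lia.
have -> : (m - (m + n + 1) = 0)%N by lia.
have -> : (n - (m + n + 1) = 0)%N by lia.
have -> : (m + n + 1 <= 0 + n)%N = false by lia.
have -> : (m + n + 1 - 1 - m - 1 = n - 1)%N by lia.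
have -> : (m + n + 1 - n - 1 = m)%N by lia.
have -> : (m + n + 1 - 1 = m + n)%N by lia.
have kE := odd_double_half (m + n).
rewrite (_ : odd (m + n + 1) = ~~ odd (m + n)) ?negbK; last by rewrite addn1.
move: (odd (m + n)) (m + n)./2 kE => b h kE.
have -> : ((m + n - 1)./2 = h - ~~ b)%N by case: b kE => /= kE; lia.
by case: b kE => /= kE; lia.
Qed.

(** Every modulus divides kappa, so only the residue of k matters. The summands n + 1 and m are the
    exponents of (q; q)_inf moved to the opposite sides. The residue 0 is treated apart. *)
Lemma exponent_count (m n k : nat) : (0 < n)%N ->
  let k2 := (m + n + 1)%N in let kappa := (2 * k2)%N in
  (m * (kappa %| k) +
   \sum_(1 <= i < m.+1) ((k %% kappa == i + 1) + (k %% kappa == kappa - (i + 1))) +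
   \sum_(1 <= j < m.+1) \sum_(1 <= i < j)
     ((k %% kappa == j - i) + (k %% kappa == kappa - (j - i)) +
      ((k %% kappa == i + j + 1) + (k %% kappa == kappa - (i + j + 1)))) +
   (n + 1) =
   (2 %| k) + (k2 %| k) + (n - 1) * (kappa %| k) +
   \sum_(1 <= i < n.+1) ((k %% k2 == i) + (k %% k2 == k2 - i)) +
   \sum_(1 <= j < n.+1) \sum_(1 <= i < j)
     ((k %% kappa == j - i) + (k %% kappa == kappa - (j - i)) +
      ((k %% kappa == i + j) + (k %% kappa == kappa - (i + j)))) + m)%N.
Proof.
move=> n0 k2 kappa.
have k20 : (0 < k2)%N by rewrite /k2; lia.
have -> : (2 %| k)%N = (2 %| k %% kappa)%N by rewrite /dvdn modn_dvdm // dvdn_mulr.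
have -> : (k2 %| k)%N = (k2 %| k %% kappa)%N by rewrite /dvdn modn_dvdm // dvdn_mull.
have -> : (k %% k2 = k %% kappa %% k2)%N by rewrite modn_dvdm // dvdn_mull.
rewrite [(kappa %| k)%N]/dvdn.
have : (k %% kappa < kappa)%N by rewrite ltn_mod muln_gt0.
move: (k %% kappa)%N => {k} r rk.
rewrite sum_pair_counts; [|rewrite /kappa /k2; lia|by []].
have := @sum_pair_counts n r kappa 0 ltac:(rewrite /kappa /k2; lia) rk.
under eq_bigr => j _ do under eq_bigr => i _ do rewrite !addn0.
move=> ->; rewrite !big_split /= count_shift count_eq count_rev; last by rewrite /k2; lia.
have -> : (\sum_(1 <= i < m.+1) (r == kappa - (i + 1)) = (1 < kappa - r <= m + 1))%N.
  by rewrite -count_shift; apply: eq_big_nat => i im; lia.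
have rE : (r %% k2 = if r < k2 then r else r - k2)%N.
  case: ltnP => [|le]; first exact: modn_small.
  by rewrite -[in LHS](subnK le) modnDr modn_small //; move: rk; rewrite /kappa; lia.
rewrite [(k2 %| r)%N]/dvdn rE dvdn2.
move: rk rE; rewrite /kappa /k2 => rk _.
case: (r == 0%N) / eqP => [->|r0] /=.
  rewrite /pair_count.
  have -> : (0 < m + n + 1)%N by lia.
  have -> : ((2 * (m + n + 1) - 0 - 1 - 1)./2 = m + n)%N by lia.
  have -> : ((2 * (m + n + 1) - 0 - 0 - 1)./2 = m + n)%N by lia.
  have -> : (1 < 2 * (m + n + 1) - 0 <= m + 1)%N = false by lia.
  have -> : (m - (2 * (m + n + 1) - 0) = 0)%N by lia.
  have -> : (n - (2 * (m + n + 1) - 0) = 0)%N by lia.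
  have -> : (m + n - (2 * (m + n + 1) - 0 - 1 - m - 1) = 0)%N by lia.
  have -> : (m + n - (2 * (m + n + 1) - 0 - 0 - n - 1) = 0)%N by lia.
  have -> : (m + n + 1 <= 0 + n)%N = false by lia.
  by rewrite !muln1 ltnn /=; lia.
rewrite !muln0 !addn0 !add0n exponent_count_residue //; last by lia.
case: (ltnP r (m + n + 1)) => rk2; first by rewrite rk2 andbT.
have -> : (r - (m + n + 1) < m + n + 1)%N by lia.
by rewrite andbT.
Qed.

End Counting.

Definition first_product (n m : nat) : laurent :=
  let kappa := (2 * m + 2 * n + 2)%N in
  qpoch_inf (q ^+ 2) (q ^+ 2) * qpoch_inf (q ^+ (kappa %/ 2)) (q ^+ (kappa %/ 2))
    * qpoch_inf (q ^+ kappa) (q ^+ kappa) ^+ (n - 1) / qpoch_inf q q ^+ (n + 1)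
    * (\prod_(1 <= i < n.+1) theta (q ^+ i) (q ^+ (kappa %/ 2)))
    * \prod_(1 <= j < n.+1) \prod_(1 <= i < j)
        (theta (q ^+ (j - i)) (q ^+ kappa) * theta (q ^+ (i + j)) (q ^+ kappa)).

Theorem product_sides_eq (m n : nat) : (0 < n)%N ->
  let kappa := (2 * m + 2 * n + 2)%N in
  first_product n m =
  qpoch_inf (q ^+ kappa) (q ^+ kappa) ^+ m / qpoch_inf q q ^+ m
    * (\prod_(1 <= i < m.+1) theta (q ^+ (i + 1)) (q ^+ kappa))
    * \prod_(1 <= j < m.+1) \prod_(1 <= i < j)
        (theta (q ^+ (j - i)) (q ^+ kappa) * theta (q ^+ (i + j + 1)) (q ^+ kappa)).
Proof.
move=> n0 kappa; rewrite /first_product -/kappa; pose k2 := (m + n + 1)%N.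
have k2E : (kappa %/ 2 = k2)%N by rewrite /kappa /k2; lia.
have kE : kappa = (2 * k2)%N by rewrite /kappa /k2; lia.
have e2 := euler_qpoch_inf_self (isT : 0 < 2)%N.
have eh := @euler_qpoch_inf_self k2 ltac:(lia).
have ek := @euler_qpoch_inf_self kappa ltac:(lia).
have e1 := euler_qpoch_inf_self (isT : 0 < 1)%N; rewrite expr1 in e1.
have nz : qpoch_inf q q != 0 by apply: one_unit_neq0; apply: euler_one_unit e1.
have p1 := @euler_prod 1 n.+1 _ _ (fun i ir => @euler_theta i k2 ltac:(lia) ltac:(lia)).
have p2 := @euler_prod 1 n.+1 _ _ (fun j jr => @euler_prod 1 j _ _ (fun i ir =>
  eulerM (@euler_theta (j - i) kappa ltac:(lia) ltac:(lia))
         (@euler_theta (i + j) kappa ltac:(lia) ltac:(lia)))).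
have p3 := @euler_prod 1 m.+1 _ _ (fun i ir => @euler_theta (i + 1) kappa ltac:(lia) ltac:(lia)).
have p4 := @euler_prod 1 m.+1 _ _ (fun j jr => @euler_prod 1 j _ _ (fun i ir =>
  eulerM (@euler_theta (j - i) kappa ltac:(lia) ltac:(lia))
         (@euler_theta (i + j + 1) kappa ltac:(lia) ltac:(lia)))).
have crossmul (F : fieldType) (a b c d e : F) (i j : nat) : e != 0 ->
    a * b * c * e ^+ j = d * e ^+ i -> a / e ^+ i * b * c = d / e ^+ j.
  move=> e0 E; have ei := expf_neq0 i e0; have ej := expf_neq0 j e0.
  have -> : a / e ^+ i * b * c = a * b * c / e ^+ i by field.
  by apply/eqP; rewrite eqr_div // E.
rewrite [RHS](_ : _ = (qpoch_inf (q ^+ kappa) (q ^+ kappa) ^+ m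
    * (\prod_(1 <= i < m.+1) theta (q ^+ (i + 1)) (q ^+ kappa))
    * \prod_(1 <= j < m.+1) \prod_(1 <= i < j)
        (theta (q ^+ (j - i)) (q ^+ kappa) * theta (q ^+ (i + j + 1)) (q ^+ kappa)))
    / qpoch_inf q q ^+ m); last first.
  by rewrite -!mulrA; congr (_ * _); rewrite mulrC -mulrA.
apply: crossmul => //; rewrite k2E.
have L := eulerM (eulerM (eulerM (eulerM (eulerM e2 eh) (eulerX (n - 1) ek)) p1) p2) (eulerX m e1).
have R := eulerM (eulerM (eulerM (eulerX m ek) p3) p4) (eulerX (n + 1) e1).
apply: (euler_unique L); apply: eq_euler R => k k0.
rewrite !dvd1n !muln1 kE; exact: exponent_count.
Qed.

(** * Alphabets made of strings of powers *)

Lemma sum_ffun_recl (R : nmodType) (T : finType) n (F : {ffun 'I_n.+1 -> T} -> R) :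
  \sum_f F f =
  \sum_(a : T) \sum_(g : {ffun 'I_n -> T}) F [ffun i => oapp g a (unlift ord0 i)].
Proof.
rewrite pair_big /=.
rewrite (reindex (fun ag : T * {ffun 'I_n -> T} =>
  [ffun i => oapp ag.2 ag.1 (unlift ord0 i)])) //=.
exists (fun f : {ffun 'I_n.+1 -> T} => (f ord0, [ffun j => f (lift ord0 j)])).
  move=> [a g] _; rewrite ffunE unlift_none /=; congr (_, _).
  by apply/ffunP => j; rewrite !ffunE liftK.
move=> f _; apply/ffunP => i; rewrite ffunE /=.
by case: unliftP => [j|] ->; rewrite /= ?ffunE.
Qed.

Section Strings.
Variables (K : fieldType) (x : K).
Hypotheses (x0 : x != 0) (xtor : forall d : int, d != 0 -> x ^ d != 1).
Variables (zeta tau : int).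
Let z := x ^ zeta.
Let t := x ^ tau.

Implicit Types (c d e : int) (m p k L : nat).

Fixpoint str c m : seq K :=
  if m is m'.+1 then x ^ c :: str (c + tau) m' else [::].

Lemma xD c d : x ^ (c + d) = x ^ c * x ^ d. Proof. exact: expfzDr. Qed.

Lemma refl_x c : refl z (x ^ c) = x ^ (- zeta - c).
Proof. by rewrite /refl /z -xD invr_expz; congr (x ^ _); ring. Qed.

(** The two properties of [weight] that select the surviving configurations. Stated for an arbitrary
    [E], they persist when letters already chosen are absorbed into [E], as the inductions
    require. *)
Definition vanishing (E : seq K -> K) :=
  perm_invariant E /\ forall y y' h, t * z * y * y' = 1 -> E (y :: y' :: h) = 0.

Lemma vanishing_cons E y : vanishing E -> vanishing (fun h => E (y :: h)).
Proof.
move=> [invE vE]; split; first exact: perm_invariant_cons.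
move=> y1 y2 h yy; rewrite -(vE y1 y2 (y :: h) yy); apply: invE.
by rewrite -cat1s (perm_catCA [:: y] [:: y1; y2] h).
Qed.

Lemma vanishing_cat E h : vanishing E -> vanishing (fun h' => E (h ++ h')).
Proof.
elim: h E => [|y h IHh] E vE //.
exact: (IHh (fun h' => E (y :: h')) (vanishing_cons y vE)).
Qed.

Definition block c L m := map (refl z) (str c m) ++ str (c + tau * m) (L - m).

(** If a letter y is kept and the next one, t y, is reflected, then t z y [refl z] (t y) = 1 and the
    term is 0. Hence the reflected letters form an initial segment, of length m. *)
Lemma configs_string c L E : vanishing E ->
  \sum_(h <- configs z (str c L)) E h = \sum_(m < L.+1) E (block c L m).
Proof.
elim: L c E => [|L IHL] c E vE; first by rewrite big_ord1 big_seq1.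
rewrite big_configs_cons [RHS]big_ord_recl !IHL; try exact: vanishing_cons.
rewrite [X in X + _ = _]big_ord_recl big1 ?addr0 => [|m _]; last first.
  case: vE => invE vE0; rewrite /block lift0 /=; apply: vE0; rewrite refl_x /t /z -!xD.
  by have -> : tau + zeta + c + (- zeta - (c + tau)) = 0 by ring.
congr (E _ + _); first by rewrite /block /= !mulr0 !addr0 subn0.
apply: eq_bigr => m _; congr (E _); rewrite /block lift0 /= subSS; congr (_ :: _ ++ str _ _).
by rewrite intS; ring.
Qed.

Lemma configs_strings n (c : 'I_n -> int) L E : vanishing E ->
  \sum_(h <- configs z (flatten [seq str (c i) L | i <- enum 'I_n])) E h =
  \sum_(f : {ffun 'I_n -> 'I_L.+1}) E (flatten [seq block (c i) L (f i) | i <- enum 'I_n]).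
Proof.
elim: n c E => [|n IHn] c E vE.
  rewrite enum_ord0 big_seq1 (eq_bigr (fun=> E [::])) //.
  by rewrite sumr_const card_ffun !card_ord expn0 mulr1n.
rewrite enum_ordSl /= configs_cat -map_comp.
rewrite exchange_big (IHn (fun i => c (lift ord0 i))
  (fun h2 => \sum_(h1 <- configs z (str (c ord0) L)) E (h1 ++ h2))); last first.
  case: (vE) => invE E0; split=> [s1 s2 s12|y y' h yy].
    by apply: eq_bigr => h _; apply: invE; rewrite perm_cat2l.
  by apply: big1 => h1 _; case: (vanishing_cat h1 vE) => _; apply.
rewrite sum_ffun_recl [RHS]exchange_big /=; apply: eq_bigr => g _.
have vE' : vanishing (fun h1 => E (h1 ++ flatten [seq block (c (lift ord0 i)) L (g i) | i <- enum 'I_n])).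
  case: (vE) => invE E0; split=> [s1 s2 s12|y y' h yy]; last exact: E0.
  by apply: invE; rewrite perm_cat2r.
rewrite (configs_string _ _ vE'); apply: eq_bigr => m _; rewrite -map_comp.
rewrite ffunE unlift_none /=; congr (E (_ ++ flatten _)).
by apply: eq_map => i /=; rewrite ffunE liftK.
Qed.

Definition cweight (h h' : seq K) : K :=
  \prod_(y <- h) \prod_(y' <- h') fq t (z * y * y').

Lemma cweight_catl h1 h2 h : cweight (h1 ++ h2) h = cweight h1 h * cweight h2 h.
Proof. by rewrite /cweight big_cat. Qed.

Lemma cweight_catr h h1 h2 : cweight h (h1 ++ h2) = cweight h h1 * cweight h h2.
Proof. by rewrite /cweight -big_split; apply: eq_bigr => y _; rewrite big_cat. Qed.

Lemma cweight_perm h1 h2 h1' h2' : perm_eq h1 h1' -> perm_eq h2 h2' ->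
  cweight h1 h2 = cweight h1' h2'.
Proof.
move=> p1 p2; rewrite /cweight (perm_big _ p1); apply: eq_bigr => y _.
exact: perm_big.
Qed.

Lemma weight_cat phi h1 h2 :
  weight z t phi (h1 ++ h2) = weight z t phi h1 * weight z t phi h2 * cweight h1 h2.
Proof. by rewrite /weight big_cat pairs_cat /cweight /=; ring. Qed.

Lemma weight_flatten (I : eqType) phi (b : I -> seq K) (s : seq I) :
  weight z t phi (flatten [seq b i | i <- s]) =
  (\prod_(i <- s) weight z t phi (b i)) * pairs (fun i j => cweight (b i) (b j)) s.
Proof.
elim: s => [|i s IHs]; first by rewrite /weight /= !big_nil !mulr1.
rewrite /= weight_cat IHs big_cons.
have -> : cweight (b i) (flatten [seq b j | j <- s]) = \prod_(j <- s) cweight (b i) (b j).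
  elim: s {IHs} => [|j s IHs] /=; last by rewrite cweight_catr big_cons IHs.
  by rewrite /cweight big_nil big1 // => y _; rewrite big_nil.
by ring.
Qed.

Lemma weight_vanishing phi : vanishing (weight z t phi).
Proof.
split=> [|y y' h yy]; first exact: weight_perm.
have fq0 : fq t (z * y * y') = 0 by rewrite /fq !mulrA yy subrr mul0r.
by rewrite /weight /= !big_cons fq0 !mul0r mulr0.
Qed.

Lemma str_rcons c m : str c m.+1 = rcons (str c m) (x ^ (c + tau * m)).
Proof.
elim: m c => [|m IHm] c; first by rewrite /= mulr0 addr0.
rewrite [LHS]/= -/(str _ m.+1) IHm /=; congr (_ :: rcons _ _).
by rewrite intS; congr (x ^ _); ring.
Qed.

Lemma map_refl_str c m :
  perm_eq (map (refl z) (str c m)) (str (- zeta - c - tau * (m%:Z - 1)) m).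
Proof.
elim: m c => [|m IHm] c //.
rewrite [X in perm_eq _ X]str_rcons [map _ _]/= refl_x perm_sym perm_rcons.
have -> : - zeta - c - tau * (m.+1%:Z - 1) + tau * m = - zeta - c by rewrite intS; ring.
rewrite perm_cons perm_sym.
have -> : - zeta - c - tau * (m.+1%:Z - 1) = - zeta - (c + tau) - tau * (m%:Z - 1).
  by rewrite intS; ring.
exact: IHm.
Qed.

Definition offset (R m : nat) : int := R%:Z - m%:Z.

(** Read backwards, the reflected segment is again a string of ratio t, and the relation between
    zeta, a and b makes it start at a + tau r with r = R - m. So r moves the two strings of a block
    in opposite directions. *)
Lemma block_perm (a b : int) (R m : nat) : zeta + a + b = tau ->
  perm_eq (block (b - tau * R) (2 * R) m)
    (str (a + tau * offset R m) m ++ str (b - tau * offset R m) (2 * R - m)).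
Proof.
move=> zab; rewrite /block /offset.
have -> : b - tau * R + tau * m = b - tau * (R%:Z - m%:Z) by ring.
rewrite perm_cat2r; apply: perm_trans (map_refl_str _ _) _.
have -> // : a + tau * (R%:Z - m%:Z) = - zeta - (b - tau * R) - tau * (m%:Z - 1).
by rewrite -zab; ring.
Qed.

Definition classw phi (a b : int) (R m : nat) : K :=
  weight z t phi (str (a + tau * offset R m) m) *
  weight z t phi (str (b - tau * offset R m) (2 * R - m)) *
  cweight (str (a + tau * offset R m) m) (str (b - tau * offset R m) (2 * R - m)).

Definition pairw (a b a' b' : int) (R m m' : nat) : K :=
  let A := str (a + tau * offset R m) m in
  let B := str (b - tau * offset R m) (2 * R - m) in
  let A' := str (a' + tau * offset R m') m' in
  let B' := str (b' - tau * offset R m') (2 * R - m') in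
  cweight A A' * cweight A B' * cweight B A' * cweight B B'.

Lemma Gsum_strings phi n (a b : 'I_n -> int) (R : nat) :
  (forall i, zeta + a i + b i = tau) ->
  Gsum z t phi (flatten [seq str (b i - tau * R) (2 * R) | i <- enum 'I_n]) =
  \sum_(f : {ffun 'I_n -> 'I_(2 * R).+1})
    (\prod_(i < n) classw phi (a i) (b i) R (f i)) *
    \prod_(i < n) \prod_(j < n | (i < j)%N) pairw (a i) (b i) (a j) (b j) R (f i) (f j).
Proof.
move=> zab; rewrite /Gsum (configs_strings _ _ (weight_vanishing phi)).
apply: eq_bigr => f _; rewrite weight_flatten big_enum /=.
have bp i := block_perm R (f i) (zab i).
have -> : pairs (fun i j => cweight (block (b i - tau * R) (2 * R) (f i))
     (block (b j - tau * R) (2 * R) (f j))) (enum 'I_n) =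
    pairs (fun i j => pairw (a i) (b i) (a j) (b j) R (f i) (f j)) (enum 'I_n).
  apply: eq_pairs => i j _ _; rewrite (cweight_perm (bp i) (bp j)) /pairw.
  by rewrite cweight_catl !cweight_catr; ring.
rewrite -[enum 'I_n in X in _ * X]map_id pairs_ord; congr (_ * _).
apply: eq_bigr => i _; by rewrite (@weight_perm _ z t phi _ _ (bp i)) weight_cat.
Qed.

Definition poch c k : K := qpoch (x ^ c) t k.

Lemma tX k : t ^+ k = x ^ (tau * k). Proof. by rewrite /t exprnP exprz_exp. Qed.

Lemma pochE c k : poch c k = \prod_(0 <= j < k) (1 - x ^ (c + tau * j)).
Proof. by apply: eq_bigr => j _; rewrite tX -xD. Qed.

Lemma poch0 c : poch c 0 = 1. Proof. by rewrite pochE big_geq. Qed.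

Lemma pochS c k : poch c k.+1 = (1 - x ^ c) * poch (c + tau) k.
Proof.
rewrite !pochE big_nat_recl // mulr0 addr0; congr (_ * _).
by apply: eq_bigr => j _; rewrite intS; congr (1 - x ^ _); ring.
Qed.

Lemma pochD c k l : poch c (k + l) = poch c k * poch (c + tau * k) l.
Proof.
elim: k c => [|k IHk] c; first by rewrite poch0 mul1r mulr0 addr0.
rewrite addSn !pochS IHk mulrA; congr (_ * poch _ _).
by rewrite intS; ring.
Qed.

Lemma sub1x_neq0 d : d != 0 -> 1 - x ^ d != 0.
Proof. by move=> d0; rewrite subr_eq0 eq_sym xtor. Qed.

Lemma poch_neq0 c k : (forall j : nat, c + tau * j != 0) -> poch c k != 0.
Proof.
by move=> cj; rewrite pochE prodf_seq_neq0; apply/allP => j _; rewrite sub1x_neq0.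
Qed.

(** Along a string of ratio t the numerator of each factor is the denominator of the next, so the
    product telescopes. *)
Lemma prod_fq_str c d m : (forall j : nat, zeta + c + d + tau * j != 0) ->
  \prod_(y <- str d m) fq t (z * x ^ c * y) =
  (1 - x ^ (zeta + c + d + tau * m)) / (1 - x ^ (zeta + c + d)).
Proof.
elim: m d => [|m IHm] d nz.
  by rewrite big_nil mulr0 addr0 divff // sub1x_neq0 //; have := nz 0%N; rewrite mulr0 addr0.
rewrite big_cons IHm => [|j]; last by have := nz j.+1; rewrite intS; congr (_ != 0); ring.
rewrite /fq /t /z -!xD.
have -> : tau + (zeta + c + d) = zeta + c + (d + tau) by ring.
have -> : zeta + c + d + tau * m.+1 = zeta + c + (d + tau) + tau * m by rewrite intS; ring.
have n1 : 1 - x ^ (zeta + c + d) != 0.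
  by apply: sub1x_neq0; have := nz 0%N; rewrite mulr0 addr0.
have n2 : 1 - x ^ (zeta + c + (d + tau)) != 0.
  by apply: sub1x_neq0; have := nz 1%N; congr (_ != 0); ring.
by field; rewrite n1 n2.
Qed.

Lemma cweight_str c d m k : (forall j : nat, zeta + c + d + tau * j != 0) ->
  cweight (str c m) (str d k) = poch (zeta + c + d + tau * k) m / poch (zeta + c + d) m.
Proof.
rewrite /cweight; elim: m c => [|m IHm] c nz; first by rewrite big_nil !poch0 divr1.
rewrite big_cons IHm => [|j]; last by have := nz j.+1; rewrite intS; congr (_ != 0); ring.
rewrite prod_fq_str // !pochS invfM mulrACA.
have -> : zeta + (c + tau) + d + tau * k = zeta + c + d + tau * k + tau by ring.
by have -> : zeta + (c + tau) + d = zeta + c + d + tau by ring.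
Qed.

End Strings.

(** * Truncated theta functions and the weights of blocks *)

Definition tri (s : int) : int := ((s * (s - 1)) %/ 2)%Z.

Lemma tri2 s : 2 * tri s = s * (s - 1).
Proof.
have [h [->|->]] : exists h : int, s = 2 * h \/ s = 2 * h + 1.
- by exists (s %/ 2)%Z; lia.
- rewrite /tri (_ : 2 * h * (2 * h - 1) = h * (2 * h - 1) * 2); last by ring.
  by rewrite mulzK //; ring.
rewrite /tri (_ : (2 * h + 1) * (2 * h + 1 - 1) = (2 * h + 1) * h * 2); last by ring.
by rewrite mulzK //; ring.
Qed.

Lemma tri_eq s e : 2 * e = s * (s - 1) -> tri s = e.
Proof. by move=> se; apply: (@mulfI _ 2) => //; rewrite tri2. Qed.

Section Theta.
Variables (K : fieldType) (x : K).
Hypotheses (x0 : x != 0) (xtor : forall d : int, d != 0 -> x ^ d != 1).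
Variable tau : int.
Implicit Types (c d e s : int) (m p k : nat).

Local Notation poch := (poch x tau).
Let xD := xD x0.

(** A truncation of theta(x^e; t), with m + 1 factors on one side and p on the other. *)
Definition ftheta e m p : K := poch e m.+1 * poch (tau - e) p.

Lemma fthetaE e m p : ftheta e m p = (1 - x ^ e) * poch (e + tau) m * poch (tau - e) p.
Proof. by rewrite /ftheta pochS. Qed.

(** The quasi-periodicity theta(a t; t) = -theta(a; t)/a. For the truncation it moves one factor
    from one product to the other, so it stays exact once m and p are adjusted. *)
Lemma ftheta_step e m p : x ^ e * ftheta (e + tau) m p.+1 = - ftheta e m.+1 p.
Proof.
rewrite /ftheta; have -> : tau - (e + tau) = - e by ring.
rewrite [poch (- e) _]pochS // [poch e _]pochS //.
have -> : - e + tau = tau - e by ring.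
have xe : x ^ e * x ^ (- e) = 1 by rewrite -xD subrr expr0z.
transitivity ((x ^ e - x ^ e * x ^ (- e)) * (poch (e + tau) m.+1 * poch (tau - e) p)); first by ring.
by rewrite xe; ring.
Qed.

Let ftheta_shift_nat k e m p :
  x ^ (k%:Z * e + tau * tri k) * ftheta (e + tau * k) m (p + k) =
  (-1) ^+ k * ftheta e (m + k) p.
Proof.
elim: k m => [|k IHk] m.
  by rewrite (tri_eq (e := 0)) // mul0r !mulr0 !addr0 expr0z !mul1r !addn0.
have -> : k.+1%:Z * e + tau * tri k.+1 = (k%:Z * e + tau * tri k) + (e + tau * k).
  have -> : tri k.+1 = tri k + k.
    by apply: tri_eq; rewrite mulrDr tri2 intS; ring.
  by rewrite intS; ring.
have -> : e + tau * k.+1 = e + tau * k + tau by rewrite intS; ring.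
rewrite xD -mulrA addnS ftheta_step mulrN IHk exprS addSnnS.
by ring.
Qed.

Lemma ftheta_shift s e m p m' p' : m'%:Z = m%:Z + s -> p'%:Z = p%:Z - s ->
  x ^ (s * e + tau * tri s) * ftheta (e + tau * s) m p =
  (-1) ^+ `|s|%N * ftheta e m' p'.
Proof.
case: s => k mk pk.
  have -> : m' = (m + k)%N by lia.
  have -> : p = (p' + k)%N by lia.
  exact: ftheta_shift_nat.
set s := Negz k in mk pk *; pose k1 := k.+1.
have sE : s = - k1%:Z by rewrite /s NegzE.
have -> : m = (m' + k1)%N by lia.
have -> : p' = (p + k1)%N by lia.
have := ftheta_shift_nat k1 (e + tau * s) m' p.
have -> : e + tau * s + tau * k1 = e by rewrite sE; ring.
have -> : `|s|%N = k1 by lia.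
move=> E; apply: (mulrI (unitrX k1 (unitrN1 K))); rewrite mulrCA -E mulrA.
have -> : (-1) ^+ k1 * ((-1) ^+ k1 * ftheta e m' (p + k1)) = ftheta e m' (p + k1).
  by rewrite mulrA -exprD addnn -muln2 mulnC exprM sqrrN expr1n expr1n mul1r.
rewrite -xD.
have -> : s * e + tau * tri s + (k1%:Z * (e + tau * s) + tau * tri k1) = 0.
  have -> : tri s = k1%:Z * k1 - tri k1.
    by apply: tri_eq; rewrite mulrBr tri2 sE; ring.
  by rewrite sE; ring.
by rewrite expr0z mul1r.
Qed.

Variable zeta : int.

Definition psi a (r : int) : K := x ^ ((zeta + 2 * a - tau) * r + tau * r ^+ 2).

(** The Vandermonde variable of a block. With w = a + tau r it is invariant under w -> tau - zeta -
    w, so a difference of two nodes splits into two factors of the form 1 - x^e, see [vnode_sub];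
    [fnode] is the antisymmetric counterpart. *)
Definition vnode a (r : int) : K := x ^ (- (a + tau * r)) + x ^ (zeta - tau + (a + tau * r)).

Definition fnode a (r : int) : K := x ^ (- (a + tau * r)) - x ^ (zeta - tau + (a + tau * r)).

(** The part of a cross weight that converges: over [q], for positive c and tau, it tends to 1/(x^c;
    t)_inf as R, k and k' grow. *)
Definition frac c R k k' : K := poch c (2 * R) / (poch c k * poch c k').

Let poch_split c R m p : (m + p = 2 * R)%N -> (forall j : nat, c + tau * j != 0) ->
  poch (c + tau * p) m = poch c (2 * R) / poch c p.
Proof.
move=> mp nz; rewrite -mp addnC pochD //.
by rewrite mulrAC mulfV ?mul1r // poch_neq0.
Qed.

(** Field algebra only: the first two equations are theta shifts, s1 and s2 their signs, and the
    fourth gathers the monomials and linear factors into T. *)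
Let assemble (P1 P2 P3 P4 p1 p2 p3 p4 D1 D2 D3 D4 a1 a2 a3 a4 : K)
    (M1 M2 u1 u2 s1 s2 v1 v2 T : K) :
  M1 * (u1 * D1 * D4) = s1 * (v1 * a1 * a4) ->
  M2 * (u2 * D2 * D3) = s2 * (v2 * a2 * a3) ->
  s1 * s2 = 1 -> M1 * M2 * (u1 * u2) = T * (v1 * v2) ->
  [&& D1 != 0, D2 != 0, D3 != 0, D4 != 0, a1 != 0, a2 != 0, a3 != 0, a4 != 0, v1 != 0 & v2 != 0] ->
  P1 / p1 / D1 * (P2 / p2 / D2) * (P3 / p3 / D3) * (P4 / p4 / D4) =
  P1 / (p1 * a1) * (P2 / (p2 * a2)) * (P3 / (p3 * a3)) * (P4 / (p4 * a4)) * T.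
Proof.
move=> E1 E2 s12 E3 /and5P[d1 d2 d3 d4 /and5P[n1 n2 n3 n4 /andP[w1 w2]]].
have s0 : s1 * s2 != 0 by rewrite s12 oner_neq0.
have : (D1 * D2 * D3 * D4)^-1 = T / (a1 * a2 * a3 * a4).
  have dd : D1 * D2 * D3 * D4 != 0 by rewrite !mulf_neq0.
  have aa : a1 * a2 * a3 * a4 != 0 by rewrite !mulf_neq0.
  have vv : v1 * v2 != 0 by rewrite mulf_neq0.
  apply: (mulfI dd); rewrite mulfV //; apply: (mulIf aa); rewrite mul1r -[RHS]mulrA divfK //.
  apply: (mulIf vv); rewrite -[LHS]mul1r -s12.
  transitivity ((s1 * (v1 * a1 * a4)) * (s2 * (v2 * a2 * a3))); first by ring.
  by rewrite -E1 -E2 -[RHS]mulrA -E3; ring.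
rewrite !invfM => dE.
transitivity (P1 * P2 * P3 * P4 * p1^-1 * p2^-1 * p3^-1 * p4^-1 *
  (D1^-1 * D2^-1 * D3^-1 * D4^-1)); first by ring.
by rewrite dE; ring.
Qed.

Lemma tri_add_sub (r r' : int) : tri (r + r') + tri (r - r') = r ^+ 2 + r' ^+ 2 - r.
Proof. by apply: (@mulfI _ 2) => //; rewrite mulrDr !tri2; ring. Qed.

Lemma vnode_sub a a' (r r' : int) :
  (1 - x ^ (zeta + a + a' - tau + tau * (r + r'))) * (1 - x ^ (a - a' + tau * (r - r'))) =
  - (x ^ (a + tau * r) * (vnode a' r' - vnode a r)).
Proof.
set X := x ^ (zeta + _ + _ - _ + _); set Y := x ^ (a - _ + _).
set U := x ^ (a + tau * r).
have e1 : U * x ^ (- (a + tau * r)) = 1 by rewrite /U -xD subrr expr0z.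
have e2 : U * x ^ (- (a' + tau * r')) = Y by rewrite /U -xD; congr (x ^ _); ring.
have e3 : U * x ^ (zeta - tau + (a' + tau * r')) = X by rewrite /U -xD; congr (x ^ _); ring.
have e4 : U * x ^ (zeta - tau + (a + tau * r)) = X * Y by rewrite /U -!xD; congr (x ^ _); ring.
rewrite /vnode [RHS](_ : _ = - (U * x ^ (- (a' + tau * r')) +
    U * x ^ (zeta - tau + (a' + tau * r')) - U * x ^ (- (a + tau * r)) -
    U * x ^ (zeta - tau + (a + tau * r)))); last by ring.
by rewrite e1 e2 e3 e4; ring.
Qed.

Lemma vnode_sub0 a a' :
  (1 - x ^ (zeta + a + a' - tau)) * (1 - x ^ (a - a')) = - (x ^ a * (vnode a' 0 - vnode a 0)).
Proof.
have := vnode_sub a a' 0 0.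
have -> : zeta + a + a' - tau + tau * (0 + 0) = zeta + a + a' - tau by ring.
have -> : a - a' + tau * (0 - 0) = a - a' by ring.
by have -> : a + tau * 0 = a by ring.
Qed.

(** The four cross weights of two blocks combine into two truncated theta functions: A with A' and B
    with B' give one shifted by r + r', A with B' and B with A' one shifted by r - r'. Shifting both
    back to 0 leaves Gaussian factors and a ratio of node differences. *)
Lemma pairw_formula a b a' b' R m m' :
  zeta + a + b = tau -> zeta + a' + b' = tau -> (m <= 2 * R)%N -> (m' <= 2 * R)%N ->
  (forall j : int, zeta + a + a' + tau * j != 0) ->
  (forall j : int, zeta + a + b' + tau * j != 0) ->
  let r := offset R m in let r' := offset R m' in
  let p := (2 * R - m)%N in let p' := (2 * R - m')%N in
  pairw x zeta tau a b a' b' R m m' =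
  frac (zeta + a + a') R p p' * frac (zeta + a + b') R p m' *
  frac (zeta + b + a') R m p' * frac (zeta + b + b') R m m' *
  (psi a r * psi a' r' * ((vnode a' r' - vnode a r) / (vnode a' 0 - vnode a 0))).
Proof.
move=> zab zab' mR mR' nz1 nz2 r r' p p'.
have bE : b = tau - zeta - a by rewrite -zab; ring.
have bE' : b' = tau - zeta - a' by rewrite -zab'; ring.
have pE : p%:Z = R%:Z + r by rewrite /p /r /offset; lia.
have pE' : p'%:Z = R%:Z + r' by rewrite /p' /r' /offset; lia.
have mE : m%:Z = R%:Z - r by rewrite /r /offset; lia.
have mE' : m'%:Z = R%:Z - r' by rewrite /r' /offset; lia.
have nz3 (j : int) : zeta + b + a' + tau * j != 0.
  by have := nz2 (- 2 - j); rewrite -oppr_eq0 bE bE'; congr (_ != 0); ring.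
have nz4 (j : int) : zeta + b + b' + tau * j != 0.
  by have := nz1 (- 2 - j); rewrite -oppr_eq0 bE bE'; congr (_ != 0); ring.
pose e := zeta + a + a' - tau; pose s := r + r'.
pose e' := zeta + a + b' - tau; pose s' := r - r'.
rewrite /pairw -/r -/r' -/p -/p'.
rewrite !cweight_str //; last first.
- by move=> j; have := nz1 (r + r' + j); congr (_ != 0); ring.
- by move=> j; have := nz2 (r - r' + j); congr (_ != 0); ring.
- by move=> j; have := nz3 (r' - r + j); congr (_ != 0); ring.
- by move=> j; have := nz4 (- r' - r + j); congr (_ != 0); ring.
have -> : zeta + (a + tau * r) + (a' + tau * r') + tau * m' = zeta + a + a' + tau * p.
  by rewrite pE mE'; ring.
have -> : zeta + (a + tau * r) + (b' - tau * r') + tau * p' = zeta + a + b' + tau * p.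
  by rewrite pE pE'; ring.
have -> : zeta + (b - tau * r) + (a' + tau * r') + tau * m' = zeta + b + a' + tau * m.
  by rewrite mE mE'; ring.
have -> : zeta + (b - tau * r) + (b' - tau * r') + tau * p' = zeta + b + b' + tau * m.
  by rewrite mE pE'; ring.
have -> : zeta + (a + tau * r) + (a' + tau * r') = e + tau * s + tau by rewrite /e /s; ring.
have -> : zeta + (b - tau * r) + (b' - tau * r') = tau - (e + tau * s).
  by rewrite /e /s bE bE'; ring.
have -> : zeta + (a + tau * r) + (b' - tau * r') = e' + tau * s' + tau by rewrite /e' /s'; ring.
have -> : zeta + (b - tau * r) + (a' + tau * r') = tau - (e' + tau * s').
  by rewrite /e' /s' bE bE'; ring.
have mp : (m + p = 2 * R)%N by rewrite subnKC.
have pm : (p + m = 2 * R)%N by rewrite subnK.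
rewrite (poch_split mp (fun j : nat => nz1 j)) (poch_split mp (fun j : nat => nz2 j)).
rewrite (poch_split pm (fun j : nat => nz3 j)) (poch_split pm (fun j : nat => nz4 j)).
have E1 := @ftheta_shift s e m p p' m' ltac:(lia) ltac:(lia).
have E2 := @ftheta_shift s' e' m p m' p' ltac:(lia) ltac:(lia).
rewrite !fthetaE in E1 E2.
have c1 : e + tau = zeta + a + a' by rewrite /e; ring.
have c2 : e' + tau = zeta + a + b' by rewrite /e'; ring.
have c3 : tau - e' = zeta + b + a' by rewrite /e' bE bE'; ring.
have c4 : tau - e = zeta + b + b' by rewrite /e bE bE'; ring.
rewrite c1 c4 in E1; rewrite c2 c3 in E2.
rewrite /frac; apply: (assemble _ _ _ _ _ _ _ _ E1 E2).
(* r + r' and r - r' have the same parity, so the signs of the two shifts cancel. *)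
- rewrite -exprD -(odd_double_half (_ + _)) (_ : odd _ = false); last by lia.
  by rewrite add0n -muln2 mulnC exprM sqrrN expr1n expr1n.
- have e'E : e' = a - a' by rewrite /e' bE'; ring.
  have vz : vnode a' 0 - vnode a 0 != 0.
    have := vnode_sub0 a a'; rewrite -/e -e'E => v0E.
    have : (1 - x ^ e) * (1 - x ^ e') != 0.
      rewrite mulf_neq0 // sub1x_neq0 //.
        by have := nz1 (- 1); congr (_ != 0); rewrite /e; ring.
      by have := nz2 (- 1); congr (_ != 0); rewrite /e'; ring.
    by rewrite v0E oppr_eq0 mulf_eq0 negb_or => /andP[].
  have u12 : (1 - x ^ (e + tau * s)) * (1 - x ^ (e' + tau * s')) =
     - (x ^ (a + tau * r) * (vnode a' r' - vnode a r)) by rewrite e'E vnode_sub.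
  have v12 : (1 - x ^ e) * (1 - x ^ e') = - (x ^ a * (vnode a' 0 - vnode a 0)).
    by rewrite -vnode_sub0 -e'E.
  have M12 : x ^ (s * e + tau * tri s) * x ^ (s' * e' + tau * tri s') * x ^ (a + tau * r) =
      psi a r * psi a' r' * x ^ a.
    have -> : tri s' = r ^+ 2 + r' ^+ 2 - r - tri s by rewrite -tri_add_sub /s /s'; ring.
    by rewrite /psi -!xD; congr (x ^ _); rewrite e'E /s /s' /e; ring.
  rewrite u12 v12 !mulrN [X in - X = _]mulrA M12; congr (- _).
  by field.
have n1 (j : int) : e + tau * s + tau + tau * j != 0.
  by have := nz1 (s + j); congr (_ != 0); rewrite -c1; ring.
have n2 (j : int) : e' + tau * s' + tau + tau * j != 0.
  by have := nz2 (s' + j); congr (_ != 0); rewrite -c2; ring.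
have n3 (j : int) : tau - (e' + tau * s') + tau * j != 0.
  by have := nz3 (j - s'); congr (_ != 0); rewrite -c3; ring.
have n4 (j : int) : tau - (e + tau * s) + tau * j != 0.
  by have := nz4 (j - s); congr (_ != 0); rewrite -c4; ring.
have nz0 (c : int) k : (forall j : int, c + tau * j != 0) -> poch c k != 0.
  by move=> nz; apply: poch_neq0.
rewrite !nz0 //= !sub1x_neq0 //.
  by have := nz2 (- 1); congr (_ != 0); rewrite /e'; ring.
by have := nz1 (- 1); congr (_ != 0); rewrite /e; ring.
Qed.

Lemma prod_str c m : \prod_(y <- str x tau c m) y = x ^ (c * m + tau * tri m).
Proof.
elim: m c => [|m IHm] c.
  by rewrite big_nil (tri_eq (e := 0)) // !mulr0 addr0 expr0z.
rewrite big_cons IHm -xD; congr (x ^ _).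
have -> : tri m.+1 = tri m + m by apply: tri_eq; rewrite mulrDr tri2 intS; ring.
by rewrite intS; ring.
Qed.

(** The pair factors telescope to numerators 1 - x^(zeta + 2c + tau j) with j from m to 2m - 1, over
    denominators with odd j below 2m. The diagonal factors 1/(1 - z y^2) supply the even j, and the
    quotient is the inverse of a Pochhammer symbol of length m. *)
Lemma weight_str_odd c m (M : nat) :
  (forall j : int, zeta + 2 * c + tau * j != 0) ->
  weight (x ^ zeta) (x ^ tau) (fun y => y ^- M / (1 - x ^ zeta * y ^+ 2)) (str x tau c m) =
  (\prod_(y <- str x tau c m) y) ^- M / poch (zeta + 2 * c) m.
Proof.
elim: m c => [|m IHm] c nz.
  by rewrite /weight /= !big_nil poch0 // expr1n !invr1.
rewrite -[str x tau c m.+1]/([:: x ^ c] ++ str x tau (c + tau) m) weight_cat IHm; last first.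
  by move=> j; have := nz (2 + j); congr (_ != 0); ring.
rewrite /cweight big_seq1 prod_fq_str //; last first.
  by move=> j; have := nz (j%:Z + 1); congr (_ != 0); ring.
rewrite /weight /= !big_cons !big_nil !mulr1.
have -> : zeta + 2 * (c + tau) = zeta + 2 * c + tau + tau by ring.
have -> : zeta + c + (c + tau) = zeta + 2 * c + tau by ring.
have pS : poch (zeta + 2 * c) m.+1 * (1 - x ^ (zeta + 2 * c + tau + tau * m)) =
   (1 - x ^ (zeta + 2 * c)) * (1 - x ^ (zeta + 2 * c + tau)) * poch (zeta + 2 * c + tau + tau) m.
  have -> : zeta + 2 * c + tau + tau * m = zeta + 2 * c + tau * m.+1 by rewrite intS; ring.
  have <- : poch (zeta + 2 * c + tau * m.+1) 1 = 1 - x ^ (zeta + 2 * c + tau * m.+1).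
    by rewrite pochS // poch0 // mulr1.
  by rewrite -pochD // addn1 !pochS // mulrA.
have yE : x ^ zeta * (x ^ c) ^+ 2 = x ^ (zeta + 2 * c).
  by rewrite exprnP exprz_exp -xD; congr (x ^ _); ring.
have p0 : poch (zeta + 2 * c) m.+1 != 0 by apply: poch_neq0.
have p1 : poch (zeta + 2 * c + tau + tau) m != 0.
  by apply: poch_neq0 => // j; have := nz (2 + j); congr (_ != 0); ring.
have y1 : 1 - x ^ (zeta + 2 * c) != 0.
  by apply: sub1x_neq0 => //; have := nz 0; congr (_ != 0); ring.
have y2 : 1 - x ^ (zeta + 2 * c + tau) != 0.
  by apply: sub1x_neq0 => //; have := nz 1; congr (_ != 0); ring.
rewrite yE exprMn invfM.
apply: (mulIf p0); rewrite [RHS]divfK //.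
set Y := 1 - x ^ (zeta + 2 * c + tau + tau * m) in pS *.
set Pr := (\prod_(y <- _) y) ^+ M; set X := (x ^ c) ^+ M.
transitivity (X^-1 * Pr^-1 * (poch (zeta + 2 * c) m.+1 * Y / ((1 - x ^ (zeta + 2 * c)) *
   (1 - x ^ (zeta + 2 * c + tau)) * poch (zeta + 2 * c + tau + tau) m))).
  by rewrite !invfM; ring.
by rewrite pS mulfV ?mulr1 // !mulf_neq0.
Qed.

Lemma inv_pair (D D' a a' f f' s : K) :
  s * f * (D * D') = f' * (a * a') -> [&& D != 0, D' != 0, a != 0, a' != 0 & f' != 0] ->
  (D * D')^-1 = s * (f / f') / (a * a').
Proof.
move=> E /and5P[d1 d2 a1 a2 f1]; have dd : D * D' != 0 by rewrite mulf_neq0.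
have aa : a * a' != 0 by rewrite mulf_neq0.
apply: (mulIf dd); rewrite mulVf //.
transitivity (s * f * (D * D') / (f' * (a * a'))); last by rewrite invfM; ring.
by rewrite E mulfV // mulf_neq0.
Qed.

(** The product of the letters of the block is a constant divided by [psi a r], so its power -M
    yields [psi] to the M. The factor [psi] squared and the [fnode] ratio come from a theta shift by
    2r, doubled because the self weights involve z y^2. *)
Lemma classw_odd a b R m (M : nat) :
  zeta + a + b = tau -> (m <= 2 * R)%N ->
  (forall j : int, zeta + 2 * a + tau * j != 0) -> (forall j : nat, tau + tau * j != 0) ->
  let r := offset R m in let p := (2 * R - m)%N in
  classw x zeta tau (fun y => y ^- M / (1 - x ^ zeta * y ^+ 2)) a b R m =
  ((\prod_(y <- str x tau a R) y) * \prod_(y <- str x tau b R) y) ^- M *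
  (psi a r ^+ M.+2 * (fnode a r / fnode a 0)) *
  (poch tau (2 * R) / (poch tau p * poch tau m) /
    (poch (zeta + 2 * a) p * poch (zeta + 2 * b) m)).
Proof.
move=> zab mR nz nzt r p.
have bE : b = tau - zeta - a by rewrite -zab; ring.
have pE : p%:Z = R%:Z + r by rewrite /p /r /offset; lia.
have mE : m%:Z = R%:Z - r by rewrite /r /offset; lia.
have mp : (m + p = 2 * R)%N by rewrite subnKC.
rewrite /classw -/r -/p !weight_str_odd; last first.
- by move=> j; have := nz (2 * r + j); congr (_ != 0); ring.
- by move=> j; have := nz (2 * r - 2 - j); rewrite -oppr_eq0 bE; congr (_ != 0); ring.
have AB : zeta + (a + tau * r) + (b - tau * r) = tau by rewrite bE; ring.
rewrite cweight_str //; last by rewrite AB.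
rewrite AB (poch_split mp nzt) !prod_str -!xD.
have sE : (a + tau * r) * m + tau * tri m + ((b - tau * r) * p + tau * tri p) =
   a * R + tau * tri R + (b * R + tau * tri R) - ((zeta + 2 * a - tau) * r + tau * r ^+ 2).
  apply: (@mulfI _ 2) => //.
  transitivity (2 * ((a + tau * r) * m) + tau * (2 * tri m) + 2 * ((b - tau * r) * p) + tau * (2 * tri p)); first by ring.
  rewrite [RHS](_ : _ = 2 * (a * R) + tau * (2 * tri R) + 2 * (b * R) + tau * (2 * tri R) -
     2 * ((zeta + 2 * a - tau) * r + tau * r ^+ 2)); last by ring.
  by rewrite !tri2 pE mE bE; ring.
have E1 := @ftheta_shift (2 * r) (zeta + 2 * a - tau) m p p m ltac:(lia) ltac:(lia).
rewrite !fthetaE in E1.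
have tr : tri (2 * r) = 2 * r ^+ 2 - r by apply: tri_eq; ring.
have e1 : zeta + 2 * a - tau + tau * (2 * r) + tau = zeta + 2 * (a + tau * r) by ring.
have e2 : tau - (zeta + 2 * a - tau + tau * (2 * r)) = zeta + 2 * (b - tau * r).
  by rewrite bE; ring.
have e3 : zeta + 2 * a - tau + tau = zeta + 2 * a by ring.
have e4 : tau - (zeta + 2 * a - tau) = zeta + 2 * b by rewrite bE; ring.
have sg : (-1) ^+ `|(2 * r)%R|%N = 1 :> K by rewrite abszM exprM sqrrN expr1n expr1n.
have fE (u : int) : 1 - x ^ (zeta + 2 * a - tau + tau * (2 * u)) = x ^ (a + tau * u) * fnode a u.
  rewrite /fnode mulrBr -!xD subrr expr0z; congr (1 - x ^ _); ring.
have f0E : 1 - x ^ (zeta + 2 * a - tau) = x ^ a * fnode a 0.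
  by have := fE 0; rewrite !mulr0 !addr0.
rewrite e1 e2 e3 e4 sg mul1r fE f0E in E1.
have fz : fnode a 0 != 0.
  have : 1 - x ^ (zeta + 2 * a - tau) != 0.
    by apply: sub1x_neq0 => //; have := nz (- 1); congr (_ != 0); ring.
  by rewrite f0E mulf_eq0 negb_or => /andP[].
have E2 : psi a r ^+ 2 * fnode a r * (poch (zeta + 2 * (a + tau * r)) m *
    poch (zeta + 2 * (b - tau * r)) p) =
    fnode a 0 * (poch (zeta + 2 * a) p * poch (zeta + 2 * b) m).
  have xa : x ^ a != 0 by exact: expfz_neq0.
  apply: (mulfI xa).
  have -> : x ^ a * (fnode a 0 * (poch (zeta + 2 * a) p * poch (zeta + 2 * b) m)) =
    x ^ a * fnode a 0 * poch (zeta + 2 * a) p * poch (zeta + 2 * b) m by ring.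
  rewrite -E1 tr /psi exprnP exprz_exp.
  have -> : x ^ (2 * r * (zeta + 2 * a - tau) + tau * (2 * r ^+ 2 - r)) =
     x ^ (((zeta + 2 * a - tau) * r + tau * r ^+ 2) * 2) * x ^ (- (tau * r)).
    by rewrite -xD; congr (x ^ _); ring.
  have -> : x ^ (a + tau * r) = x ^ a * x ^ (tau * r) by rewrite xD.
  have xr : x ^ (- (tau * r)) * x ^ (tau * r) = 1 by rewrite -xD addNr expr0z.
  set P := x ^ (_ * 2); set f := fnode a r; set d1 := poch _ m; set d2 := poch _ p.
  transitivity (x ^ a * P * f * (d1 * d2) * (x ^ (- (tau * r)) * x ^ (tau * r))).
    by rewrite xr; ring.
  by ring.
have b1 : poch (zeta + 2 * (a + tau * r)) m != 0.
  by apply: poch_neq0 => // j; have := nz (2 * r + j); congr (_ != 0); ring.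
have b2 : poch (zeta + 2 * (b - tau * r)) p != 0.
  apply: poch_neq0 => // j; have := nz (2 * r - 2 - j%:Z); rewrite -oppr_eq0 bE.
  by congr (_ != 0); ring.
have b3 : poch (zeta + 2 * a) p != 0 by apply: poch_neq0.
have b4 : poch (zeta + 2 * b) m != 0.
  apply: poch_neq0 => // j; have := nz (- 2 - j%:Z); rewrite -oppr_eq0 bE.
  by congr (_ != 0); ring.
have D := inv_pair E2; rewrite b1 b2 b3 b4 fz in D; have {}D := D isT.
set S := (x ^ _) ^- M; set S' := (x ^ _) ^- M.
have SE : S * S' = (x ^ (a * R + tau * tri R + (b * R + tau * tri R))) ^- M * psi a r ^+ M.
  rewrite /S /S' -invfM -exprMn -xD sE.
  have -> : x ^ (a * R + tau * tri R + (b * R + tau * tri R) -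
      ((zeta + 2 * a - tau) * r + tau * r ^+ 2)) =
      x ^ (a * R + tau * tri R + (b * R + tau * tri R)) / psi a r.
    by rewrite /psi xD invr_expz.
  by rewrite exprMn invfM exprVn invrK.
rewrite [_ ^+ M.+2](_ : _ = psi a r ^+ M * psi a r ^+ 2); last by rewrite -exprD addn2.
transitivity (S * S' * (poch (zeta + 2 * (a + tau * r)) m *
   poch (zeta + 2 * (b - tau * r)) p)^-1 * (poch tau (2 * R) / poch tau p / poch tau m)).
  by rewrite invfM; ring.
by rewrite SE D [(poch tau p * _)^-1]invfM; ring.
Qed.

End Theta.

(** * Weights of blocks for the auxiliary alphabet, with z = 1 and t = x^(2 kap) *)

Section HalfBase.
Variables (K : fieldType) (x : K).
Hypotheses (x0 : x != 0) (xtor : forall d : int, d != 0 -> x ^ d != 1).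
Variable kap : int.
Implicit Types (c d e s : int) (m p k : nat).

Let tau := kap + kap.
Let z := x ^ (0 : int).
Let t := x ^ tau.
Let xD := xD x0.

(** The parameters e = f = 1, a = -x^kap, b = -1 make the constant term (x^kap; x^(2 kap))_N. Since
    z = 1, the function equals (1 - t y^2)/((1 - y)(1 - x^kap y)), so Pochhammer symbols of the half
    base x^kap appear. *)
Definition phi_half (y : K) : K :=
  (1 - - x ^ kap * y) * (1 - -1 * y) / (1 - z * y ^+ 2).

Lemma weight_str_half c m : (forall j : int, c + kap * j != 0) ->
  weight z t phi_half (str x tau c m) =
  poch x tau (2 * c + tau * m) m / poch x kap c (2 * m).
Proof.
elim: m c => [|m IHm] c nz.
  by rewrite /weight /= !big_nil !poch0 // invr1.
have nz' (i j : nat) : (i <= 2)%N -> 2 * c + tau * j != 0.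
  by move=> _; have := nz j; rewrite -(mulrI_eq0 _ (@mulfI _ 2 _)) //; congr (_ != 0); rewrite /tau; ring.
rewrite -[str x tau c m.+1]/([:: x ^ c] ++ str x tau (c + tau) m) weight_cat IHm; last first.
  by move=> j; have := nz (2 + j); congr (_ != 0); rewrite /tau; ring.
rewrite /cweight big_seq1 prod_fq_str //; last first.
  by move=> j; have := nz' 0%N j.+1 isT; rewrite intS; congr (_ != 0); ring.
rewrite {1}/weight /= !big_cons !big_nil !mulr1.
have -> : 0 + c + (c + tau) + tau * m = 2 * c + tau * m.+1 by rewrite intS; ring.
have -> : 0 + c + (c + tau) = 2 * c + tau by ring.
have -> : 2 * (c + tau) + tau * m = 2 * c + tau * m.+1 + tau by rewrite intS; ring.
rewrite pochS // mulnS !pochS //.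
have -> : c + kap + kap = c + tau by rewrite /tau; ring.
have y2 : 1 - x ^ (2 * c) != 0 by apply: sub1x_neq0 => //; have := nz' 0%N 0%N isT; rewrite mulr0 addr0.
have y3 : 1 - x ^ (2 * c + tau) != 0 by apply: sub1x_neq0 => //; have := nz' 0%N 1%N isT; rewrite mulr1.
have n1 : 1 - x ^ c != 0 by apply: sub1x_neq0 => //; have := nz 0; rewrite mulr0 addr0.
have n2 : 1 - x ^ (c + kap) != 0 by apply: sub1x_neq0 => //; have := nz 1; rewrite mulr1.
have E2 : x ^ (2 * c) = (x ^ c) ^+ 2 by rewrite exprnP exprz_exp mulrC.
have E3 : x ^ (2 * c + tau) = (x ^ kap * x ^ c) ^+ 2.
  by rewrite -xD exprnP exprz_exp; congr (x ^ _); rewrite /tau; ring.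
rewrite /phi_half /z expr0z mul1r -E2.
have -> : (1 - - x ^ kap * x ^ c) = (1 - x ^ (2 * c + tau)) / (1 - x ^ (c + kap)).
  apply: (mulIf n2); rewrite divfK // E3 [x ^ (c + kap)]xD; ring.
have -> : (1 - -1 * x ^ c) = (1 - x ^ (2 * c)) / (1 - x ^ c).
  by apply: (mulIf n1); rewrite divfK // E2; ring.
set P := poch x tau _ m; set P' := poch x kap _ _; rewrite !invfM.
transitivity ((1 - x ^ (2 * c + tau)) / (1 - x ^ (2 * c + tau)) * ((1 - x ^ (2 * c)) / (1 - x ^ (2 * c))) *
  ((1 - x ^ (c + kap))^-1 / (1 - x ^ c) * (P / P') * (1 - x ^ (2 * c + tau * m.+1)))); first by ring.
by rewrite !mulfV // !mul1r; ring.
Qed.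

(** Here the theta shift by 2r is performed in base x^kap, so [psi] appears only once, with the
    extra linear term [- kap * r]. *)
Lemma classw_half a b R m :
  a + b = tau -> (m <= 2 * R)%N ->
  (forall j : int, a + kap * j != 0) -> (forall j : nat, tau + tau * j != 0) ->
  let r := offset R m in let p := (2 * R - m)%N in
  classw x 0 tau phi_half a b R m =
  psi x tau 0 a r * x ^ (- (kap * r)) *
    ((1 - x ^ (a - kap + tau * r)) / (1 - x ^ (a - kap))) *
  (poch x tau tau (2 * R) / (poch x tau tau p * poch x tau tau m) *
   (poch x tau (2 * a) (2 * R) / poch x tau (2 * a) p) *
   (poch x tau (2 * b) (2 * R) / poch x tau (2 * b) m) /
   (poch x kap a (2 * R) * poch x kap b (2 * R))).
Proof.
move=> zab mR nz nzt r p.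
have bE : b = tau - a by rewrite -zab; ring.
have nzb (j : int) : b + kap * j != 0.
  by have := nz (- 2 - j); rewrite -oppr_eq0 bE; congr (_ != 0); rewrite /tau; ring.
have pE : p%:Z = R%:Z + r by rewrite /p /r /offset; lia.
have mE : m%:Z = R%:Z - r by rewrite /r /offset; lia.
have mp : (m + p = 2 * R)%N by rewrite subnKC.
have pm : (p + m = 2 * R)%N by rewrite subnK.
have nz2 c (j : nat) : (forall j : int, c + kap * j != 0) -> 2 * c + tau * j != 0.
  by move=> nzc; have := nzc j; rewrite -(mulrI_eq0 _ (@mulfI _ 2 _)) //; congr (_ != 0); rewrite /tau; ring.
rewrite /classw -/r -/p !weight_str_half; last first.
- by move=> j; have := nz (2 * r + j); congr (_ != 0); rewrite /tau; ring.
- by move=> j; have := nzb (j - 2 * r); congr (_ != 0); rewrite /tau; ring.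
have AB : 0 + (a + tau * r) + (b - tau * r) = tau by rewrite bE; ring.
rewrite cweight_str //; last by rewrite AB.
have psplit c n k : (n + k = 2 * R)%N -> (forall j : nat, c + tau * j != 0) ->
    poch x tau (c + tau * k) n = poch x tau c (2 * R) / poch x tau c k.
  move=> nk nzc; rewrite -nk addnC pochD //.
  by rewrite mulrAC mulfV ?mul1r // poch_neq0.
rewrite AB (psplit _ _ _ mp nzt).
have -> : 2 * (a + tau * r) + tau * m = 2 * a + tau * p by rewrite mE pE; ring.
have -> : 2 * (b - tau * r) + tau * p = 2 * b + tau * m by rewrite mE pE; ring.
rewrite (psplit _ _ _ mp (fun j => nz2 a j nz)) (psplit _ _ _ pm (fun j => nz2 b j nzb)).
have E1 := @ftheta_shift K x x0 kap (2 * r) (a - kap) (2 * m) (2 * p) (2 * R) (2 * R) ltac:(lia) ltac:(lia).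
rewrite !fthetaE // in E1.
have tr : tri (2 * r) = 2 * r ^+ 2 - r by apply: tri_eq; ring.
have e1 : a - kap + kap * (2 * r) + kap = a + tau * r by rewrite /tau; ring.
have e2 : kap - (a - kap + kap * (2 * r)) = b - tau * r by rewrite bE /tau; ring.
have e3 : a - kap + kap = a by ring.
have e4 : kap - (a - kap) = b by rewrite bE /tau; ring.
have e5 : a - kap + kap * (2 * r) = a - kap + tau * r by rewrite /tau; ring.
have sg : (-1) ^+ `|(2 * r)%R|%N = 1 :> K by rewrite abszM exprM sqrrN expr1n expr1n.
rewrite e1 e2 e3 e4 e5 sg mul1r tr in E1.
have pk c n : (forall j : int, c + kap * j != 0) -> poch x kap c n != 0.
  by move=> nzc; apply: poch_neq0.
have b1 : poch x kap (a + tau * r) (2 * m) != 0.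
  by apply: pk => j; have := nz (2 * r + j); congr (_ != 0); rewrite /tau; ring.
have b2 : poch x kap (b - tau * r) (2 * p) != 0.
  by apply: pk => j; have := nzb (j - 2 * r); congr (_ != 0); rewrite /tau; ring.
have b3 : poch x kap a (2 * R) != 0 by apply: pk.
have b4 : poch x kap b (2 * R) != 0 by apply: pk.
have b5 : 1 - x ^ (a - kap) != 0.
  by apply: sub1x_neq0 => //; have := nz (- 1); congr (_ != 0); ring.
have -> : psi x tau 0 a r * x ^ (- (kap * r)) =
   x ^ (2 * r * (a - kap) + kap * (2 * r ^+ 2 - r)).
  by rewrite /psi -xD; congr (x ^ _); rewrite /tau; ring.
set M := x ^ _ in E1 *; set f := 1 - x ^ (_ + tau * r) in E1 *.
set f0 := 1 - _ in E1 b5 *.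
have E2 : M * f * (poch x kap (a + tau * r) (2 * m) * poch x kap (b - tau * r) (2 * p)) =
    f0 * (poch x kap a (2 * R) * poch x kap b (2 * R)).
  by rewrite [RHS]mulrA -E1; ring.
have := inv_pair E2; rewrite b1 b2 b3 b4 b5 => /(_ isT) D.
set d1 := poch x kap _ (2 * m) in D *; set d2 := poch x kap _ (2 * p) in D *.
transitivity ((d1 * d2)^-1 * (poch x tau tau (2 * R) / (poch x tau tau p * poch x tau tau m) *
   (poch x tau (2 * a) (2 * R) / poch x tau (2 * a) p) *
   (poch x tau (2 * b) (2 * R) / poch x tau (2 * b) m))).
  by rewrite !invfM; ring.
by rewrite D; ring.
Qed.

End HalfBase.

(** * Sums of determinants *)

Section Determinants.
Variable K : fieldType.

(** The recurrence makes [F i j] equal to [f i] times the value at [v i] of a monic polynomial of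
    degree j, the same for all rows, which reduces the determinant to a Vandermonde one. The first
    step [k] differs between the two applications: 0 for [row1] and 1 for [row2]. *)
Lemma det_recurrence n (F : 'I_n -> nat -> K) (f v : 'I_n -> K) (k c : K) :
  (forall i, F i 0%N = f i) -> (forall i, F i 1%N = (v i + k) * f i) ->
  (forall i j, F i j.+2 = v i * F i j.+1 - c * F i j) ->
  \det (\matrix_(i < n, j < n) F i j) =
  (\prod_i f i) * \prod_(i < n) \prod_(j < n | (i < j)%N) (v j - v i).
Proof.
move=> F0 F1 FS.
pose P := fix P j : {poly K} := match j with
  | 0 => 1 | 1 => 'X + k%:P | (j'.+1 as j1).+1 => 'X * P j1 - c *: P j' end.
have PS j : P j.+2 = 'X * P j.+1 - c *: P j by [].
have FP i j : F i j = f i * (P j).[v i] /\ F i j.+1 = f i * (P j.+1).[v i].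
  elim: j => [|j [IH1 IH2]].
    by rewrite F0 F1 /= hornerD hornerX hornerC -[1]/(1%:P) hornerC mulr1 mulrC.
  split=> //; rewrite FS PS IH1 IH2 hornerD hornerN hornerM hornerZ hornerX; ring.
have Pmon j : [/\ P j \is monic, size (P j) = j.+1, P j.+1 \is monic & size (P j.+1) = j.+2].
  elim: j => [|j [m1 s1 m2 s2]].
    by rewrite /= monic1 size_poly1 -[k%:P]opprK -polyCN monicXsubC size_XsubC.
  have sX : size ('X * P j.+1) = j.+3.
    by rewrite mulrC size_mulX ?s2 // monic_neq0.
  have sl : (size (- (c *: P j))%R < size ('X * P j.+1)%R)%N.
    by rewrite sX size_polyN (leq_ltn_trans (size_scale_leq _ _)) // s1 ltnW.
  by split=> //; rewrite PS ?size_polyDl // ?monicE ?lead_coefDl // lead_coefM lead_coefX mul1r -monicE.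
have -> : \matrix_(i < n, j < n) F i j =
    diag_mx (\row_i f i) *m ((Vandermonde n (\row_i v i))^T *m \matrix_(l < n, j < n) (P j)`_l).
  apply/matrixP => i j; rewrite mul_diag_mx !mxE (proj1 (FP i j)); congr (_ * _).
  have [_ sP _ _] := Pmon j.
  rewrite (horner_coef_wide _ (n := n)) ?sP //; apply: eq_bigr => l _.
  by rewrite !mxE mulrC.
rewrite !det_mulmx det_diag det_tr det_Vandermonde.
have -> : \det (\matrix_(l < n, j < n) (P j)`_l) = 1.
  rewrite -det_tr det_trig.
    by apply: big1 => i _; rewrite !mxE; have [/monicP] := Pmon i; rewrite lead_coefE => + sP; rewrite sP.
  apply/is_trig_mxP => i j ij; rewrite !mxE nth_default //.
  by have [_ -> _ _] := Pmon i.
rewrite mulr1; congr (_ * _); first by apply: eq_bigr => i _; rewrite mxE.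
by apply: eq_bigr => i _; apply: eq_bigr => j _; rewrite !mxE.
Qed.

Lemma det_sum_rows n (T : finType) (g : 'I_n -> T -> K) (e : 'I_n -> T -> 'I_n -> K) :
  \sum_(f : {ffun 'I_n -> T}) (\prod_i g i (f i)) * \det (\matrix_(i, j) e i (f i) j) =
  \det (\matrix_(i, j) \sum_(m : T) g i m * e i m j).
Proof.
rewrite /determinant; under eq_bigr do rewrite mulr_sumr.
rewrite exchange_big /=; apply: eq_bigr => s _.
under eq_bigr do rewrite mulrCA.
rewrite -mulr_sumr; congr (_ * _).
under [RHS]eq_bigr do rewrite mxE.
rewrite bigA_distr_bigA /=; apply: eq_bigr => f _.
by rewrite -big_split; apply: eq_bigr => i _; rewrite mxE.
Qed.

Lemma prod_pairs_mul n (h : 'I_n -> K) :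
  \prod_(i < n) \prod_(j < n | (i < j)%N) (h i * h j) = \prod_i h i ^+ n.-1.
Proof.
elim: n h => [|n IHn] h; first by rewrite !big_ord0.
have tail i : \prod_(j < n.+1 | (lift ord0 i < j)%N) (h (lift ord0 i) * h j) =
    \prod_(j < n | (i < j)%N) (h (lift ord0 i) * h (lift ord0 j)).
  by rewrite [LHS]big_mkcond big_ord_recl /= mul1r [RHS]big_mkcond; apply: eq_bigr => j.
rewrite !big_ord_recl /= (eq_bigr _ (fun i _ => tail i)) (IHn (fun i => h (lift ord0 i))).
rewrite big_mkcond big_ord_recl /= mul1r big_split /= prodr_const card_ord.
rewrite -mulrA; congr (_ * _); rewrite -big_split; apply: eq_bigr => i _ /=.
by rewrite -exprS prednK //; apply: leq_ltn_trans (ltn_ord i).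
Qed.

End Determinants.

(** * The two box sums *)

Lemma not_multiple (T s : int) : 0 < s < T -> forall j : int, T * j - s != 0.
Proof.
move=> /andP[s0 sT] j; apply/eqP => E.
have [j0|j0] : j <= 0 \/ 1 <= j by lia.
  by nia.
by nia.
Qed.

Lemma det_ratio (K : fieldType) n (F F0 : 'I_n -> nat -> K) (v v0 : 'I_n -> K) (k c : K) :
  (forall i, F i 1%N = (v i + k) * F i 0%N) ->
  (forall i j, F i j.+2 = v i * F i j.+1 - c * F i j) ->
  (forall i, F0 i 1%N = (v0 i + k) * F0 i 0%N) ->
  (forall i j, F0 i j.+2 = v0 i * F0 i j.+1 - c * F0 i j) ->
  \det (\matrix_(i < n, j < n) F i j) / \det (\matrix_(i < n, j < n) F0 i j) =
  (\prod_i (F i 0%N / F0 i 0%N)) *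
  \prod_(i < n) \prod_(j < n | (i < j)%N) ((v j - v i) / (v0 j - v0 i)).
Proof.
move=> F1 FS F01 F0S; rewrite (det_recurrence _ F1 FS) // (det_recurrence _ F01 F0S) //.
rewrite -mulf_div; congr (_ * _); first by rewrite prodf_div.
by rewrite -prodf_div; apply: eq_bigr => i _; rewrite prodf_div.
Qed.

Section Boxes.
Variables (K : fieldType) (x : K).
Hypotheses (x0 : x != 0) (xtor : forall d : int, d != 0 -> x ^ d != 1).
Variables (n mm R : nat).
Implicit Types (i j : 'I_n) (r : int).

Let xD := xD x0.

Lemma scale_ratio (c u u' : K) : c != 0 -> (c * u) / (c * u') = u / u'.
Proof. by move=> c0; rewrite -mulf_div mulfV // mul1r. Qed.

(** The determinant at r = 0 is the normalization left by the theta shifts, which compare each block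
    with the block at r = 0. The factor [u] collects the Pochhammer symbols, which converge. *)
Definition box_sum (gauss : 'I_n -> int -> K) (row : 'I_n -> int -> nat -> K)
    (u : ('I_n -> nat) -> K) : K :=
  \sum_(f : {ffun 'I_n -> 'I_(2 * R).+1})
    (\prod_i gauss i (offset R (f i))) *
    \det (\matrix_(i < n, j < n) row i (offset R (f i)) j) /
    \det (\matrix_(i < n, j < n) row i 0 j) * u (fun i => f i).

Definition pair_unit (zeta tau : int) (a b : 'I_n -> int) (f : 'I_n -> nat) : K :=
  \prod_(i < n) \prod_(j < n | (i < j)%N)
    (frac x tau (zeta + a i + a j) R (2 * R - f i) (2 * R - f j) *
     frac x tau (zeta + a i + b j) R (2 * R - f i) (f j) *
     frac x tau (zeta + b i + a j) R (f i) (2 * R - f j) *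
     frac x tau (zeta + b i + b j) R (f i) (f j)).

(** [g] is the Gaussian factor of one block; each string lies in n - 1 pairs, each bringing one more
    [psi]. Nodes matter only through ratios of differences, so they may be rescaled by [la]. *)
Lemma Gsum_strings_det (zeta tau : int) (a b : 'I_n -> int) phi (row : 'I_n -> int -> nat -> K)
    (node g gauss : 'I_n -> int -> K) (S : 'I_n -> K) (u : 'I_n -> nat -> K) (la k c : K) :
  (forall i, zeta + a i + b i = tau) ->
  (forall i j (l : int), zeta + a i + a j + tau * l != 0) ->
  (forall i j (l : int), (i < j)%N -> zeta + a i + b j + tau * l != 0) ->
  (forall i r, row i r 1%N = (node i r + k) * row i r 0%N) ->
  (forall i r (j : nat), row i r j.+2 = node i r * row i r j.+1 - c * row i r j) ->
  la != 0 -> (forall i r, node i r = la * vnode x tau zeta (a i) r) ->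
  (forall i r, gauss i r = g i r * psi x tau zeta (a i) r ^+ n.-1) ->
  (forall i (l : nat), (l <= 2 * R)%N -> classw x zeta tau phi (a i) (b i) R l =
     S i * g i (offset R l) * (row i (offset R l) 0%N / row i 0 0%N) * u i l) ->
  Gsum (x ^ zeta) (x ^ tau) phi (flatten [seq str x tau (b i - tau * R) (2 * R) | i <- enum 'I_n]) =
  (\prod_i S i) * box_sum gauss row (fun f => (\prod_i u i (f i)) * pair_unit zeta tau a b f).
Proof.
move=> zab nz1 nz2 row_1 row_S la0 nodeE gaussE classE.
rewrite (Gsum_strings x0 _ R zab) mulr_sumr; apply: eq_bigr => f _.
have fR i : (f i <= 2 * R)%N by rewrite -ltnS ltn_ord.
rewrite (eq_bigr _ (fun i _ => classE i _ (fR i))) !big_split.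
rewrite (eq_bigr _ (fun i _ => gaussE i _)) big_split /=.
have := det_ratio (fun i => row_1 i (offset R (f i))) (fun i => row_S i (offset R (f i)))
  (fun i => row_1 i 0) (fun i => row_S i 0).
rewrite -[_ * _ / _]mulrA => ->.
set U := pair_unit _ _ _ _ _.
have -> : \prod_(i < n) \prod_(j < n | (i < j)%N)
    pairw x zeta tau (a i) (b i) (a j) (b j) R (f i) (f j) =
  U * (\prod_(i < n) \prod_(j < n | (i < j)%N)
     (psi x tau zeta (a i) (offset R (f i)) * psi x tau zeta (a j) (offset R (f j)))) *
  \prod_(i < n) \prod_(j < n | (i < j)%N)
     ((node j (offset R (f j)) - node i (offset R (f i))) / (node j 0 - node i 0)).
  rewrite /U -!big_split; apply: eq_bigr => i _; rewrite -!big_split; apply: eq_bigr => j ij /=.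
  rewrite pairw_formula //; last by move=> l; apply: nz2.
  by rewrite !nodeE -!mulrBr scale_ratio // !mulrA.
by rewrite prod_pairs_mul !big_split /=; ring.
Qed.

(** The exponents [a1 i] and [b1 i] together run through 0, ..., 2n - 1, one for each residue modulo
    the step 2n. *)
Let tau1 : int := (2 * n)%N.
Let a1 i : int := n%:Z - i%:Z - 1.
Let b1 i : int := n%:Z + i%:Z.

(** u^(j+1) - v^(j+1) with u v = x^-1: up to scaling, the entries of a symplectic Weyl numerator. *)
Definition row1 i r (j : nat) : K :=
  x ^ (- (j.+1%:Z * (tau1 * r - i%:Z))) - x ^ (j.+1%:Z * (tau1 * r - i%:Z - 1)).

Definition gauss1 i r : K :=
  x ^ ((mm + n + 1)%N%:Z * (- (2 * i%:Z + 1) * r + tau1 * r ^+ 2)).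

Definition unit1 (f : 'I_n -> nat) : K :=
  (\prod_i (frac x tau1 tau1 R (2 * R - f i) (f i) /
     (poch x tau1 (1 + 2 * a1 i) (2 * R - f i) * poch x tau1 (1 + 2 * b1 i) (f i)))) *
  pair_unit 1 tau1 a1 b1 f.

Definition alphabet1 : seq K :=
  flatten [seq str x tau1 (b1 i - tau1 * R) (2 * R) | i <- enum 'I_n].

Definition strings1 : K :=
  \prod_(i < n) ((\prod_(y <- str x tau1 (a1 i) R) y) * \prod_(y <- str x tau1 (b1 i) R) y).

Lemma power_difference_step (u v : K) (j : nat) :
  u ^+ j.+3 - v ^+ j.+3 = (u + v) * (u ^+ j.+2 - v ^+ j.+2) - u * v * (u ^+ j.+1 - v ^+ j.+1).
Proof. by rewrite !exprS; ring. Qed.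

Let node1 i r := x ^ (- (tau1 * r - i%:Z)) + x ^ (tau1 * r - i%:Z - 1).

Let row1E i r (j : nat) :
  row1 i r j = (x ^ (- (tau1 * r - i%:Z))) ^+ j.+1 - (x ^ (tau1 * r - i%:Z - 1)) ^+ j.+1.
Proof. by rewrite !exprnP !exprz_exp /row1; congr (x ^ _ - x ^ _); ring. Qed.

Let row1_1 i r : row1 i r 1 = (node1 i r + 0) * row1 i r 0.
Proof. by rewrite !row1E /node1; ring. Qed.

Let row1_S i r (j : nat) : row1 i r j.+2 = node1 i r * row1 i r j.+1 - x ^ (- 1) * row1 i r j.
Proof.
rewrite !row1E power_difference_step -xD.
by have -> : - (tau1 * r - i%:Z) + (tau1 * r - i%:Z - 1) = -1 by ring.
Qed.

Lemma Gsum_box1 :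
  Gsum (x ^ (1 : int)) (x ^ tau1) (fun y => y ^- mm / (1 - x ^ (1 : int) * y ^+ 2)) alphabet1 =
  strings1 ^- mm *
  box_sum gauss1 row1 unit1.
Proof.
have zab i : 1 + a1 i + b1 i = tau1 by rewrite /a1 /b1 /tau1; lia.
have ni i : (0 < n)%N by apply: leq_ltn_trans (ltn_ord i).
have nz1 i j (l : int) : 1 + a1 i + a1 j + tau1 * l != 0.
  have := @not_multiple tau1 (i%:Z + j%:Z + 1).
  have -> : 0 < i%:Z + j%:Z + 1 < tau1 by have := ltn_ord i; have := ltn_ord j; rewrite /tau1; lia.
  by move=> /(_ isT (l + 1)); congr (_ != 0); rewrite /a1 /tau1; lia.
have nz2 i j (l : int) : (i < j)%N -> 1 + a1 i + b1 j + tau1 * l != 0.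
  move=> ij; have := @not_multiple tau1 (tau1 - (j%:Z - i%:Z)).
  have -> : 0 < tau1 - (j%:Z - i%:Z) < tau1 by have := ltn_ord j; rewrite /tau1; lia.
  by move=> /(_ isT (l + 2)); congr (_ != 0); rewrite /a1 /b1 /tau1; lia.
have nzt i (l : nat) : tau1 + tau1 * l != 0 by have := ni i; rewrite /tau1; lia.
have nz0 i (l : int) : 1 + 2 * a1 i + tau1 * l != 0.
  by have := nz1 i i l; congr (_ != 0); ring.
pose la := x ^ (n%:Z - 1).
have la0 : la != 0 by exact: expfz_neq0.
have psiE i r : psi x tau1 1 (a1 i) r ^+ (mm + n + 1) = gauss1 i r.
  by rewrite /psi exprnP exprz_exp /gauss1; congr (x ^ _); rewrite /a1 /tau1; lia.
have row0 i r : row1 i r 0%N = la * fnode x tau1 1 (a1 i) r.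
  by rewrite /row1 /fnode [RHS]mulrBr /la -!xD; congr (x ^ _ - x ^ _); rewrite /a1 /tau1; lia.
have nodeE i r : node1 i r = la * vnode x tau1 1 (a1 i) r.
  by rewrite /node1 /vnode [RHS]mulrDr /la -!xD; congr (x ^ _ + x ^ _); rewrite /a1 /tau1; lia.
rewrite /alphabet1 (Gsum_strings_det (gauss := gauss1) (S := fun i => ((\prod_(y <- str x tau1 (a1 i) R) y) *
    \prod_(y <- str x tau1 (b1 i) R) y) ^- mm) (u := fun i l => frac x tau1 tau1 R (2 * R - l) l /
     (poch x tau1 (1 + 2 * a1 i) (2 * R - l) * poch x tau1 (1 + 2 * b1 i) l))
  (g := fun i r => psi x tau1 1 (a1 i) r ^+ mm.+2) zab nz1 nz2 row1_1 row1_S la0 nodeE) //.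
- by rewrite /strings1 -prodrXl prodfV.
- by move=> i r; rewrite -psiE -exprD; congr (_ ^+ _); have := ni i; lia.
by move=> i l lR; rewrite (classw_odd x0 xtor mm (zab i) lR (nz0 i) (nzt i)) !row0 scale_ratio // !mulrA.
Qed.

(** The power of [psi] reached in [gauss1]: mm + 2 from the block and n - 1 from the pairs. In the
    second family the step is 2 kap and the power is n, so step and power trade places up to the
    factor 2. *)
Let kap : int := (mm + n + 1)%N.
Let tau2 : int := kap + kap.
Let a2 i : int := kap - i.+1%:Z.
Let b2 i : int := kap + i.+1%:Z.

(** u^j - v^(j+1) with u v = 1: up to a power, the entries of an odd orthogonal Weyl numerator.
    Column j here corresponds to row j of the first family. *)
Definition row2 i r (j : nat) : K :=
  x ^ (- (j%:Z * (tau2 * r - i.+1%:Z))) - x ^ (j.+1%:Z * (tau2 * r - i.+1%:Z)).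

Definition gauss2 i r : K :=
  x ^ (n%:Z * (- (2 * i.+1%:Z) * r + tau2 * r ^+ 2) - kap * r).

Definition unit2 (f : 'I_n -> nat) : K :=
  (\prod_i (frac x tau2 tau2 R (2 * R - f i) (f i) *
     (poch x tau2 (2 * a2 i) (2 * R) / poch x tau2 (2 * a2 i) (2 * R - f i)) *
     (poch x tau2 (2 * b2 i) (2 * R) / poch x tau2 (2 * b2 i) (f i)) /
     (poch x kap (a2 i) (2 * R) * poch x kap (b2 i) (2 * R)))) *
  pair_unit 0 tau2 a2 b2 f.

Definition alphabet2 : seq K :=
  flatten [seq str x tau2 (b2 i - tau2 * R) (2 * R) | i <- enum 'I_n].

Let node2 i r := x ^ (- (tau2 * r - i.+1%:Z)) + x ^ (tau2 * r - i.+1%:Z).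

Let row2E i r (j : nat) :
  row2 i r j = (x ^ (- (tau2 * r - i.+1%:Z))) ^+ j - (x ^ (tau2 * r - i.+1%:Z)) ^+ j.+1.
Proof. by rewrite !exprnP !exprz_exp /row2; congr (x ^ _ - x ^ _); ring. Qed.

Let node2_mul i r : x ^ (- (tau2 * r - i.+1%:Z)) * x ^ (tau2 * r - i.+1%:Z) = 1.
Proof. by rewrite -xD addNr expr0z. Qed.

Let row2_1 i r : row2 i r 1 = (node2 i r + 1) * row2 i r 0.
Proof.
have := node2_mul i r; rewrite !row2E /node2.
set u := x ^ _; set v := x ^ _ => uv.
transitivity (u - v ^+ 2 + (1 - u * v)); first by rewrite uv; ring.
by ring.
Qed.

Let row2_S i r (j : nat) : row2 i r j.+2 = node2 i r * row2 i r j.+1 - 1 * row2 i r j.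
Proof.
have := node2_mul i r; rewrite !row2E /node2.
set u := x ^ _; set v := x ^ _ => uv; rewrite -uv !exprS.
transitivity ((u + v) * (u * u ^+ j - v * (v * v ^+ j)) -
  (u * v * u ^+ j - (u * v) * (v * v ^+ j))); first by ring.
by rewrite uv; ring.
Qed.

Lemma Gsum_box2 :
  Gsum (x ^ (0 : int)) (x ^ tau2) (phi_half x kap) alphabet2 =
  box_sum gauss2 row2 unit2.
Proof.
have zab i : 0 + a2 i + b2 i = tau2 by rewrite /a2 /b2 /tau2; lia.
have zab' i : a2 i + b2 i = tau2 by rewrite /a2 /b2 /tau2; lia.
have ni i : (0 < n)%N by apply: leq_ltn_trans (ltn_ord i).
have nz1 i j (l : int) : 0 + a2 i + a2 j + tau2 * l != 0.
  have := @not_multiple tau2 (i%:Z + j%:Z + 2).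
  have -> : 0 < i%:Z + j%:Z + 2 < tau2.
    by have := ltn_ord i; have := ltn_ord j; rewrite /tau2 /kap; lia.
  by move=> /(_ isT (l + 1)); congr (_ != 0); rewrite /a2 /tau2; lia.
have nz2 i j (l : int) : (i < j)%N -> 0 + a2 i + b2 j + tau2 * l != 0.
  move=> ij; have := @not_multiple tau2 (tau2 - (j%:Z - i%:Z)).
  have -> : 0 < tau2 - (j%:Z - i%:Z) < tau2 by have := ltn_ord j; rewrite /tau2 /kap; lia.
  by move=> /(_ isT (l + 2)); congr (_ != 0); rewrite /a2 /b2 /tau2; lia.
have nzt (l : nat) : tau2 + tau2 * l != 0 by rewrite /tau2 /kap; lia.
have nz0 i (l : int) : a2 i + kap * l != 0.
  have := @not_multiple kap i.+1.
  have -> : 0 < i.+1%:Z < kap by have := ltn_ord i; rewrite /kap; lia.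
  by move=> /(_ isT (l + 1)); congr (_ != 0); rewrite /a2; lia.
pose la := x ^ kap.
have la0 : la != 0 by exact: expfz_neq0.
have psiE i r : psi x tau2 0 (a2 i) r ^+ n * x ^ (- (kap * r)) = gauss2 i r.
  by rewrite /psi exprnP exprz_exp -xD /gauss2; congr (x ^ _); rewrite /a2 /tau2; ring.
have row0 i r : row2 i r 0%N = 1 - x ^ (a2 i - kap + tau2 * r).
  by rewrite row2E expr0 expr1; congr (1 - x ^ _); rewrite /a2; ring.
have row00 i : row2 i 0 0%N = 1 - x ^ (a2 i - kap).
  by rewrite row0; congr (1 - x ^ _); ring.
have nodeE i r : node2 i r = la * vnode x tau2 0 (a2 i) r.
  by rewrite /node2 /vnode [RHS]mulrDr /la -!xD; congr (x ^ _ + x ^ _); rewrite /a2 /tau2; ring.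
rewrite /alphabet2 (Gsum_strings_det (gauss := gauss2) (S := fun=> 1) (u := fun i l => frac x tau2 tau2 R (2 * R - l) l *
     (poch x tau2 (2 * a2 i) (2 * R) / poch x tau2 (2 * a2 i) (2 * R - l)) *
     (poch x tau2 (2 * b2 i) (2 * R) / poch x tau2 (2 * b2 i) l) /
     (poch x kap (a2 i) (2 * R) * poch x kap (b2 i) (2 * R)))
  (g := fun i r => psi x tau2 0 (a2 i) r * x ^ (- (kap * r))) zab nz1 nz2 row2_1 row2_S la0 nodeE).
- by rewrite big1 ?mul1r.
- by move=> i r; rewrite -psiE mulrAC -exprS prednK // ni.
by move=> i l lR; rewrite (classw_half x0 xtor (zab' i) lR (nz0 i) nzt) row0 row00 mul1r.
Qed.

(* The two box sums are the expansions of one determinant along rows and along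
   columns, up to reversing the summation over the second half of each entry. *)
Lemma box_sums_eq :
  \sum_(f : {ffun 'I_n -> 'I_(2 * R).+1})
    (\prod_i gauss1 i (offset R (f i))) *
    \det (\matrix_(i < n, j < n) row1 i (offset R (f i)) j) =
  \sum_(f : {ffun 'I_n -> 'I_(2 * R).+1})
    (\prod_i gauss2 i (offset R (f i))) *
    \det (\matrix_(i < n, j < n) row2 i (offset R (f i)) j).
Proof.
rewrite (det_sum_rows (fun i (l : 'I_(2 * R).+1) => gauss1 i (offset R l))
  (fun i (l : 'I_(2 * R).+1) (j : 'I_n) => row1 i (offset R l) j)).
rewrite (det_sum_rows (fun i (l : 'I_(2 * R).+1) => gauss2 i (offset R l))
  (fun i (l : 'I_(2 * R).+1) (j : 'I_n) => row2 i (offset R l) j)).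
rewrite -det_tr; congr (\det _); apply/matrixP => i j; rewrite !mxE.
under eq_bigr do rewrite /gauss1 /row1 mulrBr -!xD.
under [RHS]eq_bigr do rewrite /gauss2 /row2 mulrBr -!xD.
rewrite !sumrB; congr (_ - _).
  apply: eq_bigr => l _; congr (x ^ _); rewrite /tau1 /tau2 /kap.
  move: (offset R l) => r; rewrite !intS; ring.
rewrite (reindex_inj rev_ord_inj) /=; apply: eq_bigr => l _; congr (x ^ _).
have -> : offset R ((2 * R).+1 - l.+1) = - offset R l.
  by have := ltn_ord l; rewrite /offset; lia.
by rewrite /tau1 /tau2 /kap; move: (offset R l) => r; rewrite !intS; ring.
Qed.

End Boxes.

(** * Consecutive powers as a union of strings, and the two box formulas *)

Section Flips.
Variables (K : fieldType) (z t : K).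
Hypothesis z0 : z != 0.

Lemma configs_flip (s : seq K) (E : seq K -> K) : 0 \notin s ->
  \sum_(h <- configs z (map (refl z) s)) E h = \sum_(h <- configs z s) E h.
Proof.
elim: s E => [|y s IHs] E //; rewrite inE negb_or eq_sym => /andP[y0 s0].
rewrite map_cons !big_configs_cons !IHs // addrC; congr (_ + _).
have -> // : refl z (refl z y) = y by rewrite /refl; field; rewrite y0 z0 oner_neq0.
Qed.

Lemma configs_flatten (I : eqType) (F G : I -> seq K) (s : seq I) (E : seq K -> K) :
  perm_invariant E ->
  (forall i (E' : seq K -> K), perm_invariant E' ->
     \sum_(h <- configs z (F i)) E' h = \sum_(h <- configs z (G i)) E' h) ->
  \sum_(h <- configs z (flatten (map F s))) E h =
  \sum_(h <- configs z (flatten (map G s))) E h.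
Proof.
move=> invE FG; elim: s E invE => [|i s IHs] E invE //=.
rewrite !configs_cat FG => [|h h' hh']; last first.
  by apply: eq_bigr => h2 _; apply: invE; rewrite perm_cat2r.
apply: eq_bigr => h1 _; apply: IHs => h h' hh'.
by apply: invE; rewrite perm_cat2l.
Qed.

End Flips.

Section PowersAlphabet.
Variables (K : fieldType) (x : K).
Hypotheses (x0 : x != 0).
Variables (n R : nat).

Let tau : int := (2 * n)%N.
Let a (i : 'I_n) : int := n%:Z - i%:Z - 1.
Let b (i : 'I_n) : int := n%:Z + i%:Z.

Lemma str_cat c m k : str x tau c (m + k) = str x tau c m ++ str x tau (c + tau * m) k.
Proof.
elim: m c => [|m IHm] c; first by rewrite mulr0 addr0.
rewrite addSn /= IHm; congr (_ :: _ ++ str _ _ _ _).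
by rewrite intS; ring.
Qed.

Lemma str_neq0 c m : 0 \notin str x tau c m.
Proof.
elim: m c => [|m IHm] c //=; rewrite inE negb_or IHm andbT eq_sym.
exact: expfz_neq0.
Qed.

(** Raising R by one appends a letter to each of the 2n strings, and these letters are the next 2n
    powers: n from the [a i] in reverse order, then n from the [b i]. *)
Lemma powers_perm :
  perm_eq [seq x ^+ k | k <- iota 0 (2 * n * R)]
    (flatten [seq str x tau (a i) R ++ str x tau (b i) R | i <- enum 'I_n]).
Proof.
apply/seq.permP => P; rewrite count_map count_flatten -map_comp.
pose h (c : int) : nat := P (x ^ c).
have strE (c : int) (m : nat) : count P (str x tau c m) = (\sum_(0 <= l < m) h (c + tau * l%:Z)%R)%N.
  elim: m c => [|m IHm] c; first by rewrite big_geq.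
  rewrite big_nat_recl //= IHm mulr0 addr0; congr addn; apply: eq_bigr => l _.
  by rewrite intS; congr h; ring.
rewrite sumnE big_map big_enum /=.
under eq_bigr do rewrite count_cat !strE.
elim: R => [|r IHr].
  by rewrite muln0 big1 // => i _; rewrite !big_geq.
under eq_bigr do rewrite !big_nat_recr //= addnACA.
rewrite big_split /= -IHr mulnS addnC iotaD count_cat; congr addn.
rewrite -sum1_count big_mkcond /=.
have -> : iota (0 + 2 * n * r) (2 * n) = [seq (2 * n * r + k)%N | k <- iota 0 (n + n)].
  by rewrite -iotaDl addn0 add0n addnn mul2n.
rewrite big_map iotaD big_cat /= add0n big_split /=; congr addn.
  have -> : iota 0 n = index_iota 0 n by rewrite /index_iota subn0.
  rewrite big_mkord (reindex_inj rev_ord_inj) /=; apply: eq_bigr => i _.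
  rewrite /h exprnP.
  have -> : a i + tau * r = (2 * n * r + (n - i.+1))%N by have := ltn_ord i; rewrite /a /tau; lia.
  by case: (P _).
have -> : iota n n = [seq (n + k)%N | k <- index_iota 0 n].
  by rewrite -iotaDl addn0 subn0.
rewrite big_map big_mkord; apply: eq_bigr => i _.
rewrite /h exprnP; have -> : b i + tau * r = (2 * n * r + (n + i))%N by rewrite /b /tau; lia.
by case: (P _).
Qed.

(** The first half of each string of [alphabet1] is the reflection of [str (a i) R]. Reflecting
    letters of the alphabet only permutes the configurations, so the sum is that of the consecutive
    powers. *)
Lemma Gsum_alphabet1 (phi : K -> K) :
  Gsum (x ^ (1 : int)) (x ^ tau) phi (alphabet1 x n R) =
  Gsum (x ^ (1 : int)) (x ^ tau) phi [seq x ^+ k | k <- iota 0 (2 * n * R)].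
Proof.
rewrite /Gsum [RHS](configs_perm_sum _ (@weight_perm _ _ _ phi) powers_perm).
apply: configs_flatten; first exact: weight_perm.
move=> i E invE.
have -> : (2 * R = R + R)%N by lia.
rewrite str_cat.
have -> : n%:Z + i%:Z - (2 * n)%N%:Z * R + tau * R = b i by rewrite /b /tau; ring.
rewrite !configs_cat.
have perm_str : perm_eq (map (refl (x ^ (1 : int))) (str x tau (n%:Z + i%:Z - tau * R) R))
    (str x tau (a i) R).
  apply: perm_trans (map_refl_str x0 _ _ _ _) _.
  by have -> // : - 1 - (n%:Z + i%:Z - tau * R) - tau * (R%:Z - 1) = a i by rewrite /a /tau; lia.
have invE' : perm_invariant (fun h => \sum_(h2 <- configs (x ^ (1 : int)) (str x tau (b i) R)) E (h ++ h2)).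
  by move=> h h' hh'; apply: eq_bigr => h2 _; apply: invE; rewrite perm_cat2r.
by rewrite -(configs_perm_sum _ invE' perm_str) configs_flip ?str_neq0 ?expfz_neq0.
Qed.

Lemma prod_powers : \prod_(y <- [seq x ^+ k | k <- iota 0 (2 * n * R)]) y = strings1 x n R.
Proof.
rewrite (perm_big _ powers_perm) /= big_flatten big_map big_enum.
by apply: eq_bigr => i _; rewrite big_cat.
Qed.

End PowersAlphabet.

Section BoxFormulas.
Variables (K : fieldType) (x : K).
Hypotheses (x0 : x != 0) (xtor : forall d : int, d != 0 -> x ^ d != 1).
Variables (n mm R : nat).

Lemma level_sum_box : (0 < n)%N ->
  level_sum (x ^+ (2 * n)) x mm [seq x ^+ k | k <- iota 0 (2 * n * R)] =
  box_sum R (gauss1 x mm (n := n)) (row1 x (n := n)) (unit1 x R (n := n)).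
Proof.
move=> n0; have xz : x ^ (1 : int) = x by rewrite expr1z.
have xi (k l : nat) : x ^+ k = x ^+ l -> k = l.
  move=> kl; have : x ^ (k%:Z - l%:Z) == 1 by rewrite expfzDr // -invr_expz -!exprnP kl mulfV // expf_neq0.
  by apply: contraTeq => /eqP klN; apply: xtor; apply/eqP; lia.
have gs : generic x [seq x ^+ k | k <- iota 0 (2 * n * R)].
  apply/genericP; split.
  - by rewrite map_inj_uniq ?iota_uniq // => k l; apply: xi.
  - by move=> y /mapP[k _ ->]; rewrite expf_neq0.
  move=> y y' /mapP[k _ ->] /mapP[l _ ->]; rewrite -exprS -exprD.
  by rewrite exprnP; apply: xtor; lia.
rewrite level_sum_Gsum // (prod_powers x0).
have := Gsum_box1 x0 xtor n mm R; rewrite Gsum_alphabet1 // xz exprnP => ->.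
rewrite mulrA mulfV ?mul1r // expf_neq0 //.
rewrite -prod_powers // prodf_seq_neq0; apply/allP => y /mapP[k _ ->].
by rewrite expf_neq0.
Qed.

Lemma qpoch_box : (0 < n)%N ->
  qpoch (x ^+ (mm + n + 1)) (x ^+ (2 * (mm + n + 1))) (2 * n * R) =
  box_sum R (gauss2 x mm (n := n)) (row2 x mm (n := n)) (unit2 x mm R (n := n)).
Proof.
move=> n0; rewrite -Gsum_box2 //; set kap : int := (mm + n + 1)%N.
set tau := kap + kap.
have xi (d e : int) : x ^ d = x ^ e -> d = e.
  move=> de; have : x ^ (d - e) == 1 by rewrite expfzDr // -invr_expz de mulfV // expfz_neq0.
  by apply: contraTeq => de'; apply: xtor; rewrite subr_eq0.
have strE c m : str x tau c m = [seq x ^ (c + tau * l%:Z) | l <- iota 0 m].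
  elim: m c => [|m IHm] c //=; rewrite IHm mulr0 addr0 (iotaDl 1 0) -map_comp.
  by congr (_ :: _); apply: eq_map => l /=; congr (x ^ _); rewrite intS; ring.
pose e (i : 'I_n) (l : nat) : K := x ^ (kap + i.+1%:Z + tau * (l%:Z - R%:Z)).
have alE : alphabet2 x n mm R = [seq e i l | i <- enum 'I_n, l <- iota 0 (2 * R)].
  congr flatten; apply: eq_map => i; rewrite -/kap -/tau strE; apply: eq_map => l.
  by rewrite /e; congr (x ^ _); ring.
have mem y : y \in alphabet2 x n mm R ->
    exists i : 'I_n, exists l : int, y = x ^ (kap + i.+1%:Z + tau * l).
  by rewrite alE => /allpairsP[[i l] /= [_ _ ->]]; exists i, (l%:Z - R%:Z).
have gs : generic (x ^ (0 : int)) (alphabet2 x n mm R).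
  apply/genericP; split.
  - rewrite alE; apply: allpairs_uniq; [exact: enum_uniq | exact: iota_uniq |].
    move=> [i l] [j k] _ _ /= /xi E.
    have [ij|ij|ij] := ltngtP i j.
    + have := @not_multiple tau (j%:Z - i%:Z); have -> : 0 < j%:Z - i%:Z < tau.
        by have := ltn_ord i; have := ltn_ord j; rewrite /tau /kap; lia.
      by move=> /(_ isT (l%:Z - k%:Z)); rewrite !intS in E; lia.
    + have := @not_multiple tau (i%:Z - j%:Z); have -> : 0 < i%:Z - j%:Z < tau.
        by have := ltn_ord i; have := ltn_ord j; rewrite /tau /kap; lia.
      by move=> /(_ isT (k%:Z - l%:Z)); rewrite !intS in E; lia.
    have ij' := val_inj ij; subst j; congr (_, _).
    have : tau * (l%:Z - k%:Z) = 0 by lia.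
    by move/eqP; rewrite mulf_eq0 => /orP[|]; rewrite /tau /kap; lia.
  - by move=> y /mem[i [l ->]]; rewrite expfz_neq0.
  move=> y y' /mem[i [l ->]] /mem[j [k ->]]; rewrite -!(xD x0); apply: xtor.
  have := @not_multiple tau (tau - i.+1%:Z - j.+1%:Z).
  have -> : 0 < tau - i.+1%:Z - j.+1%:Z < tau.
    by have := ltn_ord i; have := ltn_ord j; rewrite /tau /kap; lia.
  by move=> /(_ isT (l + k + 2)); congr (_ != 0); rewrite /tau; ring.
have sz : size (alphabet2 x n mm R) = (2 * n * R)%N.
  by rewrite alE size_allpairs size_iota size_enum_ord; lia.
have z1 : x ^ (0 : int) != 0 by rewrite expr0z oner_neq0.
(* The numerator parameters of [phi_half]; z = 1 disappears from the constant. *)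
have := @Gsum_const K _ (x ^ tau) z1 1 1 (- x ^ kap) (-1) _ gs.
rewrite /phi_half => ->.
rewrite sz /qpoch big_mkord; apply: eq_bigr => k _; rewrite expr0z divr1 mulrNN !mulr1.
congr (1 - _); rewrite mulrC; congr (_ ^+ k * _).
by rewrite exprnP; congr (x ^ _); rewrite /tau /kap; lia.
Qed.

End BoxFormulas.

(** * Principal specializations *)

Section DoubledLevels.
Variables (K : fieldType) (t : K).
Implicit Types (l : seq (K * nat)) (s : seq K) (L : seq nat).

Definition double_levels l : seq (K * nat) := [seq (u.1, (2 * u.2)%N) | u <- l].

Lemma levels_double L s :
  levels [seq (2 * k)%N | k <- L] s = [seq double_levels l | l <- levels L s].
Proof.
elim: s => //= y s ->; rewrite allpairs_mapl allpairs_mapr map_allpairs.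
by [].
Qed.

(** [kapl] only compares levels, so doubling them changes the monomial and nothing else. *)
Lemma monomial_double l : monomial t (double_levels l) = lweight t 1 l.
Proof.
rewrite /monomial /lweight /double_levels big_map pairs_map; congr (_ * _).
  by apply: eq_bigr => u _; rewrite /= mul1r exprM.
apply: eq_pairs => u v _ _; rewrite /kapl /=.
by rewrite !ltn_pmul2l.
Qed.

Lemma lweight_scale c l : lweight t c l = c ^+ sumn (map snd l) * lweight t 1 l.
Proof.
rewrite /lweight mulrA; congr (_ * _); elim: l => [|u l IHl].
  by rewrite !big_nil mulr1.
by rewrite !big_cons IHl /= exprD mul1r exprMn; ring.
Qed.

Lemma levels_cat L s1 s2 (E : seq (K * nat) -> K) :
  \sum_(l <- levels L (s1 ++ s2)) E l =
  \sum_(l1 <- levels L s1) \sum_(l2 <- levels L s2) E (l1 ++ l2).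
Proof.
elim: s1 E => [|y s1 IHs] E; first by rewrite big_seq1.
rewrite cat_cons !big_levels_cons; apply: eq_bigr => k _.
by rewrite (IHs (fun l => E ((y, k) :: l))).
Qed.

(** Zero levels are discarded so that the condition makes sense for any number of variables and
    survives adding a variable of level 0. *)
Definition has_parts (la v : seq nat) : bool := perm_eq [seq k <- v | (0 < k)%N] la.

Lemma has_parts_rcons0 la v : has_parts la (v ++ [:: 0%N]) = has_parts la v.
Proof. by rewrite /has_parts filter_cat cats0. Qed.

Lemma partition_pos la : is_partition la -> [seq k <- la | (0 < k)%N] = la.
Proof.
case/andP=> _ la0; apply/all_filterP/allP => k kla.
by rewrite lt0n; apply: contraNneq la0 => <-.
Qed.

Lemma filter_pos_sumn (v : seq nat) : sumn [seq k <- v | (0 < k)%N] = sumn v.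
Proof. by elim: v => //= -[|k] v IHv /=; rewrite IHv. Qed.

Lemma has_parts_sumn la v : has_parts la v -> sumn v = sumn la.
Proof. by move=> /perm_sumn; rewrite filter_pos_sumn. Qed.

Lemma has_parts_pad la v : is_partition la -> (size la <= size v)%N ->
  has_parts la v = perm_eq v (pad (size v) la).
Proof.
move=> pla lav; rewrite pad_cat //; apply/idP/idP => [hv|/(perm_filter (fun k => 0 < k)%N)]; last first.
  by rewrite filter_cat (partition_pos pla) !filter_nseq /= cats0.
rewrite -(perm_filterC (fun k => 0 < k)%N v).
apply: perm_cat => //.
have -> : filter (predC (fun k => 0 < k)%N) v = nseq (count (predC (fun k => 0 < k)%N) v) 0%N.
  by elim: v {lav hv} => //= -[|k] v /= ->.
have := perm_size hv; rewrite size_filter => <-.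
by rewrite -(count_predC (fun k => 0 < k)%N v) addKn.
Qed.

Lemma has_parts_size la v : has_parts la v -> (size la <= size v)%N.
Proof. by move=> /perm_size <-; rewrite size_filter count_size. Qed.

Definition restricted_sum c (m : nat) (P : pred (seq nat)) s : K :=
  \sum_(l <- levels (iota 0 m.+1) s | P (map snd l)) lweight t c l.

Lemma HL_P_double N m la (x : 'I_N -> K) : (forall k, t ^+ k.+1 != 1) ->
  is_partition la -> (nth 0 la 0 <= m)%N -> injective x -> (forall i, x i != 0) ->
  HL_P (double_partition la) x t =
  restricted_sum 1 m (has_parts la) [seq x i | i <- enum 'I_N].
Proof.
move=> t1 pla lam xi x0; have [laN|Nla] := leqP (size la) N; last first.
  rewrite /HL_P size_map leqNgt Nla /= /restricted_sum big_seq_cond big_pred0 // => l.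
  apply/negP => /andP[/levels_fst ls /has_parts_size]; rewrite size_map.
  by rewrite -(size_map fst) ls size_map size_enum_ord leqNgt Nla.
have /andP[sla la0] := pla.
have nth_double i : nth 0%N (double_partition la) i = (2 * nth 0 la i)%N.
  have [ila|lai] := ltnP i (size la); first by rewrite (nth_map 0%N).
  by rewrite !nth_default // size_map.
rewrite (@HL_P_levels _ _ t1 _ _ _ [seq (2 * k)%N | k <- iota 0 m.+1]) //; last first.
- move=> _ /mapP[i _ ->]; rewrite nth_double map_f // mem_iota /= add0n ltnS.
  apply: leq_trans lam; have [ila|lai] := ltnP i (size la); last by rewrite nth_default.
  have tr : transitive geq by move=> a b c /= ba cb; apply: leq_trans ba.
  apply: (sorted_leq_nth tr leqnn 0%N sla) => //; rewrite inE; exact: leq_ltn_trans ila.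
- by rewrite map_inj_uniq ?iota_uniq // => k l /eqP; rewrite eqn_pmul2l // => /eqP.
- by rewrite size_map.
- rewrite sorted_map; congr is_true: sla; apply: eq_sorted => k l /=.
  by rewrite leq_pmul2l.
rewrite levels_double big_map; rewrite /restricted_sum big_seq_cond [RHS]big_seq_cond.
apply: eq_big => [l|l _]; last exact: monomial_double.
case: (boolP (l \in _)) => //= /levels_fst ls; have sl : size (map snd l) = N.
  by rewrite size_map -(size_map fst) ls size_map size_enum_ord.
rewrite has_parts_pad ?sl // /double_levels -map_comp.
have -> : pad N (double_partition la) = [seq (2 * k)%N | k <- pad N la].
  rewrite /pad /double_partition /mkseq -map_comp; apply: eq_map => i /=.
  exact: nth_double.
rewrite (map_comp (fun k => (2 * k)%N) snd l); apply/idP/idP => [pp|]; last exact: perm_map.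
apply: perm_map_inj pp => k k' /eqP; by rewrite eqn_pmul2l // => /eqP.
Qed.

End DoubledLevels.

Lemma kap_powers (K : fieldType) (y t : K) (a b : nat) : y != 0 -> (a < b)%N ->
  y ^+ (b - a) != 1 ->
  kap t (y ^+ a) (y ^+ b) = (1 - t * y ^+ (b - a)) / (1 - y ^+ (b - a)) /\
  kap t (y ^+ b) (y ^+ a) = (t - y ^+ (b - a)) / (1 - y ^+ (b - a)).
Proof.
move=> y0 ab yn1; have -> : y ^+ b = y ^+ a * y ^+ (b - a) by rewrite -exprD subnKC // ltnW.
set u := y ^+ a; set v := y ^+ (b - a) in yn1 *.
have u0 : u != 0 by rewrite expf_neq0.
have v1 : 1 - v != 0 by rewrite subr_eq0 eq_sym.
have d1 : u - u * v != 0 by rewrite -{1}[u]mulr1 -mulrBr mulf_neq0.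
have d2 : u * v - u != 0 by rewrite -oppr_eq0 opprB.
by split; rewrite /kap; field; rewrite ?v1 ?d1 ?d2 ?u0.
Qed.

Section PrincipalSums.
Variables (n m : nat).
Hypothesis n0 : (0 < n)%N.
Implicit Types (l : seq (laurent * nat)) (N i j : nat).

Let t : laurent := q ^+ (2 * n).
Let L := iota 0 m.+1.

Definition qpowers N : seq laurent := [seq q ^+ k | k <- iota 0 N].

Lemma qX_inj : injective (fun k : nat => q ^+ k).
Proof. by move=> k l /(@qz_inj k l) []. Qed.

Lemma qX_neq1 (k : nat) : (0 < k)%N -> q ^+ k != 1.
Proof. by move=> k0; rewrite exprnP qz_eq1; lia. Qed.

Lemma vge_qX (k : nat) : vge k (q ^+ k). Proof. exact: vge_qz. Qed.

Lemma vge0_qX (k : nat) : vge 0 (q ^+ k). Proof. by apply: vge_le (vge_qX k). Qed.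

Lemma vge0_exp a (k : nat) : vge 0 a -> vge 0 (a ^+ k).
Proof.
by move=> a0; elim: k => [|k IHk]; [exact: vge1 | rewrite exprS -[0]addr0; exact: vgeM].
Qed.

(** [kap] is homogeneous of degree 0: dividing by the smaller power of q leaves a denominator 1 -
    q^d with d > 0, a unit of Q[[q]]. *)
Lemma vge_kap i j : i != j -> vge 0 (kap t (q ^+ i) (q ^+ j)).
Proof.
have main a b : (a < b)%N -> vge 0 (kap t (q ^+ a) (q ^+ b)) /\ vge 0 (kap t (q ^+ b) (q ^+ a)).
  move=> ab; have ba : (0 < b - a)%N by rewrite subn_gt0.
  have [-> ->] := kap_powers t q_neq0 ab (qX_neq1 ba).
  have u : vge 0 (1 - q ^+ (b - a))^-1 by apply: vge_one_unitV; apply: one_unit_sub_q.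
  split; rewrite -[0]addr0; apply: vgeM => //; apply: vgeB; try exact: vge0_qX.
    exact: vge1.
  by rewrite -exprD; exact: vge0_qX.
by rewrite neq_ltn => /orP[] /main[].
Qed.

Lemma vge_kapl i j a b : i != j -> vge 0 (kapl t (q ^+ i, a) (q ^+ j, b)).
Proof.
move=> ij; rewrite /kapl /=; case: ifP => _; first exact: vge_kap.
by case: ifP => _; [apply: vge_kap; rewrite eq_sym | exact: vge1].
Qed.

Lemma vge_pairs (g : laurent * nat -> laurent * nat -> laurent) l : uniq (map fst l) ->
  {in l &, forall u v, u.1 != v.1 -> vge 0 (g u v)} -> vge 0 (pairs g l).
Proof.
elim: l => [|u l IHl] /=; first by move=> *; exact: vge1.
move=> /andP[ul us] gs; rewrite -[0]addr0; apply: vgeM; last first.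
  by apply: IHl => // v w vl wl; apply: gs; rewrite inE ?vl ?wl orbT.
apply: vge_prod => v vl _; apply: gs; rewrite ?inE ?eqxx ?vl ?orbT //.
by apply: contraNneq ul => ->; exact: map_f.
Qed.

Lemma levels_qpowers N l u : l \in levels L (qpowers N) -> u \in l ->
  exists2 i, (i < N)%N & u = (q ^+ i, u.2).
Proof.
move=> /levels_fst ls ul; have : u.1 \in qpowers N by rewrite -ls map_f.
by case/mapP=> i; rewrite mem_iota /= add0n => iN ui; exists i => //; rewrite -ui -surjective_pairing.
Qed.

Lemma uniq_qpowers N : uniq (qpowers N).
Proof. by rewrite map_inj_uniq ?iota_uniq //; exact: qX_inj. Qed.

Lemma vge_pairs_levels N l : l \in levels L (qpowers N) -> vge 0 (pairs (kapl t) l).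
Proof.
move=> lN; have us := uniq_qpowers N; rewrite -(levels_fst lN) in us.
apply: vge_pairs => // u v ul vl uv.
have [i _ uE] := levels_qpowers lN ul; have [j _ vE] := levels_qpowers lN vl.
by rewrite uE vE; apply: vge_kapl; apply: contraNneq uv => ij; rewrite uE vE ij.
Qed.

Lemma vge_lweight N l c : vge 0 c -> l \in levels L (qpowers N) -> vge 0 (lweight t c l).
Proof.
move=> c0 lN; rewrite -[0]addr0; apply: vgeM; last exact: vge_pairs_levels lN.
apply: vge_prod => u ul _; apply: vge0_exp; rewrite -[0]addr0; apply: vgeM => //.
by have [i _ ->] := levels_qpowers lN ul; apply: vge0_exp; exact: vge0_qX.
Qed.

Section Stability.
Variables (c : laurent) (P : pred (seq nat)).
Hypotheses (c0 : vge 0 c) (P0 : forall v, P (v ++ [:: 0%N]) = P v).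

Let Q N := restricted_sum t c m P (qpowers N).

Lemma vge_restricted_sum N : vge 0 (Q N).
Proof. by apply: vge_sum => l lN _; apply: vge_lweight lN. Qed.

Lemma lweight_rcons l y (k : nat) : lweight t c (l ++ [:: (y, k)]) =
  (c * y ^+ 2) ^+ k * (\prod_(u <- l) ((c * u.1 ^+ 2) ^+ u.2 * kapl t u (y, k))) *
  pairs (kapl t) l.
Proof.
rewrite /lweight pairs_cat big_cat big_seq1 big_split /=.
under [\prod_(u <- l) \prod_(v <- _) _]eq_bigr do rewrite big_seq1.
rewrite big_nil !mulr1 [_ ^+ k * _]mulrC -!mulrA; congr (_ * _).
by rewrite [RHS]mulrCA; congr (_ * _); exact: mulrC.
Qed.

Lemma vge_scaled_power (i k : nat) : vge 0 ((c * (q ^+ i) ^+ 2) ^+ k).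
Proof.
apply: vge0_exp; rewrite -[0]addr0; apply: vgeM => //.
by apply: vge0_exp; exact: vge0_qX.
Qed.

Lemma vge_scaled_powerS (i k : nat) : vge i ((c * (q ^+ i) ^+ 2) ^+ k.+1).
Proof.
rewrite exprS -[i%:Z]addr0; apply: vgeM; last exact: vge_scaled_power.
rewrite -[i%:Z]add0r; apply: vgeM => //; rewrite -exprM.
by apply: vge_le (vge_qX _); rewrite lez_nat leq_pmulr.
Qed.

Lemma vge_kapl_last (i j a b : nat) : (i < j)%N -> vge 0 (kapl t (q ^+ i, a) (q ^+ j, b)).
Proof. by move=> ij; apply: vge_kapl; rewrite neq_ltn ij. Qed.

(** A letter q^i of positive level contributes at least q^i, and its factor with the new letter, (1
    - t q^(N-i))/(1 - q^(N-i)), is 1 modulo q^(N-i); together this gives precision N. Letters of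
    level 0 have factor 1. *)
Lemma cong_lweight_rcons0 N l : l \in levels L (qpowers N) ->
  cong N (lweight t c (l ++ [:: (q ^+ N, 0%N)])) (lweight t c l).
Proof.
move=> lN; rewrite lweight_rcons expr0 mul1r.
apply: congM0; [|exact: vge_pairs_levels lN | | exact: cong_refl].
  apply: vge_prod => u ul _; have [i iN ->] := levels_qpowers lN ul.
  by rewrite -[0]addr0; apply: vgeM; [exact: vge_scaled_power | exact: vge_kapl_last].
apply: cong_prod => [u ul _|u ul _|u ul _]; have [i iN ->] := levels_qpowers lN ul => /=.
- by rewrite -[0]addr0; apply: vgeM; [exact: vge_scaled_power | exact: vge_kapl_last].
- exact: vge_scaled_power.
case: u.2 => [|k]; first by rewrite expr0 mul1r; exact: cong_refl.
rewrite /cong -[X in _ - X]mulr1 -mulrBr /kapl /=.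
have Ni : (0 < N - i)%N by rewrite subn_gt0.
have [-> _] := kap_powers t q_neq0 iN (qX_neq1 Ni).
have iNE : N%:Z = i%:Z + (N - i)%N%:Z by lia.
rewrite iNE; apply: vgeM.
  exact: vge_scaled_powerS.
have frac_sub1 (a b : laurent) : b != 0 -> a / b - 1 = (a - b) / b.
  by move=> b0; rewrite mulrBl mulfV.
rewrite frac_sub1; last exact: one_unit_neq0 (one_unit_sub_q Ni).
rewrite opprD opprK addrACA subrr add0r addrC -{1}[q ^+ _]mul1r -mulrBl.
rewrite -[X in vge X _]addr0; apply: vgeM; last by apply: vge_one_unitV; apply: one_unit_sub_q.
rewrite -[X in vge X _]add0r; apply: vgeM; last exact: vge_qX.
by apply: vgeB; [exact: vge1 | exact: vge0_qX].
Qed.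

(** If the new letter q^N has positive level, the term is divisible by q^N; at level 0 it reproduces
    the term for N letters modulo q^N. *)
Lemma cong_restricted_sumS N : cong N (Q N.+1) (Q N).
Proof.
rewrite /Q /restricted_sum; have -> : qpowers N.+1 = qpowers N ++ [:: q ^+ N].
  by rewrite /qpowers -addn1 iotaD map_cat.
rewrite big_mkcond levels_cat [X in cong _ _ X]big_mkcond; apply: cong_sum => l lN _.
rewrite big_levels_cons; under eq_bigr do rewrite big_seq1.
rewrite /L [iota _ _]/= big_cons map_cat P0 -[X in cong _ _ X]addr0; apply: congD.
  by case: ifP => _; [exact: cong_lweight_rcons0 | exact: cong_refl].
rewrite /cong subr0; apply: vge_sum => -[|k]; first by rewrite mem_iota.
move=> _ _; case: ifP => _; last exact: vge0.
rewrite lweight_rcons -[X in vge X _]addr0; apply: vgeM; last exact: vge_pairs_levels lN.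
rewrite -[X in vge X _]addr0; apply: vgeM; first exact: vge_scaled_powerS.
apply: vge_prod => u ul _; have [i iN ->] := levels_qpowers lN ul.
by rewrite -[0]addr0; apply: vgeM; [exact: vge_scaled_power | exact: vge_kapl_last].
Qed.

Lemma restricted_sum_limit : exists a, forall N, cong N (Q N) a.
Proof. exact: cauchy_converges vge_restricted_sum cong_restricted_sumS. Qed.

End Stability.

Lemma qX_not_root (k : nat) : t ^+ k.+1 != 1.
Proof. by rewrite -exprM; apply: qX_neq1; rewrite !muln_gt0 n0. Qed.

Lemma HL_principal_fin_sum la N : is_partition la -> (nth 0%N la 0 <= m)%N ->
  HL_principal_fin (double_partition la) t N =
  restricted_sum t 1 m (has_parts la) (qpowers N).
Proof.
move=> pla lam; rewrite /HL_principal_fin (HL_P_double qX_not_root pla lam).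
- by rewrite /qpowers -val_enum_ord -map_comp.
- by move=> i j /qX_inj /val_inj.
by move=> i; rewrite expf_neq0 // q_neq0.
Qed.

Lemma cong_HL_principal la N : is_partition la -> (nth 0%N la 0 <= m)%N ->
  cong N (HL_principal_fin (double_partition la) t N) (HL_principal (double_partition la) t).
Proof.
move=> pla lam; have [l ul] := restricted_sum_limit vge1 (has_parts_rcons0 la).
have fl (M : nat) : cong M (HL_principal_fin (double_partition la) t M) l.
  by rewrite HL_principal_fin_sum.
by rewrite /HL_principal (limqE (cong_converges fl)).
Qed.

Lemma restricted_sum_scale la s :
  restricted_sum t q m (has_parts la) s = q ^+ sumn la * restricted_sum t 1 m (has_parts la) s.
Proof.
rewrite /restricted_sum mulr_sumr; apply: eq_bigr => l /has_parts_sumn <-.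
exact: lweight_scale.
Qed.

Definition sort_parts (v : seq nat) : seq nat := sort geq [seq k <- v | (0 < k)%N].

Lemma sort_parts_partition v : is_partition (sort_parts v).
Proof.
rewrite /is_partition /sort_parts sort_sorted; last by move=> a b; apply: leq_total.
by rewrite mem_sort mem_filter.
Qed.

Lemma has_parts_sort la v : is_partition la -> has_parts la v = (la == sort_parts v).
Proof.
move=> /andP[sla _]; rewrite /has_parts /sort_parts; apply/idP/eqP => [pv|->]; last first.
  by rewrite perm_sym perm_sort.
apply: (@sorted_eq _ geq) => //.
- by move=> a b c /= ba cb; apply: leq_trans ba.
- by move=> a b /= /andP[ab ba]; apply/eqP; rewrite eqn_leq ab ba.
- by apply: sort_sorted => a b; apply: leq_total.
by rewrite perm_sym perm_sort.
Qed.

Lemma sort_parts_bound v : all (fun k => k <= m)%N v -> (nth 0%N (sort_parts v) 0 <= m)%N.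
Proof.
move=> /allP vm; have [lt|ge] := ltnP 0 (size (sort_parts v)); last by rewrite nth_default.
have := mem_nth 0%N lt; rewrite mem_sort mem_filter => /andP[_]; exact: vm.
Qed.

(** Modulo q^d every principal specialization may be replaced by its value in d variables. There
    each assignment of levels belongs to exactly one partition, the sorted list of its positive
    levels, so a finite set containing these partitions recovers the full level sum. *)
Lemma has_sum_level_sum a : (forall N : nat, cong N (level_sum t q m (qpowers N)) a) ->
  has_sum (fun la => is_partition la && (nth 0%N la 0 <= m)%N)
    (fun la => q ^+ sumn la * HL_principal (double_partition la) t) a.
Proof.
move=> Fl d; pose S := levels L (qpowers d).
exists [seq sort_parts (map snd l) | l <- S].
  apply/allP => _ /mapP[v vS ->]; rewrite sort_parts_partition sort_parts_bound //.
  by apply/allP => k /(levels_snd vS); rewrite mem_iota.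
move=> s us sL Ss; apply/eqmodqE; apply: cong_trans (Fl d).
apply: (@cong_trans _ (\sum_(la <- s) restricted_sum t q m (has_parts la) (qpowers d))).
  apply: cong_sum => la las _; have /andP[pla lam] := allP sL la las.
  rewrite restricted_sum_scale -HL_principal_fin_sum //.
  apply: congM0; [exact: vge0_qX | | exact: cong_refl | exact/cong_sym/cong_HL_principal].
  by rewrite HL_principal_fin_sum //; apply: vge_restricted_sum; exact: vge1.
rewrite /restricted_sum; under eq_bigr do rewrite big_mkcond.
rewrite exchange_big /level_sum -/L -/S.
rewrite (_ : \sum_(l <- S) _ = \sum_(l <- S) lweight t q l); first exact: cong_refl.
apply: eq_big_seq => v vS; rewrite (bigD1_seq (sort_parts (map snd v))) //=; last first.
  by apply: Ss; apply: map_f.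
rewrite has_parts_sort ?sort_parts_partition // eqxx big_seq_cond big1 ?addr0 // => la.
move=> /andP[las nla]; have /andP[pla _] := allP sL la las.
by rewrite has_parts_sort // (negPf nla).
Qed.

End PrincipalSums.

(** * Limit of the box sums *)

Section UnitApproximation.
Implicit Types (a b : laurent).

(** Carrying both memberships in 1 + q Q[[q]] along with the congruence makes the relation stable
    under products and inverses. *)
Definition approx (d : int) a b : Prop := [/\ one_unit a, one_unit b & cong d a b].

Lemma approx_cong d a b : approx d a b -> cong d a b. Proof. by case. Qed.

Lemma approxM d a a' b b' : approx d a a' -> approx d b b' -> approx d (a * b) (a' * b').
Proof.
move=> [a1 a1' aa] [b1 b1' bb]; split; try exact: one_unitM.
by apply: congM0 => //; exact: one_unit_vge0.
Qed.

Lemma approxV d a b : approx d a b -> approx d a^-1 b^-1.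
Proof. by move=> [a1 b1 ab]; split; [exact: one_unitV | exact: one_unitV | exact: congV]. Qed.

Lemma approx_prod d (I : Type) (r : seq I) (P : pred I) (F G : I -> laurent) :
  (forall i, P i -> approx d (F i) (G i)) ->
  approx d (\prod_(i <- r | P i) F i) (\prod_(i <- r | P i) G i).
Proof.
move=> FG; elim/big_ind2: _ => //; last by move=> a a' b b'; exact: approxM.
by split; [exact: one_unit1 | exact: one_unit1 | exact: cong_refl].
Qed.

Definition pochinf (tau c : int) : laurent := qpoch_inf (q ^ c) (q ^ tau).

Lemma approx_poch (d k : nat) (tau c : int) : 0 < tau -> 0 < c -> (d <= k)%N ->
  approx d (poch q tau c k) (pochinf tau c).
Proof.
case: tau c => // [tau] [] // c; rewrite !ltz_nat => tau0 c0 dk.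
by split; [exact: one_unit_qpoch | exact: one_unit_qpoch_inf | exact: cong_qpoch_inf].
Qed.

(** Kept in the unsimplified shape p/(p p), so that it approximates [frac] factor by factor. *)
Definition fracinf (tau c : int) : laurent := pochinf tau c / (pochinf tau c * pochinf tau c).

Lemma approx_frac (d R k k' : nat) (tau c : int) : 0 < tau -> 0 < c ->
  (d <= 2 * R)%N -> (d <= k)%N -> (d <= k')%N ->
  approx d (frac q tau c R k k') (fracinf tau c).
Proof.
move=> t0 c0 dR dk dk'; apply: approxM; first exact: approx_poch.
by apply: approxV; apply: approxM; exact: approx_poch.
Qed.

Lemma vge_prod_exp (I : Type) (r : seq I) (e : I -> int) (F : I -> laurent) :
  (forall i, vge (e i) (F i)) -> vge (\sum_(i <- r) e i) (\prod_(i <- r) F i).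
Proof.
move=> eF; elim: r => [|i r IHr]; first by rewrite !big_nil; exact: vge1.
by rewrite !big_cons; exact: vgeM.
Qed.

Lemma vge_det n (M : 'I_n -> 'I_n -> laurent) (g : 'I_n -> laurent) (e : 'I_n -> int) :
  (forall i j, vge (e i) (g i * M i j)) ->
  vge (\sum_i e i) ((\prod_i g i) * \det (\matrix_(i < n, j < n) M i j)).
Proof.
move=> eM; rewrite mulr_sumr; apply: vge_sum => s _ _.
rewrite mulrCA -[X in vge X _]add0r; apply: vgeM.
  by case: odd_perm; [apply: vgeN | ]; exact: vge1.
rewrite -big_split; apply: vge_prod_exp => i; rewrite mxE; exact: eM.
Qed.

Lemma exists_vge_det n (M : 'I_n -> 'I_n -> laurent) :
  (forall i j, exists e, vge e (M i j)) -> exists e, vge e (\det (\matrix_(i < n, j < n) M i j)).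
Proof.
move=> eM; have [e Me] : exists e, forall i j, vge e (M i j).
  have /choice[h hM] : forall p : 'I_n * 'I_n, exists e, vge e (M p.1 p.2).
    by move=> p; exact: eM.
  exists (- \sum_p `|h p|) => i j; apply: vge_le (hM (i, j)).
  rewrite (bigD1 (i, j)) //= opprD.
  have : 0 <= \sum_(p | p != (i, j)) `|h p| by apply: sumr_ge0.
  by move: (h (i, j)) (\sum_(p | _) _) => k S; lia.
exists (\sum_(i < n) e); rewrite -[\det _]mul1r -[1](@big1_eq _ _ *%R _ (index_enum 'I_n) predT).
by apply: vge_det => i j; rewrite mul1r.
Qed.

(* The constants [C] below are uniform in [R]: as |r_i| grows the quadratic
   exponents of [A] outweigh the loss of precision of [u]. *)
Lemma cong_box_sum n R (A u : {ffun 'I_n -> 'I_(2 * R).+1} -> laurent) (U : laurent) (C : int) :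
  (forall f : {ffun 'I_n -> 'I_(2 * R).+1}, vge (\sum_i `|offset R (f i)| - C) (A f)) ->
  (forall (d : nat) (f : {ffun 'I_n -> 'I_(2 * R).+1}), (d <= 2 * R)%N -> (forall i, (d <= f i)%N && (d <= 2 * R - f i)%N) -> cong d (u f) U) ->
  cong (R%:Z - C) (\sum_f A f * u f) (\sum_f A f * U).
Proof.
move=> eA uU; apply: cong_sum => f _ _; rewrite /cong -mulrBr.
pose M := (\max_i `|offset R (f i)|)%N.
have MR i : (`|offset R (f i)| <= M)%N by exact: leq_bigmax.
have MS : M%:Z <= \sum_i `|offset R (f i)|.
  rewrite /M; elim/big_rec2: _ => //= i a b _ ba.
  by rewrite /maxn; case: ifP => _; have := normr_ge0 (offset R (f i)); lia.
have fR i : (f i <= 2 * R)%N by rewrite -ltnS ltn_ord.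
have MR' : (M <= R)%N.
  by apply/bigmax_leqP => i _; have := fR i; rewrite /offset; lia.
clearbody M.
have dU : cong (R - M)%N (u f) U.
  apply: uU => [|i]; first by lia.
  by have := MR i; have := fR i; rewrite /offset; move: (nat_of_ord (f i)) => k; lia.
apply: vge_le (vgeM (eA f) dU); move: MS; move: (\sum_i _) => S; lia.
Qed.

(** With B = |b| + 1, the square of B - |r| being nonnegative gives r^2 >= 2B|r| - B^2. This absorbs
    the linear term and leaves |r| over. *)
Lemma quadratic_bound (a b c r : int) : 1 <= a ->
  `|r| - ((`|b| + 1) ^+ 2 + `|c|) <= a * r ^+ 2 + b * r + c.
Proof.
move=> a1; have s2 : r ^+ 2 = `|r| ^+ 2 by rewrite real_normK ?num_real.
have h1 : - (`|b| * `|r|) <= b * r by rewrite -normrM; lia.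
have h2 : `|r| ^+ 2 <= a * `|r| ^+ 2 by rewrite ler_peMl // exprn_ge0.
have h3 : 0 <= (`|b| + 1 - `|r|) ^+ 2 by exact: sqr_ge0.
have h4 : 0 <= `|b| by []. have h5 : 0 <= `|r| by [].
rewrite s2; nia.
Qed.

End UnitApproximation.

Lemma q_tor (d : int) : d != 0 -> q ^ d != 1. Proof. by rewrite qz_eq1. Qed.

Section PairUnits.
Variables (n : nat) (zeta tau : int) (a b : 'I_n -> int).

Definition pair_unit_limit : laurent :=
  \prod_(i < n) \prod_(j < n | (i < j)%N)
    (fracinf tau (zeta + a i + a j) * fracinf tau (zeta + a i + b j) *
     fracinf tau (zeta + b i + a j) * fracinf tau (zeta + b i + b j)).

Lemma approx_pair_unit (d R : nat) (f : 'I_n -> nat) : 0 < tau ->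
  (forall i j, 0 < zeta + a i + a j) -> (forall i j, 0 < zeta + a i + b j) ->
  (forall i j, 0 < zeta + b i + b j) -> (d <= 2 * R)%N ->
  (forall i, d <= f i)%N -> (forall i, d <= 2 * R - f i)%N ->
  approx d (pair_unit q R zeta tau a b f) pair_unit_limit.
Proof.
move=> t0 aa ab bb dR d1 d2; apply: approx_prod => i _; apply: approx_prod => j _.
by apply: approxM; [apply: approxM; [apply: approxM|]|]; apply: approx_frac; rewrite // addrAC.
Qed.

End PairUnits.

Section BoxLimits.
Variables (n m : nat).
Hypothesis n0 : (0 < n)%N.
Implicit Types (R : nat) (i j : 'I_n).

Let kap : int := (m + n + 1)%N.
Let tau1 : int := (2 * n)%N.
Let tau2 : int := kap + kap.
Let a1 i : int := n%:Z - i%:Z - 1.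
Let b1 i : int := n%:Z + i%:Z.
Let a2 i : int := kap - i.+1%:Z.
Let b2 i : int := kap + i.+1%:Z.

Definition unit1_limit : laurent :=
  (\prod_(i < n) (fracinf tau1 tau1 /
     (pochinf tau1 (1 + 2 * a1 i) * pochinf tau1 (1 + 2 * b1 i)))) *
  pair_unit_limit 1 tau1 a1 b1.

Definition unit2_limit : laurent :=
  (\prod_(i < n) (fracinf tau2 tau2 *
     (pochinf tau2 (2 * a2 i) / pochinf tau2 (2 * a2 i)) *
     (pochinf tau2 (2 * b2 i) / pochinf tau2 (2 * b2 i)) /
     (pochinf kap (a2 i) * pochinf kap (b2 i)))) *
  pair_unit_limit 0 tau2 a2 b2.

Lemma approx_unit1 (d R : nat) (f : 'I_n -> nat) : (d <= 2 * R)%N ->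
  (forall i, (d <= f i)%N && (d <= 2 * R - f i)%N) -> approx d (unit1 q R f) unit1_limit.
Proof.
move=> dR df; have d1 i : (d <= f i)%N by case/andP: (df i).
have d2 i : (d <= 2 * R - f i)%N by case/andP: (df i).
have t0 : 0 < tau1 by rewrite /tau1; lia.
have pa i : 0 <= a1 i by have := ltn_ord i; rewrite /a1; lia.
have pb i : 0 <= b1 i by rewrite /b1; lia.
apply: approxM; last first.
  by apply: approx_pair_unit => // i j; have := pa i; have := pb i; have := pa j; have := pb j; rewrite /a1 /b1; lia.
apply: approx_prod => i _; have := pa i; have := pb i; rewrite /a1 /b1 => *.
by repeat first [apply: approx_poch => //; lia | apply: approxM | apply: approxV].
Qed.

Lemma approx_unit2 (d R : nat) (f : 'I_n -> nat) : (d <= 2 * R)%N ->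
  (forall i, (d <= f i)%N && (d <= 2 * R - f i)%N) -> approx d (unit2 q m R f) unit2_limit.
Proof.
move=> dR df; have d1 i : (d <= f i)%N by case/andP: (df i).
have d2 i : (d <= 2 * R - f i)%N by case/andP: (df i).
have t0 : 0 < tau2 by rewrite /tau2 /kap; lia.
have k0 : 0 < kap by rewrite /kap; lia.
have pa i : 0 < a2 i by have := ltn_ord i; rewrite /a2 /kap; lia.
have pb i : 0 < b2 i by rewrite /b2 /kap; lia.
apply: approxM; last first.
  by apply: approx_pair_unit => // i j; have := pa i; have := pb i; have := pa j; have := pb j; rewrite /a2 /b2; lia.
apply: approx_prod => i _; have := pa i; have := pb i; rewrite /a2 /b2 => *.
by repeat first [apply: approx_poch => //; lia | apply: approxM | apply: approxV].
Qed.

(** The claim is a component of [approx], whose hypotheses hold trivially at precision 0 and R =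
    0. *)
Lemma one_unit_unit1_limit : one_unit unit1_limit.
Proof. by have [] : approx 0%N (unit1 q 0 (fun _ : 'I_n => 0%N)) unit1_limit by apply: approx_unit1. Qed.

Lemma one_unit_unit2_limit : one_unit unit2_limit.
Proof. by have [] : approx 0%N (unit2 q m 0 (fun _ : 'I_n => 0%N)) unit2_limit by apply: approx_unit2. Qed.

Lemma uniform_quadratic_bound (a b c : 'I_n -> 'I_n -> int) : (forall i j, 1 <= a i j) ->
  exists C : nat, forall i j (r : int), `|r| - C%:Z <= a i j * r ^+ 2 + b i j * r + c i j.
Proof.
move=> age1; pose B i j := ((`|b i j| + 1) ^ 2 + `|c i j|)%N.
exists (\max_i \max_j B i j)%N => i j r.
have le : (B i j <= \max_i \max_j B i j)%N.
  by apply: leq_trans (leq_bigmax i); apply: leq_bigmax.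
apply: le_trans (quadratic_bound (b i j) (c i j) r (age1 i j)); rewrite lerD2l lerN2.
have -> : (`|b i j| + 1) ^+ 2 + `|c i j| = (B i j)%:Z by rewrite /B; lia.
by rewrite lez_nat.
Qed.

Lemma vge_box_term (gauss : 'I_n -> int -> laurent) (row : 'I_n -> int -> nat -> laurent) (C : nat) :
  (forall i j (r : int), vge (`|r| - C%:Z) (gauss i r * row i r j)) ->
  forall (R : nat) (f : {ffun 'I_n -> 'I_(2 * R).+1}),
  vge (\sum_i `|offset R (f i)| - (n * C)%N%:Z)
    ((\prod_i gauss i (offset R (f i))) * \det (\matrix_(i < n, j < n) row i (offset R (f i)) j)).
Proof.
move=> gr R f; have -> : \sum_i `|offset R (f i)| - (n * C)%N%:Z =
    \sum_i (`|offset R (f i)| - C%:Z).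
  by rewrite sumrB sumr_const card_ord; congr (_ - _); rewrite -mulr_natr natz PoszM mulrC.
by apply: vge_det => i j.
Qed.

Lemma vge_term1 : exists C : nat, forall i j (r : int),
  vge (`|r| - C%:Z) (gauss1 q m i r * row1 q i r j).
Proof.
have a0 (i j : 'I_n) : 1 <= kap * tau1 by rewrite /kap /tau1; nia.
have [C1 H1] := uniform_quadratic_bound
  (fun i j => - kap * (2 * i%:Z + 1) - j.+1%:Z * tau1) (fun i j => j.+1%:Z * i%:Z) a0.
have [C2 H2] := uniform_quadratic_bound
  (fun i j => - kap * (2 * i%:Z + 1) + j.+1%:Z * tau1) (fun i j => - (j.+1%:Z * (i%:Z + 1))) a0.
exists (maxn C1 C2) => i j r; rewrite /gauss1 /row1 mulrBr -!(xD q_neq0).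
apply: vgeB; apply: vge_le (vge_qz _).
  apply: le_trans (le_trans (H1 i j r) _); first by lia.
  by rewrite -/kap -/tau1 le_eqVlt; apply/orP; left; apply/eqP; ring.
apply: le_trans (le_trans (H2 i j r) _); first by lia.
by rewrite -/kap -/tau1 le_eqVlt; apply/orP; left; apply/eqP; ring.
Qed.

Lemma vge_term2 : exists C : nat, forall i j (r : int),
  vge (`|r| - C%:Z) (gauss2 q m i r * row2 q m i r j).
Proof.
have a0 (i j : 'I_n) : 1 <= n%:Z * tau2 by rewrite /tau2 /kap; nia.
have [C1 H1] := uniform_quadratic_bound
  (fun i j => - n%:Z * (2 * i.+1%:Z) - kap - j%:Z * tau2) (fun i j => j%:Z * i.+1%:Z) a0.
have [C2 H2] := uniform_quadratic_bound
  (fun i j => - n%:Z * (2 * i.+1%:Z) - kap + j.+1%:Z * tau2) (fun i j => - (j.+1%:Z * i.+1%:Z)) a0.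
exists (maxn C1 C2) => i j r; rewrite /gauss2 /row2 mulrBr -!(xD q_neq0).
apply: vgeB; apply: vge_le (vge_qz _).
  apply: le_trans (le_trans (H1 i j r) _); first by lia.
  by rewrite -/kap -/tau2 le_eqVlt; apply/orP; left; apply/eqP; ring.
apply: le_trans (le_trans (H2 i j r) _); first by lia.
by rewrite -/kap -/tau2 le_eqVlt; apply/orP; left; apply/eqP; ring.
Qed.

Definition det1 : laurent := \det (\matrix_(i < n, j < n) row1 q i 0 j).
Definition det2 : laurent := \det (\matrix_(i < n, j < n) row2 q m i 0 j).

(** For R = 0 the alphabet is empty and the box formula has value 1; a zero determinant, with
    inverse 0, would make every term of the box sum 0. *)
Lemma det1_neq0 : det1 != 0.
Proof.
apply/eqP => d0; have := level_sum_box q_neq0 q_tor m 0 n0.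
rewrite muln0 /box_sum /level_sum big_seq1 /lweight big_nil mulr1 -/det1 d0 invr0.
under eq_bigr do rewrite mulr0 mul0r.
by rewrite sumr_const mul0rn => /eqP; rewrite oner_eq0.
Qed.

Lemma det2_neq0 : det2 != 0.
Proof.
apply/eqP => d0; have := qpoch_box q_neq0 q_tor m 0 n0.
rewrite muln0 /box_sum /qpoch big_geq // -/det2 d0 invr0.
under eq_bigr do rewrite mulr0 mul0r.
by rewrite sumr_const mul0rn => /eqP; rewrite oner_eq0.
Qed.

Lemma exists_vge_dets : exists e : nat, vge (- e%:Z) det1 /\ vge (- e%:Z) det2.
Proof.
have sub (d e : int) : exists e', vge e' (q ^ d - q ^ e).
  exists (- (`|d| + `|e|)); apply: vgeB; apply: vge_le (vge_qz _); lia.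
have [e1 v1] : exists e, vge e det1 by apply: exists_vge_det => i j; exact: sub.
have [e2 v2] : exists e, vge e det2 by apply: exists_vge_det => i j; exact: sub.
by exists (`|e1| + `|e2|)%N; split; [apply: vge_le v1 | apply: vge_le v2]; lia.
Qed.

(** With S the common sum, [det1 * a] is close to [S * unit1_limit], and [det2] times the Pochhammer
    symbol is close to [S * unit2_limit]. Cross-multiplying eliminates S without computing it. *)
Theorem box_limit (a : laurent) :
  (forall N : nat, cong N (level_sum (q ^+ (2 * n)) q m (qpowers N)) a) ->
  det1 * a * unit2_limit =
  det2 * qpoch_inf (q ^+ (m + n + 1)) (q ^+ (2 * (m + n + 1))) * unit1_limit.
Proof.
move=> Fa; have [C1 v1] := vge_term1; have [C2 v2] := vge_term2.
have [e [e1 e2]] := exists_vge_dets.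
have u1 := one_unit_vge0 one_unit_unit1_limit; have u2 := one_unit_vge0 one_unit_unit2_limit.
apply/eqP; rewrite -subr_eq0; apply/eqP/vge_eq0 => d.
(* [n * C1] and [n * C2] make up for the losses in the two box sums, and [e] for the possible poles
   of the determinants. *)
pose R := (d + n * C1 + n * C2 + e)%N.
have S1 := cong_box_sum (R := R) (vge_box_term v1 (R := R))
  (u := fun f => unit1 q R (fun i : 'I_n => f i))
  (fun d f dR df => approx_cong (approx_unit1 dR df)).
have S2 := cong_box_sum (R := R) (vge_box_term v2 (R := R))
  (u := fun f => unit2 q m R (fun i : 'I_n => f i))
  (fun d f dR df => approx_cong (approx_unit2 dR df)).
have cancel (x y z : laurent) : x != 0 -> x * (y / x * z) = y * z.
  by move=> x0; rewrite mulrA mulrCA mulfV // mulr1.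
have E1 := level_sum_box q_neq0 q_tor m R n0.
have {}E1 := congr1 (fun x => det1 * x) E1.
move: E1; rewrite /box_sum -/det1 [X in _ = X -> _]mulr_sumr; under [X in _ = X -> _]eq_bigr do rewrite (cancel det1) ?det1_neq0 //.
move=> E1.
have E2 := qpoch_box q_neq0 q_tor m R n0.
have {}E2 := congr1 (fun x => det2 * x) E2.
move: E2; rewrite /box_sum -/det2 [X in _ = X -> _]mulr_sumr; under [X in _ = X -> _]eq_bigr do rewrite (cancel det2) ?det2_neq0 //.
move=> E2.
rewrite -E1 -mulr_suml (box_sums_eq q_neq0) in S1.
rewrite -E2 -mulr_suml in S2.
set S := \sum_f _ in S1 S2.
have cM (k l : int) (x y z : laurent) : cong k x y -> vge l z -> (d%:Z <= k + l)%R ->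
    cong d (x * z) (y * z).
  by move=> xy vz kl; rewrite /cong -mulrBl; apply: vge_le kl _; apply: vgeM.
have RN : ((d + e)%N <= 2 * n * R)%N by rewrite /R; nia.
apply: (@cong_trans _ (det1 * level_sum (q ^+ (2 * n)) q m (qpowers (2 * n * R)) * unit2_limit)).
  rewrite ![det1 * _]mulrC -!(mulrA _ det1); apply: (cM _ _ _ _ _ (cong_sym (Fa (2 * n * R)%N)) (vgeM e1 u2) _).
  by lia.
apply: (@cong_trans _ (S * unit1_limit * unit2_limit)).
  by apply: (cM _ _ _ _ _ S1 u2 _); rewrite /R; lia.
rewrite mulrAC; apply: cong_sym.
apply: (@cong_trans _ (det2 * qpoch (q ^+ (m + n + 1)) (q ^+ (2 * (m + n + 1))) (2 * n * R) * unit1_limit)); last first.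
  by apply: (cM _ _ _ _ _ S2 u1 _); rewrite /R; lia.
rewrite ![det2 * _]mulrC -!(mulrA _ det2).
have k1 : (0 < m + n + 1)%N by lia.
have k2 : (0 < 2 * (m + n + 1))%N by lia.
apply: (cM _ _ _ _ _ (cong_sym (cong_qpoch_inf k1 k2 (leqnn (2 * n * R)))) (vgeM e2 u1) _).
by lia.
Qed.

End BoxLimits.

(** * Identification of the limit *)

Lemma qpoch_inf_shift (i k : nat) : (0 < i)%N -> (0 < k)%N ->
  qpoch_inf (q ^+ i) (q ^+ k) = (1 - q ^+ i) * qpoch_inf (q ^+ (i + k)) (q ^+ k).
Proof.
move=> i0 k0; apply/eqP; rewrite -subr_eq0; apply/eqP/vge_eq0 => d.
apply: (@cong_trans _ (qpoch (q ^+ i) (q ^+ k) d.+1)).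
  by apply: cong_sym; apply: cong_qpoch_inf.
rewrite /qpoch big_nat_recl // expr0 mulr1.
under eq_bigr do rewrite exprS mulrA -exprD.
have ik : (0 < i + k)%N by rewrite addn_gt0 i0.
apply: congM0; [| |exact: cong_refl|exact: cong_qpoch_inf].
  by apply: one_unit_vge0; apply: one_unit_sub_q.
by apply: one_unit_vge0; apply: one_unit_qpoch_inf.
Qed.

Lemma mulf_cancel2 (K : fieldType) (a x y : K) : x != 0 -> y != 0 ->
  a * x * y / (y * x) = a.
Proof. by move=> x0 y0; field; rewrite x0 y0. Qed.

Lemma theta_shift_inv (i k : nat) : (0 < i < k)%N ->
  theta (q ^+ i) (q ^+ k) /
    (qpoch_inf (q ^+ (k - i)) (q ^+ k) * qpoch_inf (q ^+ (k + i)) (q ^+ k)) = 1 - q ^+ i.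
Proof.
move=> /andP[i0 ik]; have k0 : (0 < k)%N by apply: leq_ltn_trans ik.
rewrite /theta q_div ?(ltnW ik) // qpoch_inf_shift // [(i + k)%N]addnC.
have nz l : (0 < l)%N -> qpoch_inf (q ^+ l) (q ^+ k) != 0.
  by move=> l0; apply/one_unit_neq0/one_unit_qpoch_inf.
by apply: mulf_cancel2; apply: nz; rewrite ?subn_gt0 // addn_gt0 k0.
Qed.

(** A multiple of k is either an odd multiple, counted by the first factor, or a multiple of 2k,
    counted by the second. *)
Lemma qpoch_inf_double (k : nat) : (0 < k)%N ->
  qpoch_inf (q ^+ k) (q ^+ (2 * k)) * qpoch_inf (q ^+ (2 * k)) (q ^+ (2 * k)) =
  qpoch_inf (q ^+ k) (q ^+ k).
Proof.
move=> k0; have k20 : (0 < 2 * k)%N by lia.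
apply: euler_unique (eulerM (euler_qpoch_inf k0 k20) (euler_qpoch_inf_self k20)) _.
apply: eq_euler (euler_qpoch_inf_self k0) => l l0.
apply/esym; have [/dvdnP[c lE]|nd] := boolP (k %| l)%N; last first.
  rewrite [X in (_ + X)%N](_ : _ = 0%N) ?addn0; last first.
    by apply/eqP; rewrite eqb0; apply: contra nd; apply: dvdn_trans; rewrite dvdn_mull.
  apply/eqP; rewrite eqb0; apply: contra nd => /andP[kl].
  move/(dvdn_trans (dvdn_mull 2 (dvdnn k))) => h.
  by rewrite -(subnK kl) dvdn_add.
have -> : (2 * k %| l)%N = ~~ odd c by rewrite lE dvdn_pmul2r // dvdn2.
have c0 : (0 < c)%N by case: c lE l0 => // ->.
have -> : (k <= l)%N by rewrite lE leq_pmull.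
have -> : (l - k = c.-1 * k)%N by rewrite lE -{2}[k]mul1n -mulnBl subn1.
by rewrite dvdn_pmul2r // dvdn2 -(prednK c0) /=; case: odd.
Qed.

Lemma prod_triangle (K : comNzRingType) n (G : nat -> nat -> K) :
  \prod_(i < n) \prod_(j < n | (i < j)%N) G i.+1 j.+1 =
  \prod_(1 <= j < n.+1) \prod_(1 <= i < j) G i j.
Proof.
rewrite big_add1 big_mkord (exchange_big_dep predT) //=; apply: eq_bigr => j _.
rewrite big_add1 /= big_mkord (big_ord_widen n (fun i => G i.+1 j.+1)) //.
exact: ltnW.
Qed.

Section Limit.
Variables (n m : nat).
Hypothesis n0 : (0 < n)%N.

Let k := (m + n + 1)%N.
Let T := qpoch_inf (q ^+ (2 * k)) (q ^+ (2 * k)).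

(** What remains of the theta functions once the units have been removed; it does not involve m. *)
Definition shift_constant : laurent :=
  (\prod_(1 <= i < n.+1) (1 - q ^+ i)) *
  \prod_(1 <= j < n.+1) \prod_(1 <= i < j) ((1 - q ^+ (j - i)) * (1 - q ^+ (i + j))).

Lemma divff_half (x : laurent) : x != 0 -> x / (x * x) = x^-1.
Proof. by move=> x0; rewrite invfM mulrA mulfV // mul1r. Qed.

Lemma unit2_limitE : unit2_limit n m = T ^- n *
  (\prod_(1 <= i < n.+1)
     (qpoch_inf (q ^+ (k - i)) (q ^+ k) * qpoch_inf (q ^+ (k + i)) (q ^+ k))^-1) *
  \prod_(1 <= j < n.+1) \prod_(1 <= i < j)
     ((qpoch_inf (q ^+ (2 * k - (j - i))) (q ^+ (2 * k)) *
        qpoch_inf (q ^+ (2 * k + (j - i))) (q ^+ (2 * k)))^-1 *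
      (qpoch_inf (q ^+ (2 * k - (i + j))) (q ^+ (2 * k)) *
        qpoch_inf (q ^+ (2 * k + (i + j))) (q ^+ (2 * k)))^-1).
Proof.
have k2 : k%:Z + k%:Z = (2 * k)%N by lia.
have k0 : (0 < k)%N by rewrite /k; lia.
have nz (c l : nat) : (0 < c)%N -> (0 < l)%N -> pochinf l c != 0.
  by move=> c0 l0; apply: one_unit_neq0; apply: one_unit_qpoch_inf.
have fracE (c : int) (l : nat) : (0 < l)%N -> c = l -> fracinf (2 * k)%N c = (pochinf (2 * k)%N l)^-1.
  by move=> l0 ->; apply: divff_half; apply: nz => //; lia.
rewrite /unit2_limit /pair_unit_limit -/k k2 /=; congr (_ * _).
  rewrite big_add1 big_mkord /= -[in T ^- n](card_ord n) -exprVn -prodr_const -big_split.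
  apply: eq_bigr => i _; have ik := ltn_ord i.
  have -> : k%:Z - i.+1%:Z = (k - i.+1)%N by rewrite /k; lia.
  rewrite /fracinf !mulfV ?mulr1 ?divff_half //; try by apply: nz; rewrite /k; lia.
etransitivity; last exact: prod_triangle.
apply: eq_bigr => i _; apply: eq_bigr => j ij.
have := ltn_ord j => jn.
rewrite (fracE _ (2 * k - (i.+1 + j.+1))%N); [|rewrite /k; lia..].
rewrite (fracE _ (2 * k + (j.+1 - i.+1))%N); [|rewrite /k; lia..].
rewrite (fracE _ (2 * k - (j.+1 - i.+1))%N); [|rewrite /k; lia..].
rewrite (fracE _ (2 * k + (i.+1 + j.+1))%N); [|rewrite /k; lia..].
rewrite !invfM /pochinf.
have shuffle (K : fieldType) (x y z w : K) : x * y * z * w = z * y * (x * w) by ring.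
exact: shuffle.
Qed.

(** Each theta function meets two Pochhammer symbols of [unit2_limit] and leaves a single factor
    free of m, by [theta_shift_inv]. The powers of [T] cancel after one of them is split off from
    (q^k; q^k)_inf. So only (q^k; q^(2k))_inf still depends on m. *)
Lemma first_product_unit2 :
  first_product n m * unit2_limit n m =
  qpoch_inf (q ^+ 2) (q ^+ 2) / qpoch_inf q q ^+ (n + 1) * shift_constant *
  qpoch_inf (q ^+ k) (q ^+ (2 * k)).
Proof.
have kE : (2 * m + 2 * n + 2 = 2 * k)%N by rewrite /k; lia.
have k0 : (0 < k)%N by rewrite /k; lia.
rewrite /first_product unit2_limitE /= kE mulKn // -(qpoch_inf_double k0) -/T.
have T0 : T != 0 by apply: one_unit_neq0; apply: one_unit_qpoch_inf; lia.
have abs (K : fieldType) (p2 c t p1 a1 a2 b1 b2 : K) (N : nat) : t != 0 ->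
    p2 * (c * t) * t ^+ (N.+1 - 1) / p1 * a1 * a2 * (t ^- N.+1 * b1 * b2) =
    p2 / p1 * (a1 * b1) * (a2 * b2) * c.
  move=> t0; have := mulfV (expf_neq0 N.+1 t0); rewrite subn1 /= {1}exprS.
  set v := t ^- N.+1; set u := t ^+ N => tuv.
  by transitivity (p2 / p1 * a1 * b1 * (a2 * b2) * c * (t * u * v)); [ring | rewrite tuv; ring].
rewrite -(prednK n0) abs // prednK // /shift_constant; congr (_ * _).
rewrite -mulrA; congr (_ * (_ * _)).
  rewrite -big_split; apply: eq_big_nat => i /andP[i0 ik]; apply: theta_shift_inv.
  by rewrite i0 /k; lia.
rewrite -big_split; apply: eq_big_nat => j /andP[j0 jn].
rewrite -big_split; apply: eq_big_nat => i /andP[i0 ij].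
have ji : (0 < j - i < 2 * k)%N by rewrite /k; lia.
have ij' : (0 < i + j < 2 * k)%N by rewrite /k; lia.
by rewrite -(theta_shift_inv ji) -(theta_shift_inv ij') /= mulrACA.
Qed.

End Limit.

Lemma det2_const n m m' : det2 n m = det2 n m'.
Proof. by congr (\det _); apply/matrixP => i j; rewrite !mxE /row2 !mulr0. Qed.

(** For m = 0 the other form of the product is empty. *)
Lemma first_product0 n : (0 < n)%N -> first_product n 0 = 1.
Proof.
move=> n0; rewrite (@product_sides_eq 0 n n0).
by rewrite !expr0 invr1 !big_geq // !mulr1.
Qed.

(** [det1] and [unit1_limit] involve only the ratio q^(2n), and [det2] only r = 0, so none of them
    depends on m. Comparing the limit relations for m and for 0, where the level sum is 1, removes
    them all; the Pochhammer symbol that remains is the one in [first_product_unit2]. *)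
Theorem level_sum_limit n m (a : laurent) : (0 < n)%N ->
  (forall N : nat, cong N (level_sum (q ^+ (2 * n)) q m (qpowers N)) a) -> a = first_product n m.
Proof.
move=> n0 aP.
have lim0 (N : nat) : cong N (level_sum (q ^+ (2 * n)) q 0 (qpowers N)) 1.
  by rewrite level_sum0; exact: cong_refl.
have Em := box_limit n0 aP; have E0 := box_limit n0 lim0.
have Pm := first_product_unit2 m n0; have P0 := first_product_unit2 0 n0.
rewrite first_product0 // mul1r in P0; rewrite mulr1 in E0.
have d1 : det1 n != 0 by apply: (det1_neq0 0).
have u m' : unit2_limit n m' != 0 by apply: one_unit_neq0; apply: one_unit_unit2_limit.
have compare (K : fieldType) (D D' V p F U U0 C C0 a' : K) : D != 0 -> U != 0 -> U0 != 0 ->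
    D * a' * U = D' * C * V -> D * U0 = D' * C0 * V -> F * U = p * C -> U0 = p * C0 -> a' = F.
  move=> D0 Un U0n Ea E FU UE.
  have C0n : C0 != 0 by apply: contraNneq U0n => C00; rewrite UE C00 mulr0.
  apply: (mulfI (mulf_neq0 D0 (mulf_neq0 Un C0n))).
  transitivity (D * a' * U * C0); first by ring.
  rewrite Ea; transitivity (C * (D' * C0 * V)); first by ring.
  by rewrite -E UE; transitivity (D * C0 * (p * C)); [ring | rewrite -FU; ring].
by apply: compare d1 (u m) (u 0%N) Em _ Pm P0; rewrite -(det2_const n m 0) in E0.
Qed.

Theorem theorem1p2 (m n : nat) (hm : (0 < m)%N) (hn : (0 < n)%N) :
  let kappa := (2 * m + 2 * n + 2)%N in
  let Lambda := fun la : seq nat => is_partition la && (nth 0%N la 0 <= m)%N in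
  let t := q ^+ (2 * n) in
  let rhs1 :=
    qpoch_inf (q ^+ 2) (q ^+ 2)
      * qpoch_inf (q ^+ (kappa %/ 2)) (q ^+ (kappa %/ 2))
      * qpoch_inf (q ^+ kappa) (q ^+ kappa) ^+ (n - 1)
      / qpoch_inf q q ^+ (n + 1)
      * (\prod_(1 <= i < n.+1) theta (q ^+ i) (q ^+ (kappa %/ 2)))
      * \prod_(1 <= j < n.+1) \prod_(1 <= i < j)
          (theta (q ^+ (j - i)) (q ^+ kappa) * theta (q ^+ (i + j)) (q ^+ kappa)) in
  let rhs2 :=
    qpoch_inf (q ^+ kappa) (q ^+ kappa) ^+ m
      / qpoch_inf q q ^+ m
      * (\prod_(1 <= i < m.+1) theta (q ^+ (i + 1)) (q ^+ kappa))
      * \prod_(1 <= j < m.+1) \prod_(1 <= i < j)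
          (theta (q ^+ (j - i)) (q ^+ kappa) * theta (q ^+ (i + j + 1)) (q ^+ kappa)) in
  [/\ forall la, Lambda la ->
        converges_to (HL_principal_fin (double_partition la) t)
                     (HL_principal (double_partition la) t),
      has_sum Lambda
        (fun la => q ^+ sumn la * HL_principal (double_partition la) t) rhs1
    & rhs1 = rhs2].
Proof.
move=> kappa Lambda t rhs1 rhs2; split.
- move=> la /andP[pla lam]; apply: cong_converges => N; exact: cong_HL_principal lam.
(* The stability lemma with no condition on the levels provides the limit of the level sums before
   its value is known. *)
- have [a aP] : exists a, forall N : nat, cong N (level_sum t q m (qpowers N)) a.
    exact: (restricted_sum_limit m hn (P := predT) (vge0_qX 1) (fun=> erefl)).
  rewrite [rhs1](_ : _ = a); first exact: has_sum_level_sum aP.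
  by rewrite (level_sum_limit hn aP).
exact: product_sides_eq.
Qed.
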